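(* Let $(\lambda_n)_{n\in\mathbb{Z}}$ be real numbers such that $\{e^{i\lambda_n t}\}_{n\in\mathbb{Z}}$ is a Schauder basis for $L^2(0,1)$, and let $\{r_n\}_{n\in\mathbb{Z}}$ be its dual Schauder basis for $L^2(0,1)$. Let $A\subset\mathbb{Z}$ be a set with $|A|=M$ for some positive integer $M$, and let $\alpha>0$ be a real number. Then: (1) The system $\{t^{\alpha}\, r_n(t)\}_{n\in\mathbb{Z}\setminus A}$ is complete and minimal in $L^2(0,1)$ if and only if $\alpha\in[M-\tfrac12,\,M+\tfrac12)$. (2) For every $\alpha\in[M-\tfrac12,\,M+\tfrac12)$, the system $\{t^{\alpha}\, r_n(t)\}_{n\in\mathbb{Z}\setminus A}$ is not a Riesz basis for $L^2(0,1)$ and is not a frame for $L^2(0,1)$. (3) In particular, the weighted trigonometric system $\{t^{\alpha}e^{2\pi i n t}\}_{n\in\mathbb{Z}\setminus A}$ is complete and minimal in $L^2(0,1)$ if and only if $\alpha\in[M-\tfrac12,\,M+\tfrac12)$; but for every such $\alpha$ it is not even a Schauder basis for $L^2(0,1)$.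
   Context: $L^2(0,1)$ is the complex Hilbert space of (classes of) square-integrable complex-valued functions on $(0,1)$ with $\langle f,g\rangle=\int_0^1 f(t)\overline{g(t)}\,dt$. Let $\mathcal{H}$ be a separable Hilbert space and $F=\{f_n\}_{n\in J}$ a family in $\mathcal{H}$ indexed by $J\subset\mathbb{Z}$. $F$ is complete if its closed linear span is $\mathcal{H}$. $F$ is minimal if no $f_n$ lies in the closed linear span of $\{f_m\}_{m\in J,\,m\neq n}$; equivalently, there is a biorthogonal family $\{g_n\}_{n\in J}$ in $\mathcal{H}$, i.e. $\langle f_n,g_m\rangle=1$ if $n=m$ and $0$ if $n\ne m$. $F$ is exact if it is complete and minimal; in that case the biorthogonal family is unique. An exact system $F$ (with infinite index set $J$) is a Schauder basis for $\mathcal{H}$ if, for some enumeration of $J$ (fixed once and for all, independent of $f$), every $f\in\mathcal{H}$ can be written with unique scalars $d_{f,n}$ as $f=\sum_{n\in J}d_{f,n}f_n$, the series converging in norm when summed in the order of that enumeration (convergence may be conditional). The unique biorthogonal family $\{g_n\}_{n\in J}$ of a Schauder basis $F$ is then itself a Schauder basis, called the dual Schauder basis of $F$, and $f=\sum_{n\in J}\langle f,g_n\rangle f_n=\sum_{n\in J}\langle f,f_n\rangle g_n$ for all $f\in\mathcal{H}$. $F$ is a Riesz basis for $\mathcal{H}$ if $f_n=V(e_n)$ for all $n\in J$, where $\{e_n\}_{n\in J}$ is an orthonormal basis of $\mathcal{H}$ and $V$ is a bounded bijective linear operator from $\mathcal{H}$ onto $\mathcal{H}$. $F$ is a frame for $\mathcal{H}$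 if there are constants $0<a\le b<\infty$ with $a\|f\|^2\le\sum_{n\in J}|\langle f,f_n\rangle|^2\le b\|f\|^2$ for all $f\in\mathcal{H}$. *)

(* Defs.v *)
From HB Require Import structures.
From mathcomp Require Import all_boot all_order all_algebra.
From mathcomp Require Import all_classical all_reals all_analysis.
From mathcomp Require Import complex measurable_realfun ring lra.

Set Implicit Arguments.
Unset Strict Implicit.
Unset Printing Implicit Defensive.

Import Order.TTheory GRing.Theory Num.Theory.
Import numFieldNormedType.Exports.

Local Open Scope classical_set_scope.
Local Open Scope complex_scope.
Local Open Scope ring_scope.
Local Open Scope quotient_scope.

Local Notation Re := (@complex.Re _).
Local Notation Im := (@complex.Im _).

Section Systems.
Context {K : numFieldType} {H : normedModType K} {I : choiceType}.
Implicit Types (f g : I -> H) (J : set I).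

Definition lspan f J : set H :=
  [set x | exists s : seq I, exists c : I -> K,
     (forall n, n \in s -> J n) /\ x = \sum_(n <- s) c n *: f n].

Definition complete_system f J := closure (lspan f J) = [set: H].

Definition minimal_system f J :=
  forall n, J n -> ~ closure (lspan f (J `\ n)) (f n).

Definition exact_system f J := complete_system f J /\ minimal_system f J.

(* The coefficients are indexed by the position in the enumeration [e] of [J],
   so uniqueness says nothing about indices outside [J]. *)
Definition schauder_basis f J :=
  exact_system f J /\
  exists2 e : nat -> I, set_bij [set: nat] J e &
    forall x : H, exists! d : nat -> K,
      series (fun k => d k *: f (e k)) @ \oo --> x.

End Systems.

(* [`|z|] is itself an element of [R[i]], with zero imaginary part. *)
Definition sqmod {R : rcfType} (z : R[i]) : R := Re (`|z| ^+ 2).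

Section HilbertSystems.
Context {R : realType} {H : normedModType R[i]} {I : choiceType}.
Variable dot : {dot H for Num.conj}.
Implicit Types (f g : I -> H) (J : set I).

(* When [f] is a Schauder basis, the only family biorthogonal to it is its dual
   Schauder basis. *)
Definition biorthogonal f g J :=
  forall n m, J n -> J m -> dot (f n) (g m) = (n == m)%:R.

Definition orthonormal_basis f J := biorthogonal f f J /\ complete_system f J.

Definition riesz_basis f J :=
  exists (e : I -> H) (V : {linear H -> H}),
    [/\ orthonormal_basis e J,
        exists M : R, forall x, `|V x| <= M%:C * `|x|,
        bijective V &
        forall n, J n -> f n = V (e n)].

Definition is_frame f J :=
  exists a b : R, [/\ 0 < a, a <= b & forall x : H,
    ((a * sqmod `|x|)%:E <= \esum_(n in J) (sqmod (dot x (f n)))%:E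
       <= (b * sqmod `|x|)%:E)%E].

End HilbertSystems.

Section InnerProductNorm.
Context {C : numClosedFieldType} {U : lmodType C} (dot : {dot U for Num.conj}).

Lemma dot_cauchy_schwarz x y : `|dot x y| ^+ 2 <= dot x x * dot y y.
Proof.
have [->|y0] := eqVneq y 0; first
  by rewrite linear0r normr0 expr0n /= mulr_ge0 //; exact: dnorm_ge0.
have dy : 0 < dot y y by exact: neq0_dnorm_gt0.
pose a := dot x y / dot y y.
have := dnorm_ge0 dot (x - a *: y).
have -> : dot (x - a *: y) (x - a *: y) =
    dot x x - `|dot x y| ^+ 2 / dot y y.
  have ryy : (dot y y)^* = dot y y by rewrite conj_Creal ?gtr0_real.
  have xay : dot x (a *: y) = a^* * dot x y by exact: linearZr_LR.
  rewrite dnormB dnormZ xay /= /a !normCK.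
  rewrite !(rmorphM, fmorphV, conjCK, ryy) /= !(rmorphM, fmorphV, conjCK, ryy) /=.
  by field; rewrite gt_eqF.
by rewrite subr_ge0 ler_pdivrMr.
Qed.

Lemma sqrt_dot_triangle x y :
  sqrtC (dot (x + y) (x + y)) <= sqrtC (dot x x) + sqrtC (dot y y).
Proof.
have sx : 0 <= sqrtC (dot x x) by rewrite sqrtC_ge0 dnorm_ge0.
have sy : 0 <= sqrtC (dot y y) by rewrite sqrtC_ge0 dnorm_ge0.
rewrite -(@ler_pXn2r _ 2%N) ?nnegrE ?addr_ge0 ?sqrtC_ge0 ?dnorm_ge0 //.
rewrite sqrtCK sqrrD !sqrtCK dnormD /= [leRHS]addrAC lerD2l.
have h : `|dot x y| <= sqrtC (dot x x) * sqrtC (dot y y).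
  rewrite -(@ler_pXn2r _ 2%N) ?nnegrE ?mulr_ge0 //.
  by rewrite exprMn !sqrtCK dot_cauchy_schwarz.
have : dot x y + (dot x y)^* <= `|dot x y| *+ 2.
  rewrite mulr2n; have := ler_normD (dot x y) (dot x y)^*.
  rewrite norm_conjC; apply: le_trans; apply: real_ler_norm.
  by rewrite CrealE rmorphD /= conjCK addrC.
by move=> /le_trans; apply; rewrite lerMn2r.
Qed.

Lemma sqrt_dotZ a x : sqrtC (dot (a *: x) (a *: x)) = `|a| * sqrtC (dot x x).
Proof. by rewrite dnormZ sqrtCM ?nnegrE ?exprn_ge0 ?dnorm_ge0 // sqrCK. Qed.

Lemma sqrt_dot_eq0 x : sqrtC (dot x x) = 0 -> x = 0.
Proof. by move/eqP; rewrite sqrtC_eq0 dnorm_eq0 => /eqP. Qed.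

End InnerProductNorm.

Section L2_01.
Context {R : realType}.
Local Notation mu := (@lebesgue_measure R).
Local Notation D := (`]0%R, 1%R[%classic : set R).
Implicit Types f g : R -> R[i].

Definition square_integrable f :=
  [/\ measurable_fun D (fun t => Re (f t)),
      measurable_fun D (fun t => Im (f t)) &
      (\int[mu]_(t in D) (sqmod (f t))%:E < +oo)%E].

Definition complex_integral f : R[i] :=
  (\int[mu]_(t in D) Re (f t)) +i* (\int[mu]_(t in D) Im (f t)).

Lemma sqmodE (z : R[i]) : sqmod z = Re z ^+ 2 + Im z ^+ 2.
Proof. by rewrite /sqmod -add_Re2_Im2. Qed.

Let rl2 (u : R -> R) :=
  measurable_fun D u /\ mu.-integrable D (EFin \o (fun t => u t ^+ 2)).

Let mD : measurable (D : set (measurableTypeR R)).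
Proof. exact: measurable_itv. Qed.

Let rl2M u v : rl2 u -> rl2 v -> mu.-integrable D (EFin \o (fun t => u t * v t)).
Proof.
move=> [mu_ iu] [mv iv]; have iuv := integrableD mD iu iv.
apply: (le_integrable mD _ _ iuv).
  by apply/measurable_EFinP; exact: measurable_funM.
move=> t _ /=; rewrite lee_fin (ger0_norm (addr_ge0 _ _)) ?sqr_ge0 //.
by rewrite ler_norml; apply/andP; split; nra.
Qed.

Let rl2D u v : rl2 u -> rl2 v -> rl2 (fun t => u t + v t).
Proof.
move=> hu hv; have iuv := rl2M hu hv.
have mUV : measurable_fun D (fun t => u t + v t).
  by apply: measurable_funD; [case: hu|case: hv].
split=> //; case: hu hv => [mu_ iu] [mv iv].
have i4 := integrableD mD (integrableD mD iu iv) (integrableD mD iuv iuv).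
apply: eq_integrable i4 => //.
by move=> t _ /=; rewrite -!EFinD; congr EFin; ring.
Qed.

Let rl2Z a u : rl2 u -> rl2 (fun t => a * u t).
Proof.
move=> [mu_ iu]; split; first exact: measurable_funM.
have := integrableZl mD (a ^+ 2) iu; apply: eq_integrable => //.
by move=> t _ /=; rewrite -EFinM exprMn.
Qed.

Let square_integrableP f :
  square_integrable f <-> rl2 (fun t => Re (f t)) /\ rl2 (fun t => Im (f t)).
Proof.
split=> [[mr mi fi]|[[mr ir] [mi ii]]].
  have ifi : mu.-integrable D (fun t => (sqmod (f t))%:E).
    apply/integrableP; split.
      apply/measurable_EFinP.
      rewrite (_ : (fun t => sqmod (f t)) =
        (fun t => Re (f t) ^+ 2 + Im (f t) ^+ 2)); last first.
        by apply/funext => t; exact: sqmodE.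
      by apply: measurable_funD; exact: measurable_funX.
    apply: le_lt_trans fi; rewrite le_eqVlt; apply/orP; left; apply/eqP.
    apply: eq_integral => t _ /=.
    by rewrite ger0_norm // sqmodE addr_ge0 ?sqr_ge0.
  split; split=> //; apply: (le_integrable mD _ _ ifi) => [|t _].
  - by apply/measurable_EFinP; exact: measurable_funX.
  - by rewrite /= sqmodE lee_fin !ger0_norm ?addr_ge0 ?sqr_ge0 // lerDl sqr_ge0.
  - by apply/measurable_EFinP; exact: measurable_funX.
  - by rewrite /= sqmodE lee_fin !ger0_norm ?addr_ge0 ?sqr_ge0 // lerDr sqr_ge0.
split=> //.
have /integrableP[_] := integrableD mD ir ii; apply: le_lt_trans.
rewrite le_eqVlt; apply/orP; left; apply/eqP; apply: eq_integral => t _ /=.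
by rewrite sqmodE ger0_norm ?addr_ge0 ?sqr_ge0.
Qed.

Definition L2_pred : {pred R -> R[i]} := [pred f | `[< square_integrable f >]].

Lemma L2_submod_closed : submod_closed L2_pred.
Proof.
split=> [|a f g]; rewrite !inE.
  apply/square_integrableP.
  have h : rl2 (fun=> 0).
    split=> //; have := integrable0 mu D; apply: eq_integrable => //.
    by move=> t _ /=; rewrite expr0n.
  by split.
move=> /square_integrableP[fr fi] /square_integrableP[gr gi].
apply/square_integrableP; case: a => a b; split.
- have := rl2D (rl2D (rl2Z a fr) (rl2Z (- b) fi)) gr.
  congr rl2; apply/funext => t.
  rewrite (_ : ((a +i* b) *: f + g) t = (a +i* b) * f t + g t) //.
  by case: (f t) (g t) => [? ?] [? ?] /=; ring.
- have := rl2D (rl2D (rl2Z a fi) (rl2Z b fr)) gi.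
  congr rl2; apply/funext => t.
  rewrite (_ : ((a +i* b) *: f + g) t = (a +i* b) * f t + g t) //.
  by case: (f t) (g t) => [? ?] [? ?] /=; ring.
Qed.

HB.instance Definition _ := GRing.isSubmodClosed.Build _ _ L2_pred
  L2_submod_closed.

Record L2fun := L2Fun { L2fun_val :> R -> R[i]; _ : L2fun_val \in L2_pred }.
HB.instance Definition _ := [isSub for L2fun_val].
HB.instance Definition _ := [Choice of L2fun by <:].
HB.instance Definition _ := [SubChoice_isSubLmodule of L2fun by <:].


Definition L2_equiv (f g : L2fun) := `[< f = g %[ae mu in D] >].

Let L2_equiv_refl : reflexive L2_equiv.
Proof. by move=> f; apply/asboolP; exact: ae_eq_refl. Qed.

Let L2_equiv_sym : symmetric L2_equiv.
Proof. by move=> f g; apply/asboolP/asboolP; exact: ae_eq_sym. Qed.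

Let L2_equiv_trans : transitive L2_equiv.
Proof.
by move=> g f h /asboolP fg /asboolP gh; apply/asboolP/(ae_eq_trans fg gh).
Qed.

Canonical L2_equiv_canonical :=
  EquivRel L2_equiv L2_equiv_refl L2_equiv_sym L2_equiv_trans.

Definition L2 : Type := {eq_quot L2_equiv}.
HB.instance Definition _ := Choice.on L2.
HB.instance Definition _ := EqQuotient.on L2.

Lemma L2_eqP (f g : L2fun) :
  (\pi_L2 f = \pi_L2 g) <-> f = g %[ae mu in D].
Proof. by split=> [/eqmodP/asboolP|fg]; last exact/eqmodP/asboolP. Qed.

Lemma L2_ind (P : L2 -> Prop) : (forall f : L2fun, P (\pi_L2 f)) -> forall x, P x.
Proof. by move=> Pf x; rewrite -[x]reprK. Qed.

Let reprK_ae (f : L2fun) : repr (\pi_L2 f) = f %[ae mu in D].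
Proof. by apply/L2_eqP; rewrite reprK. Qed.

Definition L2_zero : L2 := \pi_L2 0.
Definition L2_opp (x : L2) : L2 := \pi_L2 (- repr x).
Definition L2_add (x y : L2) : L2 := \pi_L2 (repr x + repr y).
Definition L2_scale (a : R[i]) (x : L2) : L2 := \pi_L2 (a *: repr x).

Let aeF := ae_filter_ringOfSetsType mu.

Let piN (f : L2fun) : L2_opp (\pi_L2 f) = \pi_L2 (- f).
Proof.
apply/L2_eqP; apply: (@filterS _ _ aeF) (reprK_ae f) => t ft Dt.
by rewrite -[LHS]/(- (repr (\pi_L2 f) t)) -[RHS]/(- (f t)) ft.
Qed.

Let piD (f g : L2fun) : L2_add (\pi_L2 f) (\pi_L2 g) = \pi_L2 (f + g).
Proof.
apply/L2_eqP; apply: (@filterS2 _ _ aeF) (reprK_ae f) (reprK_ae g) => t ft gt Dt.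
rewrite -[LHS]/(repr (\pi_L2 f) t + repr (\pi_L2 g) t) -[RHS]/(f t + g t).
by rewrite (ft Dt) (gt Dt).
Qed.

Let piZ a (f : L2fun) : L2_scale a (\pi_L2 f) = \pi_L2 (a *: f).
Proof.
apply/L2_eqP; apply: (@filterS _ _ aeF) (reprK_ae f) => t ft Dt.
by rewrite -[LHS]/(a * repr (\pi_L2 f) t) -[RHS]/(a * f t) ft.
Qed.

Let L2_addA : associative L2_add.
Proof.
move=> x y z; elim/L2_ind: x => f; elim/L2_ind: y => g; elim/L2_ind: z => h.
by rewrite !piD addrA.
Qed.

Let L2_addC : commutative L2_add.
Proof. by move=> x y; elim/L2_ind: x => f; elim/L2_ind: y => g; rewrite !piD addrC. Qed.

Let L2_add0 : left_id L2_zero L2_add.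
Proof. by move=> x; elim/L2_ind: x => f; rewrite piD add0r. Qed.

Let L2_addN : left_inverse L2_zero L2_opp L2_add.
Proof. by move=> x; elim/L2_ind: x => f; rewrite piN piD addNr. Qed.

HB.instance Definition _ :=
  GRing.isZmodule.Build L2 L2_addA L2_addC L2_add0 L2_addN.

Let L2_scaleA a b x : L2_scale a (L2_scale b x) = L2_scale (a * b) x.
Proof. by elim/L2_ind: x => f; rewrite !piZ scalerA. Qed.

Let L2_scale1 : left_id 1 L2_scale.
Proof. by move=> x; elim/L2_ind: x => f; rewrite piZ scale1r. Qed.

Let L2_scaleDr : right_distributive L2_scale +%R.
Proof.
move=> a x y; elim/L2_ind: x => f; elim/L2_ind: y => g.
rewrite -[LHS]/(L2_scale a (L2_add _ _)).
rewrite -[RHS]/(L2_add (L2_scale _ _) (L2_scale _ _)).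
by rewrite !(piD, piZ) scalerDr.
Qed.

Let L2_scaleDl x : {morph L2_scale^~ x : a b / a + b}.
Proof.
elim/L2_ind: x => f a b; rewrite -[RHS]/(L2_add _ _).
by rewrite !(piD, piZ) scalerDl.
Qed.

HB.instance Definition _ := GRing.Zmodule_isLmodule.Build R[i] L2
  L2_scaleA L2_scale1 L2_scaleDr L2_scaleDl.

Lemma L2_piD (f g : L2fun) : \pi_L2 (f + g) = \pi_L2 f + \pi_L2 g :> L2.
Proof. by rewrite -piD. Qed.

Lemma L2_piZ a (f : L2fun) : \pi_L2 (a *: f) = a *: \pi_L2 f :> L2.
Proof. by rewrite -piZ. Qed.

Definition L2_dot (x y : L2) : R[i] :=
  complex_integral (fun t => repr x t * (repr y t)^*).

Let ReM (z w : R[i]) : Re (z * w^*) = Re z * Re w + Im z * Im w.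
Proof. by case: z w => ? ? [? ?] /=; ring. Qed.

Let ImM (z w : R[i]) : Im (z * w^*) = Im z * Re w - Re z * Im w.
Proof. by case: z w => ? ? [? ?] /=; ring. Qed.

Let L2funP (f : L2fun) : square_integrable f.
Proof. by case: f => f /= /[!inE]. Qed.

Let int_prod (f g : L2fun) :
  mu.-integrable D (EFin \o (fun t => Re (f t * (g t)^*))) /\
  mu.-integrable D (EFin \o (fun t => Im (f t * (g t)^*))).
Proof.
have /square_integrableP[fr fi] := L2funP f.
have /square_integrableP[gr gi] := L2funP g.
split.
  have := integrableD mD (rl2M fr gr) (rl2M fi gi); apply: eq_integrable => //.
  by move=> t _ /=; rewrite -EFinD ReM.
have := integrableB mD (rl2M fi gr) (rl2M fr gi); apply: eq_integrable => //.
by move=> t _ /=; rewrite -EFinB ImM.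
Qed.

Let int_meas (u : R -> R) : mu.-integrable D (EFin \o u) ->
  measurable_fun (D : set (measurableTypeR R)) (EFin \o u).
Proof. by move=> /integrableP[]. Qed.

Let eq_cint (f g h k : L2fun) :
  f = h %[ae mu in D] -> g = k %[ae mu in D] ->
  complex_integral (fun t => f t * (g t)^*) =
  complex_integral (fun t => h t * (k t)^*).
Proof.
move=> fh gk; have [i1 i2] := int_prod f g; have [j1 j2] := int_prod h k.
congr (_ +i* _); congr fine; apply: ae_eq_integral => //.
- exact: int_meas.
- exact: int_meas.
- apply: (@filterS2 _ _ aeF) fh gk => t ft gt Dt.
  by rewrite /= (ft Dt) (gt Dt).
- exact: int_meas.
- exact: int_meas.
- apply: (@filterS2 _ _ aeF) fh gk => t ft gt Dt.
  by rewrite /= (ft Dt) (gt Dt).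
Qed.

Lemma L2_dotE (f g : L2fun) :
  L2_dot (\pi_L2 f) (\pi_L2 g) = complex_integral (fun t => f t * (g t)^*).
Proof. exact: eq_cint. Qed.

Let addE (f g : L2fun) t : (f + g) t = f t + g t.
Proof. by []. Qed.

Let scaleE a (f : L2fun) t : (a *: f) t = a * f t.
Proof. by []. Qed.

Let L2_dotDl (x y z : L2) : L2_dot (x + y) z = L2_dot x z + L2_dot y z.
Proof.
elim/L2_ind: x => f; elim/L2_ind: y => g; elim/L2_ind: z => h.
rewrite -L2_piD !L2_dotE.
have [i1 i2] := int_prod f h; have [j1 j2] := int_prod g h.
apply/eqP; rewrite eq_complex /=; apply/andP; split; apply/eqP.
  rewrite -RintegralD //; congr fine; apply: eq_integral => t _ /=.
  congr EFin; apply: (etrans (congr1 (fun z => Re (z * _)) (addE f g t))).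
  by rewrite !ReM; case: (f t) (g t) (h t) => ? ? [? ?] [? ?] /=; ring.
rewrite -RintegralD //; congr fine; apply: eq_integral => t _ /=.
congr EFin; apply: (etrans (congr1 (fun z => Im (z * _)) (addE f g t))).
by rewrite !ImM; case: (f t) (g t) (h t) => ? ? [? ?] [? ?] /=; ring.
Qed.

Let L2_dotZl a (x z : L2) : L2_dot (a *: x) z = a * L2_dot x z.
Proof.
elim/L2_ind: x => f; elim/L2_ind: z => h.
rewrite -L2_piZ !L2_dotE.
have [i1 i2] := int_prod f h; case: a => a b.
apply/eqP; rewrite eq_complex /=; apply/andP; split; apply/eqP.
  rewrite -!RintegralZl // -RintegralB //; last 2 first.
  - by have := integrableZl mD a i1; apply: eq_integrable.
  - by have := integrableZl mD b i2; apply: eq_integrable.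
  congr fine; apply: eq_integral => t _ /=.
  congr EFin; apply: (etrans (congr1 (fun z => Re (z * _)) (scaleE _ f t))).
  by rewrite !(ReM, ImM); case: (f t) (h t) => ? ? [? ?] /=; ring.
rewrite -!RintegralZl // -RintegralD //; last 2 first.
- by have := integrableZl mD a i2; apply: eq_integrable.
- by have := integrableZl mD b i1; apply: eq_integrable.
congr fine; apply: eq_integral => t _ /=.
congr EFin; apply: (etrans (congr1 (fun z => Im (z * _)) (scaleE _ f t))).
by rewrite !(ReM, ImM); case: (f t) (h t) => ? ? [? ?] /=; ring.
Qed.

Let L2_dotC (x y : L2) : L2_dot x y = (L2_dot y x)^*.
Proof.
elim/L2_ind: x => f; elim/L2_ind: y => g; rewrite !L2_dotE.
have [i1 i2] := int_prod g f.
apply/eqP; rewrite eq_complex /=; apply/andP; split; apply/eqP.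
  by congr fine; apply: eq_integral => t _ /=; rewrite !ReM; congr EFin; ring.
rewrite -mulN1r -RintegralZl //.
by congr fine; apply: eq_integral => t _ /=; rewrite !ImM; congr EFin; ring.
Qed.

Let L2_dotBl (x y z : L2) : L2_dot (x - y) z = L2_dot x z - L2_dot y z.
Proof. by rewrite -scaleN1r L2_dotDl L2_dotZl mulN1r. Qed.

Let L2_dotBr (x y z : L2) : L2_dot x (y - z) = L2_dot x y - L2_dot x z.
Proof.
by rewrite L2_dotC L2_dotBl rmorphB /= -[in LHS]L2_dotC -[in LHS]L2_dotC.
Qed.

Let L2_dotZr a (x y : L2) : L2_dot x (a *: y) = a^* * L2_dot x y.
Proof. by rewrite L2_dotC L2_dotZl rmorphM /= -[in LHS]L2_dotC. Qed.

HB.instance Definition _ :=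
  @isBilinear.Build R[i] L2 L2 R[i] ( *%R ) (Num.conj \; *%R) L2_dot
    (fun z x y => L2_dotBl x y z) (fun x y z => L2_dotBr x y z)
    (fun z a x => L2_dotZl a x z) (fun x a y => L2_dotZr a x y).

Let L2_dot_herm (x y : L2) :
  L2_dot x y = (-1) ^+ false * Num.conj (L2_dot y x).
Proof. by rewrite expr0 mul1r L2_dotC. Qed.

HB.instance Definition _ :=
  @isHermitianSesquilinear.Build R[i] L2 false Num.conj L2_dot L2_dot_herm.

Let L2_dot_gt0 (x : L2) : x != 0 -> 0 < L2_dot x x.
Proof.
elim/L2_ind: x => f f0; rewrite L2_dotE ltcE /=; apply/andP; split.
  apply/eqP; rewrite /Rintegral (eq_integral (cst 0%E)) ?integral0 // => t _ /=.
  by rewrite ImM; congr EFin; ring.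
have e (t : R) : Re (f t * (f t)^*) = sqmod (f t).
  by rewrite ReM sqmodE !expr2.
rewrite lt_neqAle; apply/andP; split; last first.
  by apply: Rintegral_ge0 => t _; rewrite e sqmodE addr_ge0 ?sqr_ge0.
apply: contra f0; rewrite eq_sym => /eqP f0; apply/eqP.
rewrite -[RHS]/(\pi_L2 0); apply/L2_eqP.
have [i1 _] := int_prod f f.
have : (\int[mu]_(t in D) `|(Re (f t * (f t)^*))%:E| = 0)%E.
  under eq_integral => t _.
    rewrite gee0_abs; last by rewrite lee_fin e sqmodE addr_ge0 ?sqr_ge0.
    over.
  rewrite -[LHS]fineK; last exact: integrable_fin_num.
  by congr EFin; exact: f0.
move/(ae_eq_integral_abs mu mD (int_meas i1)).
apply: (@filterS _ _ aeF) => t /= ft Dt.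
have := ft Dt; rewrite e sqmodE => -[].
move/eqP; rewrite paddr_eq0 ?sqr_ge0 // !sqrf_eq0 => /andP[/eqP a0 /eqP b0].
by apply/eqP; rewrite eq_complex a0 b0 eqxx.
Qed.

HB.instance Definition _ :=
  @isDotProduct.Build R[i] L2 L2_dot L2_dot_gt0.

HB.instance Definition _ := Lmodule_isNormed.Build R[i] L2
  (sqrt_dot_triangle L2_dot) (sqrt_dotZ L2_dot) (sqrt_dot_eq0 (dot := L2_dot)).

Lemma L2_normE (x : L2) : `|x| = sqrtC (L2_dot x x).
Proof. by []. Qed.

(* The value 0 is a default, taken only when [f] is not square integrable; see
   [L2_exp_square_integrable] and [L2_mulpow_square_integrable] below. *)
Definition L2_class (f : R -> R[i]) : L2 := \pi_L2 (insubd 0 f).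

Lemma L2_classE (f : R -> R[i]) : square_integrable f ->
  repr (L2_class f) = f %[ae mu in D].
Proof.
move=> fP; have fL2 : f \in L2_pred by rewrite inE.
apply: (@filterS _ _ aeF) (reprK_ae (insubd 0 f)) => t ft Dt.
by rewrite (ft Dt); exact: (congr1 (@^~ t) (insubdK 0 fL2)).
Qed.

Definition L2_exp (l : R) : L2 :=
  L2_class (fun t => cos (l * t) +i* sin (l * t)).

Definition L2_mulpow (alpha : R) (x : L2) : L2 :=
  L2_class (fun t => (t `^ alpha)%:C * repr x t).

Lemma L2_exp_square_integrable (l : R) :
  square_integrable (fun t => cos (l * t) +i* sin (l * t)).
Proof.
have mM : measurable_fun D (fun t => l * t) by exact: measurable_funM.
split=> /=.
- exact: measurableT_comp (continuous_measurable_fun (@continuous_cos R)) mM.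
- exact: measurableT_comp (continuous_measurable_fun (@continuous_sin R)) mM.
under eq_integral do rewrite sqmodE /= cos2Dsin2.
by rewrite integral_cst //= mul1e lebesgue_measure_itv /= lte01 sube0 ltry.
Qed.

Lemma L2_mulpow_square_integrable (alpha : R) (f : R -> R[i]) : 0 <= alpha ->
  square_integrable f ->
  square_integrable (fun t => (t `^ alpha)%:C * f t).
Proof.
move=> a0 [mr mi fi]; have mp : measurable_fun D (fun t => t `^ alpha).
  by apply: measurable_funTS; exact: measurable_powR.
have [er ei] : (forall t, Re ((t `^ alpha)%:C * f t) = t `^ alpha * Re (f t)) /\
  (forall t, Im ((t `^ alpha)%:C * f t) = t `^ alpha * Im (f t)).
  by split=> t; case: (f t) => ? ? /=; ring.
have mr' : measurable_fun D (fun t => Re ((t `^ alpha)%:C * f t)).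
  by rewrite (funext er); exact: measurable_funM.
have mi' : measurable_fun D (fun t => Im ((t `^ alpha)%:C * f t)).
  by rewrite (funext ei); exact: measurable_funM.
have ms g : measurable_fun D (fun t => Re (g t)) ->
  measurable_fun D (fun t => Im (g t)) ->
  measurable_fun (D : set (measurableTypeR R)) (fun t => (sqmod (g t))%:E).
  move=> h1 h2; apply/measurable_EFinP.
  rewrite (_ : (fun t => sqmod (g t)) =
    (fun t => Re (g t) ^+ 2 + Im (g t) ^+ 2)); last first.
    by apply/funext => t; exact: sqmodE.
  by apply: measurable_funD; exact: measurable_funX.
have s0 (z : R[i]) : (0 <= (sqmod z)%:E)%E.
  by rewrite lee_fin sqmodE addr_ge0 ?sqr_ge0.
split=> //; apply: le_lt_trans fi; apply: ge0_le_integral => //.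
- exact: (ms (fun t => (t `^ alpha)%:C * f t) mr' mi').
- exact: (ms f mr mi).
move=> t; rewrite /= in_itv /= => /andP[t0 t1].
have p1 : t `^ alpha <= 1.
  have e1 : (1 : R) `^ alpha = 1 by rewrite powR1.
  rewrite -[leRHS]e1; apply: ge0_ler_powR => //;
    by rewrite ?nnegrE ?ler01 ?ltW.
rewrite lee_fin !sqmodE er ei !exprMn -mulrDr ler_piMl ?addr_ge0 ?sqr_ge0 //.
by rewrite exprn_ile1 ?powR_ge0.
Qed.

End L2_01.

Arguments L2 R : clear implicits.

(* Main.v *)
(** Write [e_n = exp(i lambda_n t)]. If [g] is orthogonal to [t^alpha r_n] for
    all [n] outside a finite set [S], then [t^alpha g] is orthogonal to these
    [r_n], so [t^alpha g] is an exponential sum [sum_{n in S} c_n e_n]. By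
    Taylor's formula the order of vanishing of such a sum at 0 is the number of
    leading moments [sum c_n lambda_n^k] that vanish, and this order decides
    whether [t^{-alpha}] times the sum is square integrable. As the [lambda_n]
    are distinct, Lagrange interpolation gives, up to scaling, a unique nonzero
    sum over [M + 1] frequencies with [M] vanishing moments, and none over [M]
    frequencies; this yields completeness and minimality.

    The biorthogonal vector of [t^alpha r_n] is then
    [t^{-alpha} (e_n + sum_{m in A} c_{n,m} e_m)]. A frame, a Riesz basis or a
    Schauder basis whose vectors are bounded below would bound these vectors
    uniformly in [n]. For [M >= 2] the coefficients [c_{n,m}] blow up as
    [|lambda_n|] grows; for [M = 1] the vector is [t^{-alpha} (e_n - e_m)] and
    its norm diverges logarithmically. The [lambda_n] are unbounded because
    boundedness of the [r_n] separates them.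

    The trigonometric system is total: if all Fourier coefficients of [a]
    vanish, the trigonometric polynomials [(1 - x^n)^(2^n)], with [x] a suitable
    multiple of [1 + cos], approximate the indicator of the complement of an
    arc, so [a] integrates to 0 over arcs. *)
Require Import Defs.
From HB Require Import structures.
From mathcomp Require Import all_boot all_order all_algebra.
From mathcomp Require Import all_classical all_reals all_analysis.
From mathcomp Require Import complex measurable_realfun ring lra.

Set Implicit Arguments.
Unset Strict Implicit.
Unset Printing Implicit Defensive.

Import Order.TTheory GRing.Theory Num.Theory.
Import numFieldNormedType.Exports.

Local Open Scope classical_set_scope.
Local Open Scope complex_scope.
Local Open Scope ring_scope.

Local Notation Re := (@complex.Re _).
Local Notation Im := (@complex.Im _).

(** * Real-valued norms *)

(** The core argument rests on two properties of the r_n: biorthogonality to the e_n and totality.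
    For the trigonometric system r_n = e_n they come from orthonormality and from [L2_exp_total], so
    all three parts are instances of one argument. The interval for alpha is half-open because t^(N
    - alpha) is square integrable on (0,1) exactly for alpha < N + 1/2: equality leaves the
    divergent integral of 1/t. The coefficient c_{n,m} equals minus the product over j in A, j
    different from m, of (lambda_n - lambda_j) / (lambda_m - lambda_j), a polynomial of degree M - 1
    in lambda_n. It grows for M >= 2 but is the constant -1 for M = 1, which forces the separate
    logarithmic estimate there. Each notion is refuted through its own bound on the dual vectors:
    the lower frame inequality, surjectivity of the Riesz operator with uniform boundedness, or
    boundedness of the terms of a convergent series. The last one asks for vectors bounded below,
    and in part (3) the norm of t^alpha e_n does not depend on n. *)

Section RealNorm.
Context {R : realType} {V : normedZmodType R[i]}.
Implicit Types x y : V.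

(** Norms here are elements of [R[i]]; the real part carries all their information ([rnormE]) and
    lives in a total order. *)
Definition rnorm x : R := Re `|x|.

Lemma rnormE x : `|x| = (rnorm x)%:C.
Proof.
have := normr_ge0 x; rewrite lecE /= => /andP[/eqP h _].
by rewrite /rnorm; case: (`|x|) h => a b /= ->.
Qed.

Lemma rnorm_ge0 x : 0 <= rnorm x.
Proof. by have := normr_ge0 x; rewrite rnormE lecR. Qed.

Lemma ler_rnormD x y : rnorm (x + y) <= rnorm x + rnorm y.
Proof. by have := ler_normD x y; rewrite !rnormE -rmorphD /= lecR. Qed.

Lemma rnormN x : rnorm (- x) = rnorm x.
Proof. by rewrite /rnorm normrN. Qed.

Lemma rdistC x y : rnorm (x - y) = rnorm (y - x).
Proof. by rewrite -rnormN opprB. Qed.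

Lemma ler_rnormB x y : rnorm (x - y) <= rnorm x + rnorm y.
Proof. by rewrite -(rnormN y) ler_rnormD. Qed.

Lemma rnorm0 : rnorm 0 = 0.
Proof. by rewrite /rnorm normr0. Qed.

Lemma rnorm_eq0 x : (rnorm x == 0) = (x == 0).
Proof. by rewrite -[RHS]normr_eq0 rnormE -(inj_eq (@complexI R)). Qed.

Lemma rnorm_dist x y z : rnorm (x - z) <= rnorm (x - y) + rnorm (y - z).
Proof. by rewrite (le_trans _ (ler_rnormD _ _)) // addrA subrK. Qed.

End RealNorm.

Section RealNormComplex.
Context {R : realType}.
Implicit Types z w : R[i].

Lemma rnormM z w : rnorm (z * w) = rnorm z * rnorm w.
Proof. by apply: (@complexI R); rewrite rmorphM /= -!rnormE normrM. Qed.

Lemma rnorm_real (a : R) : rnorm (a%:C) = `|a|.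
Proof. by apply: (@complexI R); rewrite -rnormE normc_def /= expr0n addr0 sqrtr_sqr. Qed.

Lemma sqmod_rnorm z : sqmod z = rnorm z ^+ 2.
Proof. by rewrite /sqmod rnormE -rmorphXn. Qed.

End RealNormComplex.

Section RealNormModule.
Context {R : realType} {H : normedModType R[i]}.
Implicit Types x y : H.

Lemma rnormZ c x : rnorm (c *: x) = rnorm c * rnorm x.
Proof. by apply: (@complexI R); rewrite rmorphM /= -!rnormE normrZ. Qed.

Lemma closure_rnormP (S : set H) x :
  closure S x <-> forall e : R, 0 < e -> exists2 y, S y & rnorm (x - y) < e.
Proof.
split=> [cSx e e0|h B].
  have e0' : 0 < e%:C :> R[i] by rewrite ltcR.
  have [y [Sy]] := cSx _ (nbhsx_ballx x _ e0').
  rewrite -ball_normE /ball_ /= rnormE ltcR; by exists y.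
move=> /nbhs_ballP[e /= e0]; rewrite -ball_normE => eB.
(* Balls have radii in [R[i]]; a positive element there is real. *)
have : exists r : R, 0 < r /\ e = r%:C.
  move: e0; rewrite ltcE /= => /andP[/eqP i0 r0]; exists (Re e); split=> //.
  by case: (e) i0 => a b /= ->.
move=> [r [r0 er]]; have [y Sy xy] := h r r0; exists y; split=> //.
by apply: eB; rewrite /ball_ /= rnormE er ltcR.
Qed.

Lemma cvg_rnormP (u : nat -> H) x : u @ \oo --> x ->
  forall e : R, 0 < e -> exists N, forall n, (N <= n)%N -> rnorm (x - u n) < e.
Proof.
move=> /cvgrPdist_lt ux e e0.
have e0' : 0 < e%:C :> R[i] by rewrite ltcR.
have [N _ h] := ux _ e0'; exists N => n Nn; have := h n Nn.
by rewrite /= rnormE ltcR.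
Qed.

End RealNormModule.

(** * Inner products and linear spans *)

Section InnerProduct.
Context {R : realType} {H : normedModType R[i]} (dot : {dot H for Num.conj}).
Hypothesis normE : forall x : H, `|x| = sqrtC (dot x x).
Implicit Types x y z : H.

Lemma dot_rnorm x : dot x x = (rnorm x ^+ 2)%:C.
Proof. by rewrite rmorphXn /= -rnormE normE sqrtCK. Qed.

Lemma rnorm_dot x : rnorm x ^+ 2 = Re (dot x x).
Proof. by rewrite dot_rnorm. Qed.

Lemma dotC x y : dot y x = (dot x y)^*.
Proof. by rewrite [LHS]hermC expr0 mul1r. Qed.

Lemma rnorm_dot_le x y : rnorm (dot x y) <= rnorm x * rnorm y.
Proof.
have := dot_cauchy_schwarz dot x y.
rewrite !dot_rnorm rnormE -!(rmorphXn, rmorphM) /= lecR -exprMn.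
by rewrite ler_pXn2r // nnegrE ?mulr_ge0 ?rnorm_ge0.
Qed.

Lemma rnorm_sqrD x y :
  rnorm (x + y) ^+ 2 = rnorm x ^+ 2 + rnorm y ^+ 2 + 2 * Re (dot x y).
Proof.
rewrite !rnorm_dot linearDl !linearDr /= (dotC x y).
case: (dot x y) => a b; case: (dot x x) => c d; case: (dot y y) => e f /=.
rewrite /=; ring.
Qed.

Lemma rnorm_sqrB x y :
  rnorm (x - y) ^+ 2 = rnorm x ^+ 2 + rnorm y ^+ 2 - 2 * Re (dot x y).
Proof.
rewrite rnorm_sqrD rnormN linearNr /=.
by case: (dot x y) => a b /=; ring.
Qed.

Lemma parallelogram x y :
  rnorm (x + y) ^+ 2 + rnorm (x - y) ^+ 2 = 2 * rnorm x ^+ 2 + 2 * rnorm y ^+ 2.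
Proof. by rewrite rnorm_sqrD rnorm_sqrB; ring. Qed.

(** The product with [g] vanishes on the span and is continuous by Cauchy-Schwarz. Tolerances are
    divided by [rnorm g + 1] because [g] may be 0. *)
Lemma closure_orthogonal (I : choiceType) (f : I -> H) (J : set I) x g :
  (forall n, J n -> dot (f n) g = 0) -> closure (lspan f J) x -> dot x g = 0.
Proof.
move=> fg /closure_rnormP h; apply/eqP; rewrite -rnorm_eq0.
rewrite eq_le rnorm_ge0 andbT; apply/ler_addgt0Pr => e e0; rewrite add0r.
have [|y [s [c [sJ ye]]]] := h (e / (rnorm g + 1)).
  by rewrite divr_gt0 // ltr_wpDl ?rnorm_ge0.
have : dot y g = 0.
  rewrite ye linear_sumlz big_seq big1 // => n ns.
  by rewrite linearZl_LR /= fg ?mulr0 //; exact: sJ.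
move=> yg xy; have -> : dot x g = dot (x - y) g by rewrite linearBl /= yg subr0.
apply: le_trans (rnorm_dot_le _ _) _.
rewrite (@le_trans _ _ (e / (rnorm g + 1) * (rnorm g + 1))) //.
  by rewrite ler_pM ?rnorm_ge0 ?(ltW xy) // lerDl.
by rewrite divfK // gt_eqF // ltr_wpDl ?rnorm_ge0.
Qed.

(** All partial sums that contain the term [k] have the same product with [g], and the product is
    continuous. *)
Lemma series_dot (x g : H) (u : nat -> H) (k : nat) :
  series u @ \oo --> x -> (forall j, j != k -> dot (u j) g = 0) ->
  dot x g = dot (u k) g.
Proof.
move=> /cvg_rnormP ux ug; apply/eqP; rewrite -subr_eq0 -rnorm_eq0.
rewrite eq_le rnorm_ge0 andbT; apply/ler_addgt0Pr => e e0; rewrite add0r.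
have [|N hN] := ux (e / (rnorm g + 1)).
  by rewrite divr_gt0 // ltr_wpDl ?rnorm_ge0.
have {hN}xy := hN (N + k.+1)%N (leq_addr _ _).
have yg : dot (series u (N + k.+1)%N) g = dot (u k) g.
  rewrite /series /= linear_sumlz /= big_mkord.
  have kl : (k < N + k.+1)%N by rewrite ltn_addl.
  rewrite (bigD1 (Ordinal kl)) //= big1 ?addr0 // => j jk.
  by apply: ug; apply: contra jk => /eqP jk; apply/eqP/val_inj.
rewrite -yg -linearBl; apply: le_trans (rnorm_dot_le _ _) _.
rewrite (@le_trans _ _ (e / (rnorm g + 1) * (rnorm g + 1))) //.
  by rewrite ler_pM ?rnorm_ge0 ?(ltW xy) // lerDl.
by rewrite divfK // gt_eqF // ltr_wpDl ?rnorm_ge0.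
Qed.

Lemma lspan_gen (I : choiceType) (f : I -> H) (J : set I) n :
  J n -> lspan f J (f n).
Proof.
move=> Jn; exists [:: n], (fun=> 1); rewrite big_seq1 scale1r; split=> // m.
by rewrite inE => /eqP ->.
Qed.

Lemma lspanZ (I : choiceType) (f : I -> H) (J : set I) c x :
  lspan f J x -> lspan f J (c *: x).
Proof.
move=> [s [d [sJ ->]]]; exists s, (fun n => c * d n); split=> //.
by rewrite scaler_sumr; apply: eq_bigr => n _; rewrite scalerA.
Qed.

(** The lists in [lspan] may overlap and repeat entries; counting multiplicities moves two of them
    onto one common list without duplicates. *)
Lemma big_seq_count (I : eqType) (F : I -> H) (s u : seq I) :
  uniq u -> {subset s <= u} ->
  \sum_(n <- s) F n = \sum_(n <- u) F n *+ count_mem n s.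
Proof.
move=> uu; elim: s => [_|a s IH su]; first by rewrite big_nil big1.
rewrite big_cons IH => [|n ns]; last by apply: su; rewrite inE ns orbT.
under [RHS]eq_bigr do rewrite /= mulrnDr.
rewrite big_split /=; congr (_ + _).
rewrite (bigD1_seq a) ?su ?mem_head //= eqxx mulr1n big1 ?addr0 //.
by move=> n na; rewrite eq_sym (negbTE na).
Qed.

Lemma lspanD (I : choiceType) (f : I -> H) (J : set I) x y :
  lspan f J x -> lspan f J y -> lspan f J (x + y).
Proof.
move=> [s [c [sJ ->]]] [s' [c' [sJ' ->]]].
exists (undup (s ++ s')), (fun n => c n *+ count_mem n s + c' n *+ count_mem n s').
split=> [n|].
  by rewrite mem_undup mem_cat => /orP[/sJ|/sJ'].
under [RHS]eq_bigr do rewrite scalerDl.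
rewrite big_split /=; congr (_ + _); rewrite (@big_seq_count _ _ _ (undup (s ++ s'))) ?undup_uniq //.
- by apply: eq_bigr => n _; rewrite scalerMnl.
- by move=> n ns; rewrite mem_undup mem_cat ns.
- by apply: eq_bigr => n _; rewrite scalerMnl.
- by move=> n ns; rewrite mem_undup mem_cat ns orbT.
Qed.

End InnerProduct.

(** * Complete inner product spaces *)

Section Hilbert.
Context {R : realType} {H : normedModType R[i]} (dot : {dot H for Num.conj}).
Hypothesis normE : forall x : H, `|x| = sqrtC (dot x x).
(** Completeness with a rate of convergence, the form in which the projection (ratio 1/2) and the
    gliding hump (ratio 1/4) use it. *)
Hypothesis geometric_cvg : forall (x : nat -> H) (c q : R),
  0 <= c -> 0 < q -> q <= 2^-1 ->
  (forall n, rnorm (x n.+1 - x n) <= c * q ^+ n) ->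
  exists l, forall n, rnorm (l - x n) <= 2 * c * q ^+ n.
Implicit Types x y z : H.

Lemma ler_geometric (a b c : R) :
  (forall n, a <= b + c * 2^-1 ^+ n) -> a <= b.
Proof.
move=> h; have : (b + c * 2^-1 ^+ n) @[n --> \oo] --> b + c * 0.
  apply: cvgD; [exact: cvg_cst|apply: cvgM; first exact: cvg_cst].
  by apply: cvg_expr; rewrite ger0_norm ?invr_ge0 // invf_lt1 // ltr1n.
rewrite mulr0 addr0 => cv; rewrite -(cvg_lim (@Rhausdorff R) cv).
apply: limr_ge; first by apply/cvg_ex; exists b.
by apply: nearW.
Qed.

(** Moving [y] by c v with c = <x - y, v> / |v|^2 lowers the squared distance to [x] by |<x - y,
    v>|^2 / |v|^2, which minimality forces to be 0. *)
Lemma min_distance_orthogonal (S : set H) x y :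
  (forall c v, S v -> rnorm (x - y) <= rnorm (x - (y + c *: v))) ->
  forall v, S v -> dot (x - y) v = 0.
Proof.
move=> h v Sv; have [->|v0] := eqVneq v 0; first by rewrite linear0r.
have {}h c : rnorm (x - y) <= rnorm (x - y - c *: v).
  by apply: le_trans (h c v Sv) _; rewrite opprD addrA.
move: (x - y) h => g h.
have B0 : 0 < rnorm v ^+ 2.
  by rewrite exprn_gt0 // lt_neqAle rnorm_ge0 eq_sym rnorm_eq0 v0.
set B := rnorm v ^+ 2 in B0; case E : (dot g v) => [p q].
have := h ((p / B) +i* (q / B)); rewrite -(@ler_pXn2r _ 2%N) ?nnegrE ?rnorm_ge0 //.
rewrite (rnorm_sqrB normE) linearZr_LR /= E rnormZ exprMn -/B.
rewrite -sqmod_rnorm sqmodE /=.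
have -> : p / B * p - - (q / B) * q = (p ^+ 2 + q ^+ 2) / B by field; rewrite gt_eqF.
have -> : ((p / B) ^+ 2 + (q / B) ^+ 2) * B = (p ^+ 2 + q ^+ 2) / B
  by field; rewrite gt_eqF.
set X := (_ / B) => h0; have : X <= 0 by lra.
rewrite /X pmulr_lle0 ?invr_gt0 // => pq.
have : p ^+ 2 + q ^+ 2 == 0 by rewrite eq_le pq addr_ge0 ?sqr_ge0.
by rewrite paddr_eq0 ?sqr_ge0 // !sqrf_eq0 => /andP[/eqP -> /eqP ->].
Qed.

(** The separating vector is x - y, where [y] is the point of the closed span nearest to [x], the
    limit of a minimizing sequence. *)
Lemma closure_lspan_separation (I : choiceType) (f : I -> H) (J : set I) x :
  ~ closure (lspan f J) x ->
  exists g, (forall n, J n -> dot (f n) g = 0) /\ dot x g != 0.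
Proof.
move=> nx; set V := lspan f J in nx.
have V0 : V 0 by exists [::], (fun=> 0); rewrite big_nil.
pose E := [set rnorm (x - v) ^+ 2 | v in V].
have infE : has_inf E.
  by split; [exists (rnorm (x - 0) ^+ 2), 0|exists 0 => _ [v _ <-]; exact: sqr_ge0].
have dV v : V v -> inf E <= rnorm (x - v) ^+ 2.
  by move=> Vv; apply: ge_inf; [case: infE|exists v].
(* With w = 4^-n, the errors w/4 at step n and w/16 at step n+1 make the parallelogram law bound
   |v_{n+1} - v_n|^2 by w/2 + w/8 <= w; the steps are thus at most 2^-n. *)
have dE n : exists2 v, V v & rnorm (x - v) ^+ 2 <= inf E + (2^-1 ^+ n) ^+ 2 / 4.
  have [|_ [v Vv <-] vd] := @inf_adherent _ E ((2^-1 ^+ n) ^+ 2 / 4) _ infE.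
    by rewrite divr_gt0 // !exprn_gt0.
  by exists v => //; exact: ltW.
have d0 : 0 <= inf E.
  by apply: lb_le_inf; [case: infE|move=> _ [v _ <-]; exact: sqr_ge0].
have {dE} [v vV vd] : exists2 v : nat -> H, (forall n, V (v n)) &
    forall n, rnorm (x - v n) ^+ 2 <= inf E + (2^-1 ^+ n) ^+ 2 / 4.
  exists (fun n => projT1 (cid2 (dE n))) => n; by case: cid2.
have vv n : rnorm (v n.+1 - v n) <= 1 * 2^-1 ^+ n.
  rewrite mul1r -(@ler_pXn2r _ 2%N) ?nnegrE ?rnorm_ge0 ?exprn_ge0 //.
  have := parallelogram normE (x - v n) (x - v n.+1).
  have -> : x - v n - (x - v n.+1) = v n.+1 - v n.
    by rewrite opprB addrC addrA subrK.
  have -> : x - v n + (x - v n.+1) = 2%:C *: (x - 2^-1%:C *: (v n + v n.+1)).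
    rewrite scalerBr scalerA -rmorphM /= divff // scale1r opprD addrACA.
    by rewrite (rmorphD (real_complex R) 1 1 : 2%:C = _) rmorph1 scalerDl scale1r.
  rewrite rnormZ rnorm_real ger0_norm // exprMn.
  have := dV _ (lspanZ (2^-1)%:C (lspanD (vV n) (vV n.+1))).
  have := vd n; have := vd n.+1; rewrite (exprS _ n) exprMn.
  have := sqr_ge0 (2^-1 ^+ n : R); set w := (2^-1 ^+ n) ^+ 2.
  set A := rnorm _ ^+ 2; set B := rnorm _ ^+ 2; set C := rnorm _ ^+ 2.
  set P := rnorm (x - v n) ^+ 2; lra.
have h0 : 0 < 2^-1 :> R by rewrite invr_gt0.
have [y yv] := geometric_cvg ler01 h0 (lexx _) vv.
have cy : closure V y.
  apply/closure_rnormP => e e0.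
  have /cvgrPdist_lt /(_ e e0) [N _ hN] : 2 * 1 * 2^-1 ^+ n @[n --> \oo] --> 2 * 1 * (0 : R).
    apply: cvgM; [exact: cvg_cst|].
    by apply: cvg_expr; rewrite ger0_norm ?invr_ge0 // invf_lt1 // ltr1n.
  exists (v N) => //; apply: le_lt_trans (yv N) _; have := hN N (leqnn N).
  by rewrite /= mulr0 sub0r normrN; apply: le_lt_trans; rewrite ler_norm.
have xy : rnorm (x - y) <= Num.sqrt (inf E).
  (* Of the 3, one 2^-n is the excess of |x - v_n| over the infimum, two are the bound on |y -
     v_n|. *)
  apply: (@ler_geometric _ _ 3) => n; apply: le_trans (rnorm_dist _ (v n) _) _.
  have -> : Num.sqrt (inf E) + 3 * 2^-1 ^+ n =
      (Num.sqrt (inf E) + 2^-1 ^+ n) + 2 * 1 * 2^-1 ^+ n by ring.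
  apply: lerD; last by rewrite rdistC; exact: yv.
  rewrite -(@ler_pXn2r _ 2%N) ?nnegrE ?rnorm_ge0 ?addr_ge0 ?sqrtr_ge0 ?exprn_ge0 //.
  apply: le_trans (vd n) _; rewrite sqrrD sqr_sqrtr //.
  have : 0 <= Num.sqrt (inf E) * 2^-1 ^+ n by rewrite mulr_ge0 ?sqrtr_ge0 ?exprn_ge0.
  have := sqr_ge0 (2^-1 ^+ n : R); set w := (2^-1 ^+ n) ^+ 2; rewrite mulr2n; lra.
have dcV z : closure V z -> Num.sqrt (inf E) <= rnorm (x - z).
  move=> /closure_rnormP cz; apply/ler_addgt0Pr => e /cz[u Vu zu].
  have : Num.sqrt (inf E) <= rnorm (x - u).
    rewrite -(@ger0_norm _ (rnorm (x - u))) ?rnorm_ge0 // -sqrtr_sqr.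
    by rewrite ler_wsqrtr // dV.
  have := rnorm_dist x z u; lra.
have orth u : V u -> dot (x - y) u = 0.
  apply: (@min_distance_orthogonal V) => {}u c Vu; apply: le_trans xy (dcV _ _).
  apply/closure_rnormP => e e0; have /closure_rnormP /(_ e e0) [w Vw yw] := cy.
  exists (w + u *: c); first by apply: lspanD => //; exact: lspanZ.
  by rewrite opprD addrACA subrr addr0.
have orth' u : V u -> dot u (x - y) = 0.
  by move=> Vu; rewrite dotC orth // conjC0.
exists (x - y); split=> [n Jn|]; first by apply: orth'; exact: lspan_gen.
have yxy : dot y (x - y) = 0.
  apply: (closure_orthogonal normE _ cy) => n Jn; apply: orth'; exact: lspan_gen.
have -> : dot x (x - y) = dot (x - y) (x - y) by rewrite [RHS]linearBl /= yxy subr0.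
rewrite dnorm_eq0 subr_eq0; apply/eqP => exy; exact: nx (eq_ind_r _ cy exy).
Qed.

(* Sokal's gliding hump: of the two points [x + u] and [x - u] one has a large product with [h]. *)
Lemma uniform_boundedness (I : Type) (h : I -> H) (J : set I) :
  (forall x, exists C : R, forall n, J n -> rnorm (dot x (h n)) <= C) ->
  exists C : R, forall n, J n -> rnorm (h n) <= C.
Proof.
move=> bnd; apply: contrapT => nb.
have big (C : R) : exists2 n, J n & C < rnorm (h n).
  apply: contrapT => nC; apply: nb; exists C => n Jn; rewrite leNgt.
  by apply/negP => Cn; apply: nC; exists n.
(* After [x n.+1] the limit moves by at most twice 4^-(n+1), half of 4^-n. Half of the product
   gained at step n therefore survives, and it exceeds (2n + 1)/2. *)
have {big} [k kJ kh] : exists2 k : nat -> I, (forall n, J (k n)) &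
    forall n, 4 ^+ n * (2 * n%:R + 1) < rnorm (h (k n)).
  exists (fun n => projT1 (cid2 (big (4 ^+ n * (2 * n%:R + 1))))) => n; by case: cid2.
pose q : R := 4^-1; have q0 : 0 < q by rewrite invr_gt0.
pose u n := (q ^+ n / rnorm (h (k n)))%:C *: h (k n).
have h0 n : 0 < rnorm (h (k n)).
  by apply: le_lt_trans (kh n); rewrite mulr_ge0 ?exprn_ge0 // addr_ge0 // mulr_ge0.
have nu n : rnorm (u n) = q ^+ n.
  rewrite rnormZ rnorm_real ger0_norm ?divr_ge0 ?exprn_ge0 ?rnorm_ge0 ?(ltW q0) //.
  by rewrite divfK // gt_eqF.
pose step n x := if q ^+ n * rnorm (h (k n)) <= rnorm (dot (x + u n) (h (k n)))
  then x + u n else x - u n.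
pose fix x n := if n is m.+1 then step m (x m) else 0.
have xx n : rnorm (x n.+1 - x n) <= 1 * q ^+ n.
  rewrite /= /step; case: ifP => _; first by rewrite addrC addKr nu mul1r.
  by rewrite addrC addKr rnormN nu mul1r.
have xh n : q ^+ n * rnorm (h (k n)) <= rnorm (dot (x n.+1) (h (k n))).
  rewrite /= /step; case: ifP => // /negbT; rewrite -ltNge => lt.
  have duh : rnorm (dot (u n) (h (k n))) = q ^+ n * rnorm (h (k n)).
    rewrite linearZl_LR /= rnormM (dot_rnorm normE) !rnorm_real !ger0_norm ?sqr_ge0 //.
      by rewrite expr2 mulrA divfK // gt_eqF.
    by rewrite divr_ge0 ?exprn_ge0 ?rnorm_ge0 ?(ltW q0).
  have := ler_rnormB (dot (x n + u n) (h (k n))) (dot (x n - u n) (h (k n))).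
  rewrite -linearBl /= opprB (addrC (u n) (- _)) addrACA subrr add0r linearDl /= => tri.
  have : rnorm (dot (u n) (h (k n)) + dot (u n) (h (k n))) = 2 * (q ^+ n * rnorm (h (k n))).
    rewrite -duh; set z := dot _ _; rewrite /rnorm -mulr2n normrMn mulr2n.
    by case: `|z| => a b /=; ring.
  lra.
have q2 : q <= 2^-1 by rewrite lef_pV2 ?posrE // ler_nat.
have [l xl] := geometric_cvg ler01 q0 q2 xx.
have [C lC] := bnd l.
have lh n : n%:R < C.
  have lb := lC _ (kJ n).
  have e1 : rnorm (dot (l - x n.+1) (h (k n))) <= 2^-1 * (q ^+ n * rnorm (h (k n))).
    apply: le_trans (rnorm_dot_le normE _ _) _; rewrite mulrA ler_pM2r //.
    by apply: le_trans (xl _) _; rewrite exprS /q; lra.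
  have := rnorm_dist (dot (x n.+1) (h (k n))) (dot l (h (k n))) 0.
  rewrite !subr0 rdistC -linearBl /= => tri.
  have := xh n; have := kh n.
  rewrite -(ltr_pM2l (_ : 0 < q ^+ n)) ?exprn_gt0 // mulrA -exprMn mulVf ?pnatr_eq0 //.
  rewrite expr1n mul1r; set Q := q ^+ n * _ in e1 tri *; lra.
have := lh (Num.truncn C).+1; have C0 : 0 <= C by apply: le_trans (ltW (lh 0%N)).
by have := truncnS_gt C; lra.
Qed.

Lemma series_term_bounded (u : nat -> H) x :
  series u @ \oo --> x -> exists C : R, forall n, rnorm (u n) <= C.
Proof.
move=> /cvg_rnormP /(_ 1 ltr01) [N hN].
exists (2 + \sum_(i < N) rnorm (u i)) => n; have [nN|nN] := ltnP n N.
  rewrite (bigD1 (Ordinal nN)) //= addrCA lerDl addr_ge0 //.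
  by apply: sumr_ge0 => i _; exact: rnorm_ge0.
apply: ler_wpDr; first by apply: sumr_ge0 => i _; exact: rnorm_ge0.
have -> : u n = series u n.+1 - series u n by rewrite seriesSr addrAC subrr add0r.
have := rnorm_dist (series u n.+1) x (series u n).
have := hN n nN; have := hN n.+1 (leqW nN); rewrite (rdistC x (series u n.+1)); lra.
Qed.

(** * Coefficients of Schauder expansions *)

Section SchauderExpansion.
Context {I : choiceType}.
Variables (f g : I -> H) (J : set I) (e : nat -> I).
Hypotheses (eJ : set_bij [set: nat] J e) (fg : biorthogonal dot f g J)
  (f_expand : forall x, exists d : nat -> R[i],
    series (fun k => d k *: f (e k)) @ \oo --> x).

Let eJ_in k : J (e k).
Proof. by case: eJ => + _ _; apply. Qed.

Let eJ_inj j k : (e j == e k) = (j == k).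
Proof.
apply/eqP/eqP => [|->] // h; case: eJ => _ + _.
by move=> /(_ j k); rewrite !inE; apply.
Qed.

Lemma expansion_coef (d : nat -> R[i]) x k :
  series (fun k => d k *: f (e k)) @ \oo --> x -> dot x (g (e k)) = d k.
Proof.
move=> dx; rewrite (series_dot normE dx (k := k)) => [|j jk]; rewrite linearZl_LR /= fg //.
  by rewrite eqxx mulr1.
by rewrite eJ_inj (negbTE jk) mulr0.
Qed.

Lemma expansion_total x : (forall n, J n -> dot x (g n) = 0) -> x = 0.
Proof.
move=> xg; have [d dx] := f_expand x.
have d0 k : d k = 0 by rewrite -(expansion_coef k dx) xg.
apply/eqP; rewrite -rnorm_eq0 eq_le rnorm_ge0 andbT.
apply/ler_addgt0Pr => a a0; rewrite add0r.
have [N /(_ N (leqnn N))] := cvg_rnormP dx a0.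
by rewrite /series /= big1 ?subr0 => [/ltW|i _]; rewrite ?d0 ?scale0r.
Qed.

(** The terms <x, g_n> f_n of the convergent expansion of [x] are bounded, so the lower bound on
    |f_n| bounds <x, g_n> for each [x]; uniform boundedness concludes. *)
Lemma expansion_dual_bounded (c : R) : 0 < c -> (forall n, J n -> c <= rnorm (f n)) ->
  exists C : R, forall n, J n -> rnorm (g n) <= C.
Proof.
move=> c0 cf; apply: uniform_boundedness => x; have [d dx] := f_expand x.
have [C dC] := series_term_bounded dx.
exists (C / c) => n Jn; have [k _ <-] : (e @` [set: nat]) n by case: eJ => _ _; apply.
rewrite (expansion_coef k dx) ler_pdivlMr //; apply: le_trans (dC k).
by rewrite rnormZ ler_wpM2l ?rnorm_ge0 // cf.
Qed.

End SchauderExpansion.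

End Hilbert.

(** * The space L2(0,1) *)

Section L2Basics.
Local Open Scope quotient_scope.
Local Open Scope ring_scope.
Context {R : realType}.
Local Notation mu := (@lebesgue_measure R).
Local Notation D := (`]0%R, 1%R[%classic : set R).
Implicit Types (f g : R -> R[i]) (x y : L2 R).

Let aeF := ae_filter_ringOfSetsType mu.

Lemma L2_repr_square_integrable x : square_integrable (repr x : L2fun).
Proof. by case: (repr x) => f /= /[!inE]. Qed.

Lemma L2_piE (f : L2fun) : \pi_(L2 R) f = L2_class f.
Proof. by rewrite /L2_class valKd. Qed.

Lemma L2_class_repr x : L2_class (repr x : L2fun) = x.
Proof. by rewrite -L2_piE reprK. Qed.

Lemma square_integrableD f g :
  square_integrable f -> square_integrable g -> square_integrable (f \+ g).
Proof.
move=> fP gP; have [_ /(_ 1 f g)] := @L2_submod_closed R.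
by rewrite !inE scale1r; apply.
Qed.

Lemma square_integrableZ c f :
  square_integrable f -> square_integrable (fun t => c * f t).
Proof.
move=> fP; have [h0 /(_ c f 0)] := @L2_submod_closed R.
by rewrite addr0 => h; have := h _ h0; rewrite !inE; apply.
Qed.

Lemma square_integrable0 : square_integrable (fun=> 0 : R[i]).
Proof. by have [] := @L2_submod_closed R; rewrite inE. Qed.

Lemma L2_class0 : L2_class (fun=> 0) = 0 :> L2 R.
Proof. exact: esym (L2_piE (0 : L2fun)). Qed.

Lemma L2_class_eq f g : square_integrable f -> square_integrable g ->
  (L2_class f = L2_class g <-> f = g %[ae mu in D]).
Proof.
move=> fP gP; split=> [fg|fg].
  have := L2_classE gP; rewrite -fg; have := L2_classE fP.
  by apply: (@filterS2 _ _ aeF) => t h1 h2 Dt; rewrite -(h1 Dt) (h2 Dt).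
have [fE gE] : L2fun_val (insubd 0 f) = f /\ L2fun_val (insubd 0 g) = g.
  by split; apply: insubdK; rewrite inE.
by apply/L2_eqP; rewrite fE gE.
Qed.

Lemma L2_classD f g : square_integrable f -> square_integrable g ->
  L2_class (f \+ g) = L2_class f + L2_class g.
Proof.
move=> fP gP; rewrite /L2_class -L2_piD; congr (\pi_(L2 R) _).
apply/val_inj; rewrite /= !insubdK ?inE //; exact: square_integrableD.
Qed.

Lemma L2_classZ c f : square_integrable f ->
  L2_class (fun t => c * f t) = c *: L2_class f.
Proof.
move=> fP; rewrite /L2_class -L2_piZ; congr (\pi_(L2 R) _).
apply/val_inj; rewrite /= !insubdK ?inE //; exact: square_integrableZ.
Qed.

Lemma L2_dot_class f g : square_integrable f -> square_integrable g ->
  L2_dot (L2_class f) (L2_class g) = complex_integral (fun t => f t * (g t)^*).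
Proof.
by move=> fP gP; rewrite /L2_class L2_dotE !insubdK // inE.
Qed.

End L2Basics.

(** * Completeness of L2(0,1) *)

Section RieszFischer.
Context {R : realType}.
Local Notation mu := (@lebesgue_measure R).
Local Notation D := (`]0%R, 1%R[%classic : set R).
Implicit Types (f g : R -> R[i]) (x y : L2 R).

Let mD : measurable (D : set (measurableTypeR R)).
Proof. exact: measurable_itv. Qed.

Lemma measurable_sqmod_parts f : measurable_fun D (fun t => Re (f t)) ->
  measurable_fun D (fun t => Im (f t)) ->
  measurable_fun (D : set (measurableTypeR R)) (fun t => (sqmod (f t))%:E).
Proof.
move=> mr mi; apply/measurable_EFinP.
rewrite (_ : (fun t => sqmod (f t)) =
    (fun t => Re (f t) ^+ 2 + Im (f t) ^+ 2)); last by apply/funext => t; exact: sqmodE.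
by apply: measurable_funD; exact: measurable_funX.
Qed.

Lemma measurable_sqmod f : square_integrable f ->
  measurable_fun (D : set (measurableTypeR R)) (fun t => (sqmod (f t))%:E).
Proof. by case=> mr mi _; exact: measurable_sqmod_parts. Qed.

Lemma sqmod_ge0 (z : R[i]) : 0 <= sqmod z.
Proof. by rewrite sqmod_rnorm sqr_ge0. Qed.

Lemma L2_rnorm_dot x : rnorm x ^+ 2 = Re (L2_dot x x).
Proof. exact: (rnorm_dot (dot := @L2_dot R) (@L2_normE R)). Qed.

Lemma rnorm_class f : square_integrable f ->
  ((rnorm (L2_class f) ^+ 2)%:E = \int[mu]_(t in D) (sqmod (f t))%:E)%E.
Proof.
move=> fP; rewrite L2_rnorm_dot L2_dot_class //=.
rewrite /Rintegral fineK; last first.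
  have [_ _ fi] := fP; rewrite ge0_fin_numE; last first.
    apply: integral_ge0 => t _; rewrite lee_fin.
    by case: (f t) => a b /=; rewrite mulrN opprK -!expr2 addr_ge0 ?sqr_ge0.
  apply: le_lt_trans fi; rewrite le_eqVlt; apply/orP; left; apply/eqP.
  apply: eq_integral => t _; congr EFin; rewrite sqmodE.
  by case: (f t) => a b /=; ring.
apply: eq_integral => t _; congr EFin; rewrite sqmodE.
by case: (f t) => a b /=; ring.
Qed.

Lemma rnorm_repr x :
  ((rnorm x ^+ 2)%:E = \int[mu]_(t in D) (sqmod (repr x t))%:E)%E.
Proof. by rewrite -{1}(L2_class_repr x) rnorm_class //; exact: L2_repr_square_integrable. Qed.

Lemma rnorm_class_sub f g : square_integrable f -> square_integrable g ->
  ((rnorm (L2_class f - L2_class g) ^+ 2)%:E =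
   \int[mu]_(t in D) (sqmod (f t - g t))%:E)%E.
Proof.
move=> fP gP; rewrite -scaleN1r -L2_classZ // -L2_classD ?rnorm_class //.
- by apply: eq_integral => t _; rewrite /= mulN1r.
- by apply: square_integrableD => //; exact: square_integrableZ.
- exact: square_integrableZ.
Qed.

(** The remainder 2 q^N makes the induction close: q^N + 2 q^(N+1) <= 2 q^N because q <= 1/2. *)
Lemma geometric_sum_le (q : R) N :
  0 < q -> q <= 2^-1 -> \sum_(i < N) q ^+ i + 2 * q ^+ N <= 2.
Proof.
move=> q0 q2; elim: N => [|N IH]; first by rewrite big_ord0 expr0 add0r mulr1.
apply: le_trans IH; rewrite big_ord_recr /= -addrA lerD2l exprS.
have : 0 < q ^+ N by rewrite exprn_gt0.
by move: (q ^+ N) => p; nra.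
Qed.

(** Squared increments divided by q^n still have integrals of order q^n, so their sum [W] is
    integrable and finite almost everywhere. There u <= u^2 / q^n + q^n makes the increments
    absolutely summable. *)
Lemma ae_limit_of_geometric (a : nat -> R -> R) (c q : R) :
  0 < q -> q <= 2^-1 -> (forall n, measurable_fun D (a n)) ->
  (forall n, \int[mu]_(t in D) ((a n.+1 t - a n t) ^+ 2)%:E
     <= (c * (q ^+ n) ^+ 2)%:E)%E ->
  exists2 l : R -> R, measurable_fun D l &
    {ae mu, forall t, D t -> a n t @[n --> \oo] --> l t}.
Proof.
move=> q0 q2 ma da.
pose w n t := ((a n.+1 t - a n t) ^+ 2 / q ^+ n)%:E.
have w0 n t : (0 <= w n t)%E.
  by rewrite lee_fin divr_ge0 ?sqr_ge0 // exprn_ge0 // ltW.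
have mda n : measurable_fun D (fun t => (a n.+1 t - a n t) ^+ 2).
  by apply: measurable_funX; exact: (measurable_funB (ma n.+1) (ma n)).
have mw n : measurable_fun (D : set (measurableTypeR R)) (w n).
  apply/measurable_EFinP; exact: (measurable_funM (mda n) (measurable_cst _)).
have iw n : (\int[mu]_(t in D) w n t <= (c * q ^+ n)%:E)%E.
  under eq_integral do rewrite /w mulrC EFinM.
  rewrite ge0_integralZl_EFin //; last 3 first.
  - by move=> t _; rewrite lee_fin sqr_ge0.
  - by apply/measurable_EFinP; exact: mda.
  - by rewrite invr_ge0 exprn_ge0 // ltW.
  apply: le_trans (lee_wpmul2l _ (da n)) _; first by rewrite lee_fin invr_ge0 exprn_ge0 // ltW.
  by rewrite -EFinM lee_fin mulrCA expr2 mulKf // expf_neq0 // gt_eqF.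
have c0 : 0 <= c.
  rewrite -lee_fin -[X in (_ <= X%:E)%E]mulr1 -(expr0 q); apply: le_trans (iw 0%N).
  by apply: integral_ge0 => t _; exact: w0.
pose W t := (\sum_(0 <= n <oo) w n t)%E.
have W0 t : (0 <= W t)%E by apply: nneseries_ge0 => n _ _; exact: w0.
have mW : measurable_fun (D : set (measurableTypeR R)) W.
  by apply: ge0_emeasurable_sum => // k t _ _; exact: w0.
have iW : mu.-integrable D W.
  apply/integrableP; split=> //.
  under eq_integral do rewrite gee0_abs //.
  rewrite integral_nneseries //.
  apply: (@le_lt_trans _ _ (c * 2)%:E); last exact: ltry.
  apply: lime_le; first by apply: is_cvg_nneseries => n _ _; exact: integral_ge0.
  apply: nearW => N; apply: (@le_trans _ _ (\sum_(0 <= i < N) (c * q ^+ i)%:E)%E).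
    by apply: lee_sum => i _; exact: iw.
  rewrite sumEFin lee_fin -mulr_sumr ler_wpM2l // big_mkord.
  have := geometric_sum_le N q0 q2; apply: le_trans; rewrite lerDl.
  by rewrite mulr_ge0 // exprn_ge0 // ltW.
(* The upper limit is measurable whether or not the sequence converges; [fine] replaces infinite
   values by 0, which can occur only on a null set. *)
exists (fun t => fine (limn_esup (fun n => (a n t)%:E))).
  apply: measurableT_comp => //; apply: measurable_fun_limn_esup => n.
  exact/measurable_EFinP.
apply: (@filterS _ _ (ae_filter_ringOfSetsType mu)) (integrable_ae mD iW) => t Wt Dt.
have {}Wt := Wt Dt.
suff : cvgn (fun n => a n t).
  move=> /cvg_ex [l al].
  have al' : (a n t)%:E @[n --> \oo] --> l%:E by exact: (cvg_comp _ _ al).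
  by have [_ ->] := cvg_limn_einf_sup al'.
pose d n := a n.+1 t - a n t.
have ad n : a n t = a 0%N t + series d n.
  by rewrite /series /= telescope_sumr // addrC subrK.
suff cd : cvgn (series d).
  rewrite (_ : (fun n => a n t) = (fun n => a 0%N t + series d n)); last exact/funext.
  by apply: cvgP; apply: cvgD; [exact: cvg_cst|exact: cd].
apply: normed_cvg; apply: nondecreasing_is_cvgn.
  by apply: nondecreasing_series => n _ _; exact: normr_ge0.
exists (fine (W t) + 2) => _ [N _ <-].
have dw n : `|d n| <= (d n) ^+ 2 / q ^+ n + q ^+ n.
  have qn : 0 < q ^+ n by rewrite exprn_gt0.
  rewrite -(@ler_pM2r _ (q ^+ n)) // mulrDl divfK ?gt_eqF // -(real_normK (num_real (d n))).
  have := normr_ge0 (d n); move: (`|d n|) (q ^+ n) qn => u Q; nra.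
apply: (@le_trans _ _ (\sum_(0 <= n < N) (d n ^+ 2 / q ^+ n) + \sum_(0 <= n < N) q ^+ n)).
  by rewrite -big_split /=; apply: ler_sum => n _; exact: dw.
apply: lerD; last first.
  rewrite big_mkord; have := geometric_sum_le N q0 q2; apply: le_trans.
  by rewrite lerDl mulr_ge0 // exprn_ge0 // ltW.
rewrite -lee_fin fineK // -sumEFin; apply: nneseries_lim_ge => n _ _; exact: w0.
Qed.

Lemma geometric_dist (V : normedZmodType R[i]) (x : nat -> V) (c q : R) :
  0 <= c -> 0 < q -> q <= 2^-1 ->
  (forall n, rnorm (x n.+1 - x n) <= c * q ^+ n) ->
  forall n m, rnorm (x (n + m)%N - x n) <= 2 * c * q ^+ n.
Proof.
move=> c0 q0 q2 dx n m.
have h : rnorm (x (n + m)%N - x n) <= c * q ^+ n * \sum_(i < m) q ^+ i.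
  elim: m => [|m IH]; first by rewrite addn0 subrr rnorm0 big_ord0 mulr0.
  apply: le_trans (rnorm_dist _ (x (n + m)%N) _) _.
  rewrite big_ord_recr /= mulrDr addrC addnS lerD // -mulrA -exprD; exact: dx.
apply: le_trans h _; rewrite (mulrC 2) [leRHS]mulrAC ler_wpM2l //.
  by rewrite mulr_ge0 // exprn_ge0 // ltW.
have := geometric_sum_le m q0 q2; apply: le_trans; rewrite lerDl.
by rewrite mulr_ge0 // exprn_ge0 // ltW.
Qed.

(** Real and imaginary parts converge almost everywhere, and Fatou's lemma carries the distances
    between the terms over to the limit function. *)
Lemma L2_geometric_cvg (x : nat -> L2 R) (c q : R) :
  0 <= c -> 0 < q -> q <= 2^-1 ->
  (forall n, rnorm (x n.+1 - x n) <= c * q ^+ n) ->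
  exists l, forall n, rnorm (l - x n) <= 2 * c * q ^+ n.
Proof.
move=> c0 q0 q2 dx.
pose f n : R -> R[i] := L2fun_val (repr (x n)).
have fP n : square_integrable (f n) by exact: L2_repr_square_integrable.
have fx n : L2_class (f n) = x n by exact: L2_class_repr.
have dist n m : (\int[mu]_(t in D) (sqmod (f m t - f n t))%:E =
    (rnorm (x m - x n) ^+ 2)%:E)%E by rewrite -rnorm_class_sub // !fx.
have msub n m : measurable_fun (D : set (measurableTypeR R))
    (fun t => (sqmod (f m t - f n t))%:E).
  have := measurable_sqmod (square_integrableD (fP m) (square_integrableZ (-1) (fP n))).
  by congr measurable_fun; apply/funext => t; rewrite /= mulN1r.
(* [p] stands for the real part and for the imaginary part. *)
have step (p : R[i] -> R) : (forall z w, p (z - w) = p z - p w) ->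
    (forall z, p z ^+ 2 <= sqmod z) ->
    (forall n, measurable_fun D (fun t => p (f n t))) ->
    exists2 l : R -> R, measurable_fun D l &
      {ae mu, forall t, D t -> p (f n t) @[n --> \oo] --> l t}.
  move=> pB p2 mp; apply: (@ae_limit_of_geometric (fun n t => p (f n t)) (c ^+ 2) q) => // n.
  apply: (@le_trans _ _ (\int[mu]_(t in D) (sqmod (f n.+1 t - f n t))%:E)%E).
    apply: ge0_le_integral => //.
    - by move=> t _; rewrite lee_fin sqr_ge0.
    - by apply/measurable_EFinP; apply: measurable_funX; exact: (measurable_funB (mp n.+1) (mp n)).
    - by move=> t _; rewrite lee_fin -pB p2.
  rewrite dist lee_fin -exprMn ler_pXn2r ?nnegrE ?rnorm_ge0 ?mulr_ge0 ?exprn_ge0 ?(ltW q0) //.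
have [lr mlr clr] : exists2 l : R -> R, measurable_fun D l &
    {ae mu, forall t, D t -> Re (f n t) @[n --> \oo] --> l t}.
  apply: step => [[a b] [u v] //|z|n]; first by rewrite sqmodE lerDl sqr_ge0.
  by case: (fP n).
have [li mli cli] : exists2 l : R -> R, measurable_fun D l &
    {ae mu, forall t, D t -> Im (f n t) @[n --> \oo] --> l t}.
  apply: step => [[a b] [u v] //|z|n]; first by rewrite sqmodE lerDr sqr_ge0.
  by case: (fP n).
pose l t : R[i] := lr t +i* li t.
have bound n : (\int[mu]_(t in D) (sqmod (l t - f n t))%:E <= ((2 * c * q ^+ n) ^+ 2)%:E)%E.
  have ml : measurable_fun (D : set (measurableTypeR R)) (fun t => (sqmod (l t - f n t))%:E).
    have [mr mi _] := fP n; apply/measurable_EFinP.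
    rewrite (_ : (fun t => _) = (fun t => (lr t - Re (f n t)) ^+ 2 + (li t - Im (f n t)) ^+ 2)).
      by apply: measurable_funD; apply: measurable_funX;
        [exact: (measurable_funB mlr mr)|exact: (measurable_funB mli mi)].
    by apply/funext => t; rewrite sqmodE /l; case: (f n t).
  pose s m t := (sqmod (f (n + m)%N t - f n t))%:E.
  (* The integrand is almost everywhere the limit of the shifted squared distances [s m]; as a lower
     limit it has the shape that Fatou's lemma bounds. *)
  have -> : (\int[mu]_(t in D) (sqmod (l t - f n t))%:E =
      \int[mu]_(t in D) limn_einf (s ^~ t))%E.
    have ms : measurable_fun (D : set (measurableTypeR R)) (fun t => limn_einf (s ^~ t)).
      rewrite (_ : (fun t => _) = (fun t => - limn_esup (fun m => - s m t))%E).
        apply: measurableT_comp => //; apply: measurable_fun_limn_esup => m.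
        by apply: measurableT_comp => //; exact: msub.
      by apply/funext => t; rewrite -[LHS]oppeK; congr (- _)%E; exact/esym/limn_esupN.
    apply: ae_eq_integral => //.
    apply: (@filterS2 _ _ (ae_filter_ringOfSetsType mu)) clr cli => t cr ci Dt.
    have {}cr := cr Dt; have {}ci := ci Dt.
    suff : s m t @[m --> \oo] --> (sqmod (l t - f n t))%:E.
      by move=> /cvg_limn_einf_sup[-> _].
    have cs : (Re (f (n + m)%N t) - Re (f n t)) ^+ 2 + (Im (f (n + m)%N t) - Im (f n t)) ^+ 2
       @[m --> \oo] --> sqmod (l t - f n t).
      have -> : sqmod (l t - f n t) = (lr t - Re (f n t)) ^+ 2 + (li t - Im (f n t)) ^+ 2.
        by rewrite sqmodE /l; case: (f n t).
      have sh (u : nat -> R) (k b : R) : u m @[m --> \oo] --> b ->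
          (u (n + m)%N - k) ^+ 2 @[m --> \oo] --> (b - k) ^+ 2.
        move=> ub; have {}ub : u (n + m)%N @[m --> \oo] --> b.
          rewrite (_ : (fun m => u (n + m)%N) = [sequence u (m + n)%N]_m).
            by rewrite (cvg_shiftn n u).
          by apply/funext => m; rewrite /= addnC.
        by apply: cvgM; apply: cvgB => //; exact: cvg_cst.
      by apply: cvgD; [exact: (sh (fun m => Re (f m t)))|exact: (sh (fun m => Im (f m t)))].
    rewrite /s; under eq_fun do rewrite sqmodE !raddfB /=.
    exact: (cvg_comp _ _ cs).
  have s0 m t : D t -> (0 <= s m t)%E by move=> _; rewrite lee_fin sqmod_ge0.
  apply: le_trans (fatou mu mD (fun m => msub n (n + m)%N) s0) _.
  rewrite limn_einf_lim; apply: lime_le; first exact: is_cvg_einfs.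
  apply: nearW => m; apply: (@le_trans _ _ (\int[mu]_(t in D) s m t)%E).
    by apply: ereal_inf_lbound; exists m => /=.
  rewrite dist lee_fin ler_pXn2r ?nnegrE ?rnorm_ge0 ?mulr_ge0 ?exprn_ge0 ?(ltW q0) //.
  exact: geometric_dist.
have lP : square_integrable (fun t => l t - f 0%N t).
  have [mr mi _] := fP 0%N; split.
  - rewrite (_ : (fun t => _) = (fun t => lr t - Re (f 0%N t))).
      exact: (measurable_funB mlr mr).
    by apply/funext => t; rewrite /l; case: (f 0%N t).
  - rewrite (_ : (fun t => _) = (fun t => li t - Im (f 0%N t))).
      exact: (measurable_funB mli mi).
    by apply/funext => t; rewrite /l; case: (f 0%N t).
  - by apply: le_lt_trans (bound 0%N) _; rewrite ltry.
have lP' : square_integrable l.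
  have := square_integrableD lP (fP 0%N); congr square_integrable.
  by apply/funext => t; rewrite /= subrK.
exists (L2_class l) => n; rewrite -(@ler_pXn2r _ 2%N) ?nnegrE ?rnorm_ge0
  ?mulr_ge0 ?exprn_ge0 ?(ltW q0) //.
by rewrite -lee_fin -fx rnorm_class_sub.
Qed.

End RieszFischer.

(** * Integrals on (0,1) *)

Section Integrals.
Context {R : realType}.
Local Notation mu := (@lebesgue_measure R).
Local Notation D := (`]0%R, 1%R[%classic : set R).

Let mD : measurable (D : set (measurableTypeR R)).
Proof. exact: measurable_itv. Qed.

Lemma integral_derivative (G g : R -> R) (a b : R) : a < b ->
  (forall t, a <= t <= b -> is_derive t 1 G (g t)) ->
  (forall t, a <= t <= b -> {for t, continuous g}) ->
  (\int[mu]_(t in `[a, b]) (g t)%:E = (G b - G a)%:E)%E.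
Proof.
move=> ab dG cg; have cG t : a <= t <= b -> {for t, continuous G}.
  by move=> /dG[d _]; apply: differentiable_continuous; exact/derivable1_diffP.
rewrite (@continuous_FTC2 _ g G a b) //.
- by apply: continuous_in_subspaceT => t /[!inE] /=; rewrite in_itv /=; exact: cg.
- split.
  + move=> t; rewrite in_itv /= => /andP[ta tb].
    by have [] := dG t; rewrite ?(ltW ta) ?(ltW tb).
  + by apply: cvg_at_right_filter; apply: cG; rewrite lexx ltW.
  + by apply: cvg_at_left_filter; apply: cG; rewrite lexx ltW.
- move=> t; rewrite in_itv /= => /andP[ta tb].
  by rewrite derive1E; have [|_ ->] := dG t; rewrite ?(ltW ta) ?(ltW tb).
Qed.

(** Bounds an integral over (0,1) from below by an explicit antiderivative on [a, b]. The slack [c]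
    absorbs an error term of [g] and costs at most c because b - a < 1. *)
Lemma integral_ge_increment (phi G g : R -> R) (a b c : R) :
  0 < a -> a < b -> b < 1 -> 0 <= c ->
  mu.-integrable D (EFin \o phi) -> (forall t, 0 <= phi t) ->
  (forall t, a <= t <= b -> is_derive t 1 G (g t)) ->
  (forall t, a <= t <= b -> {for t, continuous g}) ->
  (forall t, a <= t <= b -> g t <= phi t + c) ->
  ((G b - G a)%:E <= \int[mu]_(t in D) (phi t)%:E + c%:E)%E.
Proof.
move=> a0 ab b1 c0 iphi phi0 dG cg gphi.
have mab : measurable (`[a, b]%classic : set (measurableTypeR R)) by exact: measurable_itv.
have abD : `[a, b]%classic `<=` D.
  move=> t /=; rewrite !in_itv /= => /andP[ta tb].
  by rewrite (lt_le_trans a0 ta) (le_lt_trans tb b1).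
have iphi' := integrableS mD mab abD iphi.
have ic : mu.-integrable `[a, b] (EFin \o cst c).
  apply: continuous_compact_integrable; first exact: segment_compact.
  by apply: continuous_subspaceT => t; exact: cst_continuous.
rewrite -(integral_derivative ab dG cg).
apply: (@le_trans _ _ (\int[mu]_(t in `[a, b]) (phi t + c)%:E)%E).
  apply: le_integral => //.
  - apply: continuous_compact_integrable; first exact: segment_compact.
    by apply: continuous_in_subspaceT => t /[!inE] /=; rewrite in_itv /=; exact: cg.
  - have := integrableD mab iphi' ic; exact: eq_integrable.
  - by move=> t /[!inE] /=; rewrite in_itv /= lee_fin => /gphi.
under eq_integral do rewrite EFinD.
rewrite integralD // leeD //.
  apply: ge0_subset_integral => //.
  - by have /integrableP[] := iphi.
  - by move=> t _; rewrite lee_fin.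
rewrite integral_cst //= lebesgue_measure_itv /= lte_fin ab -EFinB -EFinM lee_fin.
by rewrite ler_piMr //; lra.
Qed.

Lemma powR_le1 (t s : R) : 0 <= t -> t <= 1 -> 0 <= s -> t `^ s <= 1.
Proof.
move=> t0 t1 s0; have <- : 1 `^ s = 1 :> R by rewrite powR1.
by apply: ge0_ler_powR => //; rewrite nnegrE.
Qed.

Lemma integral_powR_lty (s : R) : -1 < s ->
  (\int[mu]_(t in D) (t `^ s)%:E < +oo)%E.
Proof.
move=> s1; have s0 : 0 < s + 1 by lra.
(* Starting at 1/3 keeps a_n < 1 - a_n, so no segment of the exhaustion degenerates. *)
pose a (n : nat) : R := n.+3%:R^-1.
pose F n : set R := `[a n, 1 - a n]%classic.
have a0 n : 0 < a n by rewrite invr_gt0.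
have a3 n : a n <= 3^-1 by rewrite lef_pV2 ?posrE // ler_nat.
have DF : D = \bigcup_n F n.
  apply/seteqP; split => t /=; rewrite in_itv /=; last first.
    move=> [n _]; rewrite /F /= in_itv /= => /andP[ta tb].
    by rewrite (lt_le_trans (a0 n) ta) (le_lt_trans tb) // gtrBl.
  move=> /andP[t0 t1].
  have u0 : 0 < Num.min t (1 - t) by rewrite lt_min t0 subr_gt0.
  pose n := Num.truncn (Num.min t (1 - t))^-1; exists n => //.
  have an : a n <= Num.min t (1 - t).
    rewrite -[leRHS]invrK lef_pV2 ?posrE ?invr_gt0 //.
    apply: ltW; apply: lt_le_trans (truncnS_gt _) _; rewrite ler_nat ltnS.
    exact: leq_trans (leqnSn _) (leqnSn _).
  by move: an; rewrite le_min => /andP[? ?]; rewrite /F /= in_itv /=; apply/andP; split; lra.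
have mp : measurable_fun [set: measurableTypeR R] (fun t : R => (t `^ s)%:E).
  by apply/measurable_EFinP; exact: measurable_powR.
have cv : (\int[mu]_(x in F n) (x `^ s)%:E)%E @[n --> \oo] -->
    (\int[mu]_(x in D) (x `^ s)%:E)%E.
  rewrite DF; apply: ge0_nondecreasing_set_cvg_integral => //.
  - move=> n m nm; apply/subsetPset => t; rewrite /F /= !in_itv /= => /andP[ta tb].
    have : a m <= a n by rewrite lef_pV2 ?posrE // ler_nat !ltnS.
    by move=> amn; apply/andP; split; lra.
  - by move=> n; exact: measurable_itv.
  - by move=> n; exact: measurable_funTS.
  - by move=> n t _; rewrite lee_fin powR_ge0.
apply: (@le_lt_trans _ _ ((s + 1)^-1)%:E); last exact: ltry.
rewrite -(cvg_lim _ cv) //; apply: lime_le; first by apply/cvg_ex; eexists; exact: cv.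
apply: nearW => n.
have an1 : a n < 1 - a n by have := a3 n; lra.
have dp t : a n <= t <= 1 - a n ->
    is_derive t 1 (fun t : R => (s + 1)^-1 * t `^ (s + 1)) (t `^ s).
  move=> /andP[ta _]; have t0 := lt_le_trans (a0 n) ta.
  have := is_deriveZ (s + 1)^-1 (is_derive1_powR (s + 1) t0).
  by rewrite addrK scalerA mulVf ?gt_eqF // scale1r.
have cp t : a n <= t <= 1 - a n -> {for t, continuous (fun t : R => t `^ s)}.
  move=> /andP[ta _]; have t0 := lt_le_trans (a0 n) ta.
  apply: differentiable_continuous; apply/derivable1_diffP.
  by have [] := is_derive1_powR s t0.
have -> := integral_derivative an1 dp cp.
rewrite lee_fin -mulrBr ler_piMr ?invr_ge0 ?(ltW s0) //.
have : (1 - a n) `^ (s + 1) <= 1.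
  by apply: powR_le1; [have := a3 n; lra|rewrite gerBl ltW|exact: ltW].
by have := powR_ge0 (a n) (s + 1); lra.
Qed.

End Integrals.

(** * Exponential sums near 0 *)

Section ComplexExponential.
Context {R : realType}.

(** Mean value theorem between 0 and [x], at the price of the factor 1/(K+1) that integration would
    give. *)
Lemma normr_le_of_derivative (f df : R -> R) (K : nat) :
  (forall x : R, is_derive x 1 f (df x)) -> f 0 = 0 ->
  (forall x, `|df x| <= `|x| ^+ K) -> forall x, `|f x| <= `|x| ^+ K.+1.
Proof.
move=> dfx f0 dfK x.
have cf a b : {within `[a, b], continuous f}.
  apply: continuous_subspaceT => y; apply: differentiable_continuous.
  by apply/derivable1_diffP; have [] := dfx y.
have [x0|x0] := leP 0 x.
  have [c] := MVT_segment x0 (fun y _ => dfx y) (cf 0 x).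
  rewrite in_itv /= f0 !subr0 => /andP[c0 cx] ->.
  rewrite normrM exprSr ler_wpM2r //; apply: le_trans (dfK c) _.
  by rewrite lerXn2r ?nnegrE // !ger0_norm // (le_trans c0).
have [c] := MVT_segment (ltW x0) (fun y _ => dfx y) (cf x 0).
rewrite in_itv /= f0 !sub0r => /andP[cx c0] /eqP; rewrite eqr_oppLR => /eqP ->.
rewrite normrN normrM normrN exprSr ler_wpM2r //; apply: le_trans (dfK c) _.
by rewrite lerXn2r ?nnegrE // !ler0_norm ?lerN2 // ltW.
Qed.

(** Differentiation shifts the coefficient sequence; a general [u] serves cosine and sine at
    once. *)
Lemma is_derive_taylor (u : nat -> R) (K : nat) (x : R) :
  is_derive x 1 (fun x => \sum_(k < K.+1) u k * (x ^+ k / k`!%:R))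
    (\sum_(k < K) u k.+1 * (x ^+ k / k`!%:R)).
Proof.
elim: K => [|K IH].
  rewrite big_ord0; under eq_fun do rewrite big_ord_recl big_ord0 expr0.
  exact: is_derive_cst.
under eq_fun do rewrite big_ord_recr /=.
rewrite big_ord_recr /=; apply: is_deriveD.
have := is_deriveZ (u K.+1 / (K.+1)`!%:R) (is_deriveX K.+1 (is_derive_id x 1)).
rewrite /= => /is_derive_eq; have -> : (u K.+1 / (K.+1)`!%:R) \*: (id ^+ K.+1) =
    (fun x : R => u K.+1 * (x ^+ K.+1 / (K.+1)`!%:R)).
  by apply/funext => y; rewrite fctE -[LHS]/(_ / _ * y ^+ K.+1) mulrAC mulrA.
apply; rewrite factS natrM /GRing.scale /= mulr1; field.
by rewrite addrC natr1 !pnatr_eq0 -lt0n fact_gt0.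
Qed.

Definition cexp (x : R) : R[i] := cos x +i* sin x.
(** The Taylor polynomial of exp(i x) of degree below [K]; [0 +i* 1] is the imaginary unit. *)
Definition ctaylor (K : nat) (x : R) : R[i] :=
  \sum_(k < K) (0 +i* 1) ^+ k * (x ^+ k / k`!%:R)%:C.

(** The derivative of the cosine remainder is, up to sign, the sine remainder of one degree less,
    and conversely; hence the joint induction. The 2 covers the factor sqrt 2 from joining the two
    parts. *)
Lemma rnorm_cexp_taylor (K : nat) (x : R) :
  rnorm (cexp x - ctaylor K x) <= 2 * `|x| ^+ K.
Proof.
pose r k := Re ((0 +i* 1 : R[i]) ^+ k); pose s k := Im ((0 +i* 1 : R[i]) ^+ k).
have rS k : r k.+1 = - s k.
  by rewrite /r /s exprS; case: (_ ^+ k) => a b /=; ring.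
have sS k : s k.+1 = r k.
  by rewrite /r /s exprS; case: (_ ^+ k) => a b /=; ring.
have bd : (forall y, `|cos y - \sum_(k < K) r k * (y ^+ k / k`!%:R)| <= `|y| ^+ K) /\
  (forall y, `|sin y - \sum_(k < K) s k * (y ^+ k / k`!%:R)| <= `|y| ^+ K).
  elim: K => [|K [IHc IHs]].
    split=> y; rewrite big_ord0 subr0 expr0 ler_norml.
      by rewrite cos_geN1 cos_le1.
    by rewrite sin_geN1 sin_le1.
  split.
    apply: (@normr_le_of_derivative _ (fun y => - (sin y - \sum_(k < K) s k * (y ^+ k / k`!%:R)))).
    - move=> y; rewrite opprB addrC; apply: is_deriveD.
      have -> : \sum_(k < K) s k * (y ^+ k / k`!%:R) = - \sum_(k < K) r k.+1 * (y ^+ k / k`!%:R).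
        by rewrite -sumrN; apply: eq_bigr => k _; rewrite rS mulNr opprK.
      exact: is_deriveN (is_derive_taylor r K y).
    - rewrite cos0 big_ord_recl expr0 fact0 divr1 big1 ?addr0 /r /= ?mulr1 ?subrr // => i _.
      by rewrite /bump leq0n add1n expr0n /= mul0r mulr0.
    - by move=> y; rewrite normrN.
  apply: (@normr_le_of_derivative _ (fun y => cos y - \sum_(k < K) r k * (y ^+ k / k`!%:R))) => //.
  - move=> y; apply: is_deriveB.
    have -> : \sum_(k < K) r k * (y ^+ k / k`!%:R) = \sum_(k < K) s k.+1 * (y ^+ k / k`!%:R).
      by apply: eq_bigr => k _; rewrite sS.
    exact: is_derive_taylor.
  - rewrite sin0 big_ord_recl expr0 fact0 divr1 big1 ?addr0 /s /= ?mul0r ?subrr // => i _.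
    by rewrite /bump leq0n add1n expr0n /= mul0r mulr0.
have -> : cexp x - ctaylor K x = (cos x - \sum_(k < K) r k * (x ^+ k / k`!%:R)) +i*
    (sin x - \sum_(k < K) s k * (x ^+ k / k`!%:R)).
  have -> : ctaylor K x = (\sum_(k < K) r k * (x ^+ k / k`!%:R)) +i*
      (\sum_(k < K) s k * (x ^+ k / k`!%:R)).
    rewrite /ctaylor; elim: (K) => [|k IH]; first by rewrite !big_ord0.
    have E (P Q w : R) (z : R[i]) : P +i* Q + z * w%:C = (P + Re z * w) +i* (Q + Im z * w).
      by case: z => a b; apply/eqP; rewrite eq_complex /=; apply/andP; split; apply/eqP; ring.
    by rewrite !big_ord_recr /= IH E.
  by apply/eqP; rewrite eq_complex /= !eqxx.
move: bd => [/(_ x) h1 /(_ x) h2].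
move: h1 h2; set a := cos x - _; set b := sin x - _; set q := `|x| ^+ K => h1 h2.
rewrite -(@ler_pXn2r _ 2%N) ?nnegrE ?rnorm_ge0 ?mulr_ge0 ?exprn_ge0 //.
rewrite -sqmod_rnorm sqmodE /= -(real_normK (num_real a)) -(real_normK (num_real b)).
have := normr_ge0 a; have := normr_ge0 b; rewrite exprMn; nra.
Qed.

Lemma rnorm_imag_unit (N : nat) : rnorm ((0 +i* 1 : R[i]) ^+ N) = 1.
Proof.
elim: N => [|k IH]; first by rewrite expr0 -[1]/(1%:C) rnorm_real normr1.
rewrite exprS rnormM IH mulr1; apply/eqP.
by rewrite -(@eqrXn2 _ 2%N) ?rnorm_ge0 // -sqmod_rnorm sqmodE /= expr0n add0r.
Qed.

Lemma ler_rnorm_sum (V : normedZmodType R[i]) (J : Type) (s : seq J) (F : J -> V) :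
  rnorm (\sum_(n <- s) F n) <= \sum_(n <- s) rnorm (F n).
Proof.
elim: s => [|n s IH]; first by rewrite !big_nil rnorm0.
by rewrite !big_cons; apply: le_trans (ler_rnormD _ _) _; rewrite lerD2l.
Qed.

Context {I : eqType}.
Variable lambda : I -> R.
Implicit Types (c : I -> R[i]) (s : seq I).

Definition expsum c s (t : R) : R[i] := \sum_(n <- s) c n * cexp (lambda n * t).
(** Multiplied by i^k / k!, this is the Taylor coefficient of order [k] of [expsum c s] at 0. *)
Definition moment c s (k : nat) : R[i] := \sum_(n <- s) c n * (lambda n)%:C ^+ k.

(** In the Taylor expansion of the exponentials, the total coefficient of each order below [K] is a
    multiple of a vanishing moment. *)
Lemma expsum_leading c s (K : nat) :
  (forall k, (k < K)%N -> moment c s k = 0) ->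
  exists2 C : R, 0 <= C & forall t, 0 <= t ->
    rnorm (expsum c s t - (0 +i* 1) ^+ K * (t ^+ K / K`!%:R)%:C * moment c s K)
      <= C * t ^+ K.+1.
Proof.
move=> mom0; exists (\sum_(n <- s) rnorm (c n) * (2 * `|lambda n| ^+ K.+1)) => [|t t0].
  by apply: sumr_ge0 => n _; rewrite mulr_ge0 ?rnorm_ge0 // mulr_ge0 ?exprn_ge0.
have tay (l : R) k : ((l * t) ^+ k / k`!%:R)%:C = l%:C ^+ k * (t ^+ k / k`!%:R)%:C.
  by rewrite exprMn -mulrA rmorphM rmorphXn.
have -> : (0 +i* 1) ^+ K * (t ^+ K / K`!%:R)%:C * moment c s K =
    \sum_(n <- s) c n * ctaylor K.+1 (lambda n * t).
  rewrite /ctaylor; under eq_bigr do rewrite mulr_sumr.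
  rewrite exchange_big big_ord_recr /= big1 ?add0r => [|k _]; last first.
    rewrite (_ : \sum_(n <- s) _ = (0 +i* 1) ^+ k * (t ^+ k / k`!%:R)%:C * moment c s k).
      by rewrite mom0 ?mulr0.
    rewrite mulr_sumr; apply: eq_bigr => n _.
    by rewrite tay; ring.
  rewrite mulr_sumr; apply: eq_bigr => n _.
  by rewrite tay; ring.
rewrite -sumrB mulr_suml; apply: le_trans (ler_rnorm_sum _ _) _.
apply: ler_sum => n _; rewrite -mulrBr rnormM -mulrA ler_wpM2l ?rnorm_ge0 //.
apply: le_trans (rnorm_cexp_taylor _ _) _.
by rewrite normrM exprMn (ger0_norm t0) mulrA.
Qed.

Lemma expsum_bound c s (N : nat) :
  (forall k, (k < N)%N -> moment c s k = 0) ->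
  exists2 C : R, 0 <= C & forall t, 0 <= t -> t <= 1 -> rnorm (expsum c s t) <= C * t ^+ N.
Proof.
move=> /expsum_leading[C C0 hC].
exists (C + rnorm (moment c s N)) => [|t t0 t1]; first by rewrite addr_ge0 ?rnorm_ge0.
set a := (0 +i* 1) ^+ N * (t ^+ N / N`!%:R)%:C * moment c s N.
have ra : rnorm a <= t ^+ N * rnorm (moment c s N).
  rewrite /a rnormM ler_wpM2r ?rnorm_ge0 // rnormM rnorm_real.
  rewrite rnorm_imag_unit mul1r ger0_norm ?divr_ge0 ?exprn_ge0 // ler_pdivrMr ?ltr0n ?fact_gt0 //.
  by rewrite ler_peMr ?exprn_ge0 // ler1n fact_gt0.
have := rnorm_dist (expsum c s t) a 0; rewrite !subr0 => h.
apply: le_trans h _; rewrite mulrDl; apply: lerD; last by rewrite mulrC.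
apply: le_trans (hC t t0) _; rewrite ler_wpM2l // exprS ler_piMl ?exprn_ge0 //.
Qed.

End ComplexExponential.

(** * Exponential sums divided by a power *)

Section WeightedExpSums.
Context {R : realType}.
Local Notation mu := (@lebesgue_measure R).
Local Notation D := (`]0%R, 1%R[%classic : set R).
Implicit Types (x y g : L2 R).

Let mD : measurable (D : set (measurableTypeR R)).
Proof. exact: measurable_itv. Qed.

Let aeF := ae_filter_ringOfSetsType mu.

Lemma L2_sum (J : Type) (s : seq J) (F : J -> R -> R[i]) :
  (forall n, square_integrable (F n)) ->
  square_integrable (fun t => \sum_(n <- s) F n t) /\
  L2_class (fun t => \sum_(n <- s) F n t) = \sum_(n <- s) L2_class (F n).
Proof.
move=> FP; elim: s => [|n s [IH1 IH2]].
  have -> : (fun t => \sum_(n <- [::]) F n t) = (0 : L2fun) :> (R -> R[i]).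
    by apply/funext => t; rewrite big_nil.
  split; last by rewrite big_nil -L2_piE.
  by have [] := @L2_submod_closed R; rewrite inE.
have -> : (fun t => \sum_(m <- n :: s) F m t) = F n \+ (fun t => \sum_(m <- s) F m t).
  by apply/funext => t; rewrite big_cons.
split; first exact: square_integrableD.
by rewrite L2_classD // big_cons IH2.
Qed.

Context {I : eqType}.
Variable lambda : I -> R.
Implicit Types (c : I -> R[i]) (s : seq I).

Lemma expsum_class c s : square_integrable (expsum lambda c s) /\
  L2_class (expsum lambda c s) = \sum_(n <- s) c n *: L2_exp (lambda n).
Proof.
have h n : square_integrable (fun t => c n * cexp (lambda n * t)).
  by apply: square_integrableZ; exact: L2_exp_square_integrable.
have [h1 h2] := L2_sum s h; split=> //; rewrite h2; apply: eq_bigr => n _.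
rewrite L2_classZ //; exact: L2_exp_square_integrable.
Qed.

(** Division by t^alpha acts on functions, not on classes, since the quotient may fail to be square
    integrable. *)
Definition unweight (alpha : R) (f : R -> R[i]) (t : R) : R[i] :=
  (t `^ (- alpha))%:C * f t.

Lemma measurable_unweight (alpha : R) (f : R -> R[i]) :
  measurable_fun D (fun t => Re (f t)) -> measurable_fun D (fun t => Im (f t)) ->
  measurable_fun D (fun t => Re (unweight alpha f t)) /\
  measurable_fun D (fun t => Im (unweight alpha f t)).
Proof.
move=> mr mi; have mp : measurable_fun D (fun t : R => t `^ (- alpha)).
  by apply: measurable_funTS; exact: measurable_powR.
have [er ei] : (forall t, Re (unweight alpha f t) = t `^ (- alpha) * Re (f t)) /\
    (forall t, Im (unweight alpha f t) = t `^ (- alpha) * Im (f t)).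
  by split=> t; rewrite /unweight; case: (f t) => ? ? /=; ring.
by rewrite (funext er) (funext ei); split; exact: measurable_funM.
Qed.

Lemma weightK (alpha t : R) : 0 < t -> t `^ alpha * t `^ (- alpha) = 1.
Proof. by move=> t0; rewrite powRN divff // gt_eqF // powR_gt0. Qed.

Lemma L2_mulpow_unweight (alpha : R) (f : R -> R[i]) :
  0 <= alpha -> square_integrable f -> square_integrable (unweight alpha f) ->
  L2_mulpow alpha (L2_class (unweight alpha f)) = L2_class f.
Proof.
move=> a0 fP uP; rewrite /L2_mulpow; apply/L2_class_eq => //.
  by apply: L2_mulpow_square_integrable => //; exact: L2_repr_square_integrable.
apply: (@filterS _ _ aeF) (L2_classE uP) => t ht Dt; rewrite (ht Dt) /unweight.
move: Dt; rewrite /= in_itv /= => /andP[t0 _].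
by rewrite mulrA -rmorphM /= weightK // mul1r.
Qed.

(** Here the existence of [g] in L2 becomes an integrability condition on [f]: f / t^alpha agrees
    with [g] almost everywhere. *)
Lemma L2_mulpow_unweightE (alpha : R) (f : R -> R[i]) g :
  0 <= alpha -> square_integrable f -> L2_mulpow alpha g = L2_class f ->
  square_integrable (unweight alpha f) /\ g = L2_class (unweight alpha f).
Proof.
move=> a0 fP; have gP := L2_repr_square_integrable g.
move=> /L2_class_eq -/(_ (L2_mulpow_square_integrable a0 gP) fP) gf.
have gu : repr g = unweight alpha f %[ae mu in D].
  apply: (@filterS _ _ aeF) gf => t h Dt; rewrite /unweight -(h Dt).
  move: Dt; rewrite /= in_itv /= => /andP[t0 _].
  by rewrite mulrA -rmorphM /= (mulrC (t `^ (- alpha))) weightK // mul1r.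
have uP : square_integrable (unweight alpha f).
  have [mr mi _] := fP; have [_ _ gi] := gP.
  have [mr' mi'] := measurable_unweight alpha mr mi.
  split=> //; apply: le_lt_trans gi; rewrite le_eqVlt; apply/orP; left; apply/eqP.
  apply: ae_eq_integral => //.
  - exact: measurable_sqmod_parts.
  - exact: measurable_sqmod.
  - by apply: (@filterS _ _ aeF) gu => t h Dt; rewrite (h Dt).
by split=> //; rewrite -(L2_class_repr g); apply/L2_class_eq.
Qed.

(** The sum is O(t^N), so the squared quotient is O(t^(2N - 2 alpha)), with exponent above -1. *)
Lemma unweight_expsum_square_integrable (alpha : R) c s (N : nat) :
  alpha < N%:R + 2^-1 -> (forall k, (k < N)%N -> moment lambda c s k = 0) ->
  square_integrable (unweight alpha (expsum lambda c s)).
Proof.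
move=> aN mom0; have [C C0 hC] := expsum_bound mom0.
have [fP _] := expsum_class c s; have [mr mi _] := fP.
set f := expsum lambda c s in fP mr mi hC *.
have [mr' mi'] := measurable_unweight alpha mr mi.
split=> //; pose e := 2 * N%:R - 2 * alpha.
have e1 : -1 < e by rewrite /e; lra.
apply: (@le_lt_trans _ _ (\int[mu]_(t in D) ((C ^+ 2)%:E * (t `^ e)%:E)))%E.
  apply: ge0_le_integral => //.
  - by move=> t _; rewrite lee_fin sqmod_ge0.
  - exact: measurable_sqmod_parts.
  - apply/measurable_EFinP; apply: measurable_funM => //.
    by apply: measurable_funTS; exact: measurable_powR.
  move=> t; rewrite /= in_itv /= => /andP[t0 t1]; rewrite -EFinM lee_fin.
  rewrite sqmod_rnorm /unweight rnormM rnorm_real (ger0_norm (powR_ge0 _ _)).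
  have -> : t `^ e = (t `^ (- alpha) * t ^+ N) ^+ 2.
    rewrite -(powR_mulrn _ (ltW t0)) -powRD ?(gt_eqF t0) ?implybT //.
    rewrite -powR_mulrn ?powR_ge0 // -powRrM; congr (_ `^ _); rewrite /e; ring.
  rewrite -exprMn ler_pXn2r ?nnegrE ?mulr_ge0 ?powR_ge0 ?rnorm_ge0 ?exprn_ge0 ?(ltW t0) //.
  by rewrite mulrCA ler_wpM2l ?powR_ge0 // hC // ltW.
rewrite ge0_integralZl_EFin ?sqr_ge0 //.
- by rewrite lte_mul_pinfty ?lee_fin ?sqr_ge0 // integral_powR_lty.
- by move=> t _; rewrite lee_fin powR_ge0.
- by apply/measurable_EFinP; apply: measurable_funTS; exact: measurable_powR.
Qed.

Lemma sqmod_integrable (f : R -> R[i]) : square_integrable f ->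
  mu.-integrable D (EFin \o (fun t => sqmod (f t))).
Proof.
move=> fP; apply/integrableP; split; first exact: measurable_sqmod.
have [_ _] := fP; apply: le_lt_trans; rewrite le_eqVlt; apply/orP; left; apply/eqP.
by apply: eq_integral => t _; rewrite /= ger0_norm // sqmod_ge0.
Qed.

Lemma is_derive_lnZ (a t : R) : 0 < t -> is_derive t 1 (fun t : R => a * ln t) (a / t).
Proof. by move=> t0; have := is_deriveZ a (is_derive1_ln t0); exact. Qed.

Lemma continuous_divr (a t : R) : 0 < t -> {for t, continuous (fun t : R => a / t)}.
Proof.
move=> t0; apply: (@cvgM _ _ _ _ (fun=> a) (fun t => t^-1)); first exact: cvg_cst.
by apply: cvgV; [rewrite gt_eqF|exact: cvg_id].
Qed.

Lemma not_integrable_inv (phi : R -> R) (a d : R) : 0 < a -> 0 < d -> d < 1 ->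
  mu.-integrable D (EFin \o phi) -> (forall t, 0 <= phi t) ->
  ~ (forall t, 0 < t -> t <= d -> a / t <= phi t).
Proof.
move=> a0 d0 d1 iphi phi0 h.
have ifin := integrable_fin_num mD iphi.
pose J := fine (\int[mu]_(t in D) (phi t)%:E).
have eJ : (\int[mu]_(t in D) (phi t)%:E = J%:E)%E by rewrite /J fineK.
(* Chosen so that a (ln d - ln e) = J + 1, more than the integral [J]. *)
pose e := d * expR (- ((J + 1) / a)).
have J0 : 0 <= J by rewrite -lee_fin -eJ; apply: integral_ge0 => t _; rewrite lee_fin.
have e0 : 0 < e by rewrite mulr_gt0 // expR_gt0.
have ed : e < d.
  by rewrite gtr_pMr // expR_lt1 oppr_lt0 divr_gt0 // ltr_wpDl.
have dG t : e <= t <= d -> is_derive t 1 (fun t : R => a * ln t) (a / t).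
  by move=> /andP[te _]; apply: is_derive_lnZ; exact: lt_le_trans e0 te.
have cg t : e <= t <= d -> {for t, continuous (fun t : R => a / t)}.
  by move=> /andP[te _]; apply: continuous_divr; exact: lt_le_trans e0 te.
have := integral_ge_increment e0 ed d1 (lexx 0) iphi phi0 dG cg.
rewrite adde0 eJ lee_fin -mulrBr => /(_ _)/wrap[].
  by move=> t /andP[te td]; rewrite addr0 h // (lt_le_trans e0 te).
rewrite /e lnM ?posrE ?expR_gt0 // expRK opprD addrA subrr add0r opprK mulrCA divff ?gt_eqF // mulr1.
by lra.
Qed.

(** This is t^(2k - 2 alpha) >= 1/t cleared of denominators, the comparison with the nonintegrable
    1/t; it includes the endpoint alpha = k + 1/2. *)
Lemma weight_sqr_ge (alpha t : R) (k : nat) : 0 < t -> t <= 1 -> k%:R + 2^-1 <= alpha ->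
  1 <= t ^+ k * t ^+ k * t * (t `^ (- alpha)) ^+ 2.
Proof.
move=> t0 t1 ka; have ta : (t `^ alpha) ^+ 2 <= t ^+ k * t ^+ k * t.
  have -> : t ^+ k * t ^+ k * t = (t `^ (k%:R + 2^-1)) ^+ 2.
    rewrite -[in RHS]powR_mulrn ?powR_ge0 // -powRrM -exprD -exprSr -powR_mulrn ?(ltW t0) //.
    by congr (_ `^ _); rewrite -natr1 natrD; field.
  rewrite ler_pXn2r ?nnegrE ?powR_ge0 //.
  have -> : alpha = (k%:R + 2^-1) + (alpha - (k%:R + 2^-1)) by ring.
  rewrite powRD ?(gt_eqF t0) ?implybT // ler_piMr ?powR_ge0 // powR_le1 ?(ltW t0) //.
  by rewrite subr_ge0.
have := ler_wpM2r (sqr_ge0 (t `^ (- alpha))) ta.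
by rewrite -exprMn weightK // expr1n.
Qed.

(** At the first nonvanishing moment, of order k, the sum is at least a constant times t^k near 0,
    so the squared quotient dominates a multiple of 1/t. *)
Lemma moment_eq0 (alpha : R) c s (K : nat) :
  K%:R + 2^-1 <= alpha -> square_integrable (unweight alpha (expsum lambda c s)) ->
  forall k, (k <= K)%N -> moment lambda c s k = 0.
Proof.
move=> aK uP; elim/ltn_ind => k IH kK; apply/eqP; apply: contraT => mk.
have [C C0 hC] := @expsum_leading _ _ lambda c s k (fun j jk => IH j jk (leq_trans (ltnW jk) kK)).
set b := rnorm (moment lambda c s k) / k`!%:R.
have b0 : 0 < b.
  by rewrite divr_gt0 ?ltr0n ?fact_gt0 // lt_neqAle rnorm_ge0 eq_sym rnorm_eq0 mk.
(* On (0, d] the Taylor error C t^(k+1) is at most half of the leading term b t^k. *)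
pose d := Num.min 2^-1 (b / (2 * (C + 1))).
have d0 : 0 < d by rewrite lt_min invr_gt0 ltr0n /= divr_gt0 // mulr_gt0 // ltr_wpDl.
have d1 : d < 1 by rewrite gt_min invf_lt1 // ltr1n.
have dC : d * C <= b / 2.
  apply: (@le_trans _ _ (b / (2 * (C + 1)) * (C + 1))).
    by apply: ler_pM; rewrite ?(ltW d0) // ?ge_min ?lexx ?orbT // lerDl.
  by rewrite invfM mulrA divfK // gt_eqF // ltr_wpDl.
have low t : 0 < t -> t <= d -> b / 2 * t ^+ k <= rnorm (expsum lambda c s t).
  move=> t0 td; have := hC t (ltW t0); set z := _ * moment _ _ _ _.
  have -> : b / 2 * t ^+ k = rnorm z - b / 2 * t ^+ k.
    rewrite /z 2!rnormM rnorm_real rnorm_imag_unit mul1r ger0_norm ?divr_ge0 ?exprn_ge0 ?(ltW t0) //.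
    by rewrite /b; field; rewrite pnatr_eq0 -lt0n fact_gt0.
  move=> h; have tC : C * t ^+ k.+1 <= b / 2 * t ^+ k.
    rewrite exprS mulrA ler_pM2r ?exprn_gt0 //; apply: le_trans dC.
    by rewrite mulrC ler_wpM2r.
  have := rnorm_dist z (expsum lambda c s t) 0; rewrite !subr0 rdistC; lra.
clearbody b.
have phi0 t : 0 <= sqmod (unweight alpha (expsum lambda c s) t) by exact: sqmod_ge0.
have ba : 0 < b ^+ 2 / 4 by rewrite divr_gt0 // exprn_gt0.
exfalso; apply: (not_integrable_inv ba d0 d1 (sqmod_integrable uP) phi0).
move=> t t0 td; rewrite sqmod_rnorm /unweight rnormM rnorm_real (ger0_norm (powR_ge0 _ _)).
have t1 : t <= 1 by rewrite (le_trans td) // ltW.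
have := low t t0 td => lowt.
have ka : k%:R + 2^-1 <= alpha by rewrite (le_trans _ aK) // lerD2r ler_nat.
rewrite exprMn; have pw := weight_sqr_ge t0 t1 ka.
rewrite ler_pdivrMr // -[X in _ <= X]mulrA.
have sq : (b / 2 * t ^+ k) ^+ 2 <= rnorm (expsum lambda c s t) ^+ 2.
  by rewrite ler_pXn2r ?nnegrE ?rnorm_ge0 ?mulr_ge0 ?divr_ge0 ?exprn_ge0 ?(ltW t0) ?(ltW b0).
set P := (t `^ _) ^+ 2 in pw *; have P0 : 0 <= P by exact: sqr_ge0.
apply: (@le_trans _ _ (P * ((b / 2 * t ^+ k) ^+ 2 * t))); last first.
  by rewrite ler_wpM2l // ler_wpM2r // ltW.
have -> : P * ((b / 2 * t ^+ k) ^+ 2 * t) = (b ^+ 2 / 4) * (t ^+ k * t ^+ k * t * P) by field.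
by rewrite ler_peMr // divr_ge0 // sqr_ge0.
Qed.

Lemma sqmod_cexpB (a b : R) : sqmod (cexp a - cexp b) = 2 - 2 * cos (a - b).
Proof.
rewrite sqmodE cosB /=.
have := cos2Dsin2 a; have := cos2Dsin2 b; nra.
Qed.

(** One integration by parts: the derivative is (2 - 2 cos(nu t)) / t plus an error that is small
    for large [nu] away from 0. *)
Lemma is_derive_sinc (nu t : R) : 0 < t -> nu != 0 ->
  is_derive t 1 (fun t : R => 2 * ln t - 2 / nu * (sin (nu * t) / t))
    (2 / t - 2 * cos (nu * t) / t + 2 / nu * (sin (nu * t) / t ^+ 2)).
Proof.
move=> t0 nu0.
have d1 := is_deriveZ 2 (is_derive1_ln t0).
have dm : is_derive t 1 (fun t : R => nu * t) nu.
  by have := is_deriveZ nu (is_derive_id t 1); rewrite /GRing.scale /= mulr1.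
have d2 := is_derive1_comp (is_derive_sin (nu * t)) dm.
have t0' : id t != 0 :> R by rewrite gt_eqF.
have d3 := is_deriveV t0' (is_derive_id t 1).
have h := is_deriveB d1 (is_deriveZ (2 / nu) (is_deriveM d2 d3)).
have -> : 2 / t - 2 * cos (nu * t) / t + 2 / nu * (sin (nu * t) / t ^+ 2) =
    2 * t^-1 - (2 / nu) * (sin (nu * t) * (- t ^- 2 * 1) + t^-1 * (cos (nu * t) * nu)).
  by field; rewrite nu0 gt_eqF.
exact: h.
Qed.

Lemma continuous_sinc_derivative (nu t : R) : 0 < t ->
  {for t, continuous (fun t : R =>
    2 / t - 2 * cos (nu * t) / t + 2 / nu * (sin (nu * t) / t ^+ 2))}.
Proof.
move=> t0; have cm : {for t, continuous (fun t : R => nu * t)}.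
  by apply: cvgM; [exact: cvg_cst|exact: cvg_id].
have cc : {for t, continuous (fun t : R => cos (nu * t))}.
  exact: (cvg_comp _ _ cm (@continuous_cos R (nu * t))).
have cs : {for t, continuous (fun t : R => sin (nu * t))}.
  exact: (cvg_comp _ _ cm (@continuous_sin R (nu * t))).
have ci : {for t, continuous (fun t : R => t^-1)}.
  by apply: cvgV; [rewrite gt_eqF|exact: cvg_id].
have ci2 : {for t, continuous (fun t : R => (t ^+ 2)^-1)}.
  by apply: cvgV; [rewrite expf_neq0 // gt_eqF|exact: exprn_continuous].
apply: cvgD.
  by apply: cvgB; apply: cvgM => //; [exact: cvg_cst|apply: cvgM => //; exact: cvg_cst].
by apply: cvgM; [exact: cvg_cst|exact: cvgM].
Qed.

Lemma sqmod_unweight (alpha : R) (f : R -> R[i]) (t : R) :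
  sqmod (unweight alpha f t) = (t `^ (- alpha)) ^+ 2 * sqmod (f t).
Proof.
by rewrite !sqmod_rnorm /unweight rnormM exprMn rnorm_real ger0_norm ?powR_ge0.
Qed.

(* [2 - 2 cos] oscillates around 2, so dividing by [t] gives a logarithmically divergent integral. *)
Lemma unweight_cexpB_ge (alpha l m e : R) :
  2^-1 <= alpha -> 0 < e -> e < 2^-1 -> 6 / e ^+ 2 <= `|l - m| ->
  square_integrable (unweight alpha (fun t => cexp (l * t) - cexp (m * t))) ->
  ((- 2 * ln (2 * e) - 1)%:E <=
    \int[mu]_(t in D) (sqmod (unweight alpha (fun t => cexp (l * t) - cexp (m * t)) t))%:E)%E.
Proof.
move=> a2 e0 e2; set nu := l - m => nue uP.
have e20 : 0 < e ^+ 2 by rewrite exprn_gt0.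
have n0 : 0 < `|nu| by apply: lt_le_trans nue; rewrite divr_gt0.
have nu0 : nu != 0 by rewrite -normr_gt0.
have nue' : 6 <= `|nu| * e ^+ 2 by rewrite -ler_pdivrMr.
(* Bounds the error term of the derivative for t >= e. With w = 1 / (|nu| e^2), the total loss is c
   = 2w plus at most w at each end of the segment, and 6w <= 1 keeps it below 1. *)
pose c := 2 / (`|nu| * e ^+ 2).
have c0 : 0 <= c by rewrite divr_ge0 // mulr_ge0 // ltW.
have h1 : 2^-1 < 1 :> R by rewrite invf_lt1 // ltr1n.
have dG t : e <= t <= 2^-1 -> is_derive t 1 (fun t : R => 2 * ln t - 2 / nu * (sin (nu * t) / t))
    (2 / t - 2 * cos (nu * t) / t + 2 / nu * (sin (nu * t) / t ^+ 2)).
  by move=> /andP[te _]; apply: is_derive_sinc => //; exact: lt_le_trans e0 te.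
have cg t : e <= t <= 2^-1 -> {for t, continuous (fun t : R =>
    2 / t - 2 * cos (nu * t) / t + 2 / nu * (sin (nu * t) / t ^+ 2))}.
  by move=> /andP[te _]; apply: continuous_sinc_derivative; exact: lt_le_trans e0 te.
have phi0 t : 0 <= sqmod (unweight alpha (fun t => cexp (l * t) - cexp (m * t)) t).
  exact: sqmod_ge0.
have sn (x : R) : `|sin x| <= 1 by rewrite ler_norml sin_geN1 sin_le1.
have := integral_ge_increment e0 e2 h1 c0 (sqmod_integrable uP) phi0 dG cg.
move=> /(_ _)/wrap[].
  move=> t /andP[te th]; have t0 := lt_le_trans e0 te.
  apply: lerD; last first.
    apply: le_trans (ler_norm _) _; rewrite !normrM normfV !normfV normrX.
    rewrite (gtr0_norm (_ : 0 < 2)) // (gtr0_norm t0) /c.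
    have -> : 2 / (`|nu| * e ^+ 2) = 2 / `|nu| * (1 / e ^+ 2).
      by field; rewrite !gt_eqF.
    rewrite ler_wpM2l ?divr_ge0 //; apply: ler_pM; rewrite ?invr_ge0 ?exprn_ge0 ?(ltW t0) //.
    by rewrite lef_pV2 ?posrE ?exprn_gt0 // ler_pXn2r ?nnegrE ?(ltW e0) ?(ltW t0).
  rewrite sqmod_unweight sqmod_cexpB -!mulrBl -/nu.
  have cos1 := cos_le1 (nu * t); have c2 : 0 <= 2 - 2 * cos (nu * t) by lra.
  rewrite mulrC ler_wpM2r //.
  have a2' : 0%:R + 2^-1 <= alpha by rewrite add0r.
  have := weight_sqr_ge t0 (le_trans th (ltW h1)) a2'; rewrite !expr0 !mul1r => hw.
  by rewrite -(ler_pM2l t0) divff // gt_eqF.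
move: (\int[mu]_(t in D) _)%E => J hJ.
have lnE : 2 * ln 2^-1 - 2 * ln e = - 2 * ln (2 * e).
  by rewrite lnV ?posrE // lnM ?posrE //; ring.
pose w := (`|nu| * e ^+ 2)^-1; have w0 : 0 < w by rewrite invr_gt0 mulr_gt0.
have w6 : w * 6 <= 1.
  by rewrite mulrC ler_pdivrMr ?mul1r // mulr_gt0.
have s1 : `|2 / nu * (sin (nu / 2) / 2^-1)| <= w.
  rewrite invrK !normrM !normfV (gtr0_norm (_ : 0 < 2)) //.
  apply: (@le_trans _ _ (2 / `|nu| * (1 * 2))).
    by rewrite ler_wpM2l ?divr_ge0 // ler_wpM2r.
  have -> : 2 / `|nu| * (1 * 2) = w * (4 * e ^+ 2) by rewrite /w; field; rewrite !gt_eqF.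
  by rewrite ler_piMr ?(ltW w0) // expr2; nra.
have s2 : `|2 / nu * (sin (nu * e) / e)| <= w.
  rewrite !normrM !normfV (gtr0_norm (_ : 0 < 2)) // (gtr0_norm e0).
  apply: (@le_trans _ _ (2 / `|nu| * (1 / e))).
    by rewrite ler_wpM2l ?divr_ge0 // ler_wpM2r // invr_ge0 ltW.
  have -> : 2 / `|nu| * (1 / e) = w * (2 * e) by rewrite /w; field; rewrite !gt_eqF.
  by rewrite ler_piMr ?(ltW w0) //; lra.
have cE : c = 2 * w by [].
move: hJ; rewrite -leeBlDr // -EFinB; apply: le_trans; rewrite lee_fin cE.
move: s1 s2; rewrite !ler_norml => /andP[_ s1] /andP[s2 _].
by move: lnE s1 s2; set p := _ * (_ / _); set p' := _ * (_ / _) => lnE s1 s2; lra.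
Qed.

End WeightedExpSums.

(** * Totality of the trigonometric system *)

Section TrigonometricTotality.
Context {R : realType}.
Local Notation mu := (@lebesgue_measure R).
Local Notation D := (`]0%R, 1%R[%classic : set R).

Let mD : measurable (D : set (measurableTypeR R)).
Proof. exact: measurable_itv. Qed.

Let freq (n : int) (t : R) := 2 * pi * n%:~R * t.

Section Orthogonality.
Variable a : R -> R.
Hypothesis ia : mu.-integrable D (EFin \o a).
Hypothesis a_cos : forall n : int, \int[mu]_(t in D) (a t * cos (freq n t)) = 0.
Hypothesis a_sin : forall n : int, \int[mu]_(t in D) (a t * sin (freq n t)) = 0.

Definition bounded_test (phi : R -> R) :=
  measurable_fun D phi /\ exists B : R, forall t, `|phi t| <= B.

Lemma bounded_testM phi psi :
  bounded_test phi -> bounded_test psi -> bounded_test (fun t => phi t * psi t).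
Proof.
move=> [mp [B hB]] [mq [B' hB']]; split; first exact: measurable_funM.
by exists (B * B') => t; rewrite normrM ler_pM.
Qed.

Lemma bounded_testD phi psi :
  bounded_test phi -> bounded_test psi -> bounded_test (fun t => phi t + psi t).
Proof.
move=> [mp [B hB]] [mq [B' hB']]; split; first exact: measurable_funD.
by exists (B + B') => t; apply: le_trans (ler_normD _ _) _; exact: lerD.
Qed.

Lemma bounded_test_cst (k : R) : bounded_test (fun=> k).
Proof. by split; [exact: measurable_cst|exists `|k|]. Qed.

Lemma bounded_test_cos n : bounded_test (fun t => cos (freq n t)).
Proof.
split; last by exists 1 => t; rewrite ler_norml cos_geN1 cos_le1.
have mM : measurable_fun D (fun t => freq n t) by exact: measurable_funM.
exact: measurableT_comp (continuous_measurable_fun (@continuous_cos R)) mM.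
Qed.

Lemma bounded_test_sin n : bounded_test (fun t => sin (freq n t)).
Proof.
split; last by exists 1 => t; rewrite ler_norml sin_geN1 sin_le1.
have mM : measurable_fun D (fun t => freq n t) by exact: measurable_funM.
exact: measurableT_comp (continuous_measurable_fun (@continuous_sin R)) mM.
Qed.

Lemma integrable_test phi : bounded_test phi ->
  mu.-integrable D (EFin \o (fun t => a t * phi t)).
Proof.
move=> [mp [B hB]]; have iB := integrableZl mD B ia.
apply: (le_integrable mD _ _ iB).
  apply/measurable_EFinP; apply: measurable_funM => //.
  by have /integrableP[/measurable_EFinP] := ia.
move=> t _ /=; rewrite lee_fin mulrC !normrM ler_wpM2r //.
by rewrite (le_trans (hB t)) // ler_norm.
Qed.

(** Asking for all frequencies at once makes the class stable under multiplication by cosine and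
    sine of frequency 1, through the product formulas. *)
Definition trig_orthogonal (phi : R -> R) := bounded_test phi /\
  forall n : int, \int[mu]_(t in D) (a t * (phi t * cos (freq n t))) = 0 /\
    \int[mu]_(t in D) (a t * (phi t * sin (freq n t))) = 0.

Let integral_lin phi psi (k l : R) : bounded_test phi -> bounded_test psi ->
  \int[mu]_(t in D) (a t * phi t) = 0 -> \int[mu]_(t in D) (a t * psi t) = 0 ->
  forall chi, (forall t, chi t = k * phi t + l * psi t) ->
  \int[mu]_(t in D) (a t * chi t) = 0.
Proof.
move=> tp tq ip iq chi chiE.
under eq_Rintegral do rewrite chiE mulrDr !(mulrCA (a _)).
rewrite RintegralD //.
- by rewrite !RintegralZl ?integrable_test // ip iq !mulr0 addr0.
- by have := integrableZl mD k (integrable_test tp); exact: eq_integrable.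
- by have := integrableZl mD l (integrable_test tq); exact: eq_integrable.
Qed.

Lemma trig_orthogonal_lin phi psi (k l : R) :
  trig_orthogonal phi -> trig_orthogonal psi ->
  trig_orthogonal (fun t => k * phi t + l * psi t).
Proof.
move=> [tp op] [tq oq]; split.
  by apply: bounded_testD; apply: bounded_testM => //; exact: bounded_test_cst.
move=> n; have [p1 p2] := op n; have [q1 q2] := oq n; split.
  apply: (integral_lin (k := k) (l := l) _ _ p1 q1) => [||t]; last by rewrite mulrDl !mulrA.
    by apply: bounded_testM => //; exact: bounded_test_cos.
  by apply: bounded_testM => //; exact: bounded_test_cos.
apply: (integral_lin (k := k) (l := l) _ _ p2 q2) => [||t]; last by rewrite mulrDl !mulrA.
  by apply: bounded_testM => //; exact: bounded_test_sin.
by apply: bounded_testM => //; exact: bounded_test_sin.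
Qed.

Let freqD n m t : freq (n + m) t = freq n t + freq m t.
Proof. by rewrite /freq rmorphD /=; ring. Qed.

Let freqB n m t : freq (n - m) t = freq n t - freq m t.
Proof. by rewrite /freq rmorphB /=; ring. Qed.

Lemma trig_orthogonal_cos phi : trig_orthogonal phi ->
  trig_orthogonal (fun t => phi t * cos (freq 1 t)).
Proof.
move=> [tp op]; split; first by apply: bounded_testM => //; exact: bounded_test_cos.
have tc n := bounded_testM tp (bounded_test_cos n).
have ts n := bounded_testM tp (bounded_test_sin n).
move=> n; have [p1 p2] := op (n + 1); have [q1 q2] := op (n - 1); split.
  apply: (integral_lin (k := 2^-1) (l := 2^-1) _ _ p1 q1) => // t.
  by rewrite freqD freqB cosD cosB; field.
apply: (integral_lin (k := 2^-1) (l := 2^-1) _ _ p2 q2) => // t.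
by rewrite freqD freqB sinD sinB; field.
Qed.

Lemma trig_orthogonal_sin phi : trig_orthogonal phi ->
  trig_orthogonal (fun t => phi t * sin (freq 1 t)).
Proof.
move=> [tp op]; split; first by apply: bounded_testM => //; exact: bounded_test_sin.
have tc n := bounded_testM tp (bounded_test_cos n).
have ts n := bounded_testM tp (bounded_test_sin n).
move=> n; have [p1 p2] := op (n + 1); have [q1 q2] := op (n - 1); split.
  apply: (integral_lin (k := 2^-1) (l := - 2^-1) _ _ p2 q2) => // t.
  by rewrite freqD freqB sinD sinB; field.
apply: (integral_lin (k := - 2^-1) (l := 2^-1) _ _ p1 q1) => // t.
by rewrite freqD freqB cosD cosB; field.
Qed.

(** A bump of period 1 and height [k] centred at [m], a trigonometric polynomial of degree 1. *)
Definition raised_cos (m k : R) (t : R) := k * ((1 + cos (2 * pi * (t - m))) / 2).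

Lemma trig_orthogonal_raised_cos m k phi : trig_orthogonal phi ->
  trig_orthogonal (fun t => phi t * raised_cos m k t).
Proof.
move=> op; have oc := trig_orthogonal_cos op; have os := trig_orthogonal_sin op.
have := trig_orthogonal_lin (k / 2) 1 op (trig_orthogonal_lin
  (k / 2 * cos (2 * pi * m)) (k / 2 * sin (2 * pi * m)) oc os).
congr trig_orthogonal; apply/funext => t.
by rewrite /raised_cos mulrBr cosB /freq mulr1; field.
Qed.

Lemma trig_orthogonal_raised_cosX m k (i : nat) phi : trig_orthogonal phi ->
  trig_orthogonal (fun t => phi t * raised_cos m k t ^+ i).
Proof.
move=> op; elim: i => [|i IH]; first by under eq_fun do rewrite expr0 mulr1.
by under eq_fun do rewrite exprSr mulrA; exact: trig_orthogonal_raised_cos.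
Qed.

Lemma trig_orthogonal_raised_cos_approx m k (i j : nat) :
  trig_orthogonal (fun t => (1 - raised_cos m k t ^+ i) ^+ j).
Proof.
elim: j => [|j IH].
  split; first exact: bounded_test_cst.
  move=> n; split; [rewrite -[RHS](a_cos n)|rewrite -[RHS](a_sin n)];
    by apply: eq_Rintegral => t _; rewrite expr0 mul1r.
have := trig_orthogonal_lin 1 (-1) IH (trig_orthogonal_raised_cosX m k i IH).
congr trig_orthogonal; apply/funext => t.
by rewrite exprSr mulrBr mulr1 mul1r mulN1r.
Qed.

Lemma bernoulli_ineq (u : R) (k : nat) : -1 <= u -> 1 + k%:R * u <= (1 + u) ^+ k.
Proof.
move=> u1; elim: k => [|k IH]; first by rewrite mul0r addr0 expr0.
rewrite exprSr -natr1.
have h : 0 <= 1 + u by lra.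
have := ler_wpM2r h IH; apply: le_trans.
have : 0 <= k%:R * (u * u) by rewrite mulr_ge0 // -expr2 sqr_ge0.
lra.
Qed.

(** Bernoulli's inequality gives (1 - x^n)^(2^n) >= 1 - (2x)^n. *)
Lemma cvg_step_below (x : R) : 0 <= x -> 2 * x < 1 ->
  (1 - x ^+ n) ^+ (2 ^ n) @[n --> \oo] --> (1 : R).
Proof.
move=> x0 x2; have xn n : x ^+ n <= 1 by apply: exprn_ile1 => //; lra.
have x2n : (2 * x) ^+ n @[n --> \oo] --> (0 : R).
  by apply: cvg_expr; rewrite ger0_norm // mulr_ge0.
apply: (@squeeze_cvgr _ _ _ _ (fun n => 1 - (2 * x) ^+ n) (fun=> 1)).
- apply: nearW => n; apply/andP; split; last first.
    by apply: exprn_ile1; rewrite ?subr_ge0 // gerBl exprn_ge0.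
  have : -1 <= - x ^+ n by rewrite lerN2.
  move=> /(@bernoulli_ineq _ (2 ^ n)); apply: le_trans.
  by rewrite natrX exprMn mulrN.
- by rewrite -[X in _ --> X]subr0; apply: cvgB => //; exact: cvg_cst.
- exact: cvg_cst.
Qed.

(** With u = x^n and N = 2^n, (1 - u)^N (1 + u)^N <= 1, while Bernoulli's inequality gives (1 + u)^N
    >= N u = (2x)^n. *)
Lemma cvg_step_above (x : R) : x <= 1 -> 1 < 2 * x ->
  (1 - x ^+ n) ^+ (2 ^ n) @[n --> \oo] --> (0 : R).
Proof.
move=> x1 x2; have x0 : 0 < x by lra.
have xn n : x ^+ n <= 1 by apply: exprn_ile1 => //; lra.
have x2n : ((2 * x)^-1) ^+ n @[n --> \oo] --> (0 : R).
  apply: cvg_expr; rewrite ger0_norm ?invr_ge0 ?mulr_ge0 ?(ltW x0) //.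
  by rewrite invf_lt1 // mulr_gt0.
apply: (@squeeze_cvgr _ _ _ _ (fun=> 0) (fun n => ((2 * x)^-1) ^+ n)) => //; last exact: cvg_cst.
apply: nearW => n; apply/andP; split; first by rewrite exprn_ge0 // subr_ge0.
rewrite exprVn -[leRHS]mul1r ler_pdivlMr ?exprn_gt0 ?mulr_gt0 //.
set u := x ^+ n; have u0 : 0 <= u by rewrite exprn_ge0 // ltW.
have ku : (2 * x) ^+ n <= (1 + u) ^+ (2 ^ n).
  have := @bernoulli_ineq u (2 ^ n) (le_trans _ u0); rewrite natrX exprMn -/u => h.
  by apply: le_trans (h _); rewrite ?lerDr //; lra.
have p0 : 0 <= (1 - u) ^+ (2 ^ n) by rewrite exprn_ge0 // subr_ge0 xn.
apply: le_trans (ler_wpM2l p0 ku) _; rewrite -exprMn.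
apply: exprn_ile1; have := xn n; rewrite -/u; nra.
Qed.

Lemma cos_gt_arc (d y : R) : d <= pi -> `|y| < d -> cos d < cos y.
Proof.
move=> d2 yd; rewrite -(cos_norm y) ltr_cos // in_itv /= ?normr_ge0 ?d2 ?andbT.
  exact: ltW (lt_le_trans yd d2).
exact: le_trans (ltW yd).
Qed.

Lemma cos_lt_arc (d y : R) : 0 <= d -> d <= pi -> d < `|y| -> `|y| < 2 * pi - d ->
  cos y < cos d.
Proof.
move=> d0 d2 dy yd; rewrite -(cos_norm y); have [yp|yp] := leP `|y| pi.
  by rewrite ltr_cos // in_itv /= ?normr_ge0 ?d0.
have -> : cos `|y| = cos (2 * pi - `|y|).
  by rewrite cosB mulr_natl cos2pi sin2pi mul1r mul0r addr0.
by rewrite ltr_cos // ?in_itv /=; first lra; apply/andP; split; lra.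
Qed.

(** Dominated convergence gives integral 0 over the complement of the arc, and the whole integral is
    the coefficient of frequency 0. Length at most 1/2 makes cos d >= 0, which keeps the bump at
    most 1. *)
Lemma integral_itv_eq0 (u v : R) : 0 <= u -> u < v -> v <= 1 -> v - u <= 2^-1 ->
  \int[mu]_(t in `]u, v[) a t = 0.
Proof.
move=> u0 uv v1 uv2; have p0 := pi_gt0 R.
pose m := (u + v) / 2; pose d := pi * (v - u).
have d0 : 0 < d by rewrite mulr_gt0 // subr_gt0.
have d2 : d <= pi / 2 by rewrite ler_pM2l.
have cd : 0 <= cos d by apply: cos_ge0_pihalf; rewrite d2 andbT; lra.
(* Normalized so that the bump takes the threshold value 1/2 exactly at [u] and [v]. *)
pose k := (1 + cos d)^-1.
have k0 : 0 < k by rewrite invr_gt0; lra.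
have k1 : k <= 1 by rewrite invf_le1; lra.
have x0 t : 0 <= raised_cos m k t.
  by rewrite mulr_ge0 ?(ltW k0) // divr_ge0 //; have := cos_geN1 (2 * pi * (t - m)); lra.
have x1 t : raised_cos m k t <= 1.
  by rewrite mulr_ile1 ?(ltW k0) //; have := cos_geN1 (2 * pi * (t - m));
    have := cos_le1 (2 * pi * (t - m)); lra.
have xE t : 2 * raised_cos m k t = (1 + cos (2 * pi * (t - m))) / (1 + cos d).
  by rewrite /raised_cos /k; field; apply/eqP; lra.
have xin t : u < t -> t < v -> 1 < 2 * raised_cos m k t.
  move=> ut tv; rewrite xE ltr_pdivlMr ?mul1r; last lra.
  rewrite ltrD2l cos_gt_arc //; first lra.
  rewrite !normrM (gtr0_norm p0) (gtr0_norm (_ : 0 < 2)) // /d (mulrC 2) -mulrA ltr_pM2l //.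
  by rewrite -(gtr0_norm (_ : 0 < 2)) // -normrM ltr_norml /m; apply/andP; split; lra.
have xout t : D t -> t < u \/ v < t -> 2 * raised_cos m k t < 1.
  rewrite /= in_itv /= => /andP[t0 t1] tuv.
  rewrite xE ltr_pdivrMr ?mul1r; last lra.
  have pE : `|2 * pi * (t - m)| = pi * `|2 * (t - m)|.
    by rewrite !normrM (gtr0_norm p0) mulrA (mulrC pi).
  rewrite ltrD2l cos_lt_arc ?(ltW d0) //; first lra.
    rewrite pE /d ltr_pM2l // /m; have [h|h] := leP 0 (2 * (t - (u + v) / 2)).
      by rewrite ger0_norm //; case: tuv; lra.
    by rewrite ltr0_norm //; case: tuv; lra.
  have -> : 2 * pi - d = pi * (2 - (v - u)) by rewrite /d; ring.
  by rewrite pE ltr_pM2l // ltr_norml /m; apply/andP; split; lra.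
pose P n t := (1 - raised_cos m k t ^+ n) ^+ (2 ^ n).
have oP n : \int[mu]_(t in D) (a t * P n t) = 0.
  have [_ /(_ 0)[h _]] := trig_orthogonal_raised_cos_approx m k n (2 ^ n).
  rewrite -[RHS]h; apply: eq_Rintegral => t _.
  by rewrite /freq mulr0 mul0r cos0 mulr1.
have tP n : bounded_test (P n) by have [] := trig_orthogonal_raised_cos_approx m k n (2 ^ n).
have P1 n t : `|P n t| <= 1.
  have h : 0 <= 1 - raised_cos m k t ^+ n by rewrite subr_ge0 exprn_ile1.
  by rewrite ger0_norm ?exprn_ge0 // exprn_ile1 // gerBl exprn_ge0.
have ma : measurable_fun D a by have /integrableP[/measurable_EFinP] := ia.
pose chi : R -> R := \1_(~` `]u, v[%classic).
have mchi : measurable_fun D chi.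
  by apply: measurable_funTS; apply: measurable_indic; apply: measurableC; exact: measurable_itv.
have [_ _ cv] : [/\ mu.-integrable D (fun t => (a t * chi t)%:E),
    [sequence (\int[mu]_(x in D) `|(a x * P n x)%:E - (a x * chi x)%:E|)%E]_n @ \oo --> (0 : \bar R)
  & [sequence (\int[mu]_(x in D) (a x * P n x)%:E)%E]_n @ \oo -->
    (\int[mu]_(x in D) (a x * chi x)%:E)%E].
  apply: (@dominated_convergence _ _ _ mu D mD (fun n t => (a t * P n t)%:E)
    (fun t => (a t * chi t)%:E) (fun t => `|a t|%:E)).
  - by move=> n; apply/measurable_EFinP; apply: measurable_funM => //; have [] := tP n.
  - by apply/measurable_EFinP; exact: measurable_funM.
  (* The endpoints must be excluded: there the limit is that of (1 - 2^-n)^(2^n), namely 1/e. *)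
  - have ae_neq (w : R) : {ae mu, forall t, t != w}.
      exists [set w]; split; [exact: measurable_set1|exact: lebesgue_measure_set1|].
      by move=> t /= /negP; rewrite negbK => /eqP.
    apply: (@filterS2 _ _ (ae_filter_ringOfSetsType mu)) (ae_neq u) (ae_neq v) => t tu tv Dt.
    apply: cvg_EFin; first exact: nearW.
    apply: cvgM; first exact: cvg_cst.
    rewrite /chi indicE; have [h|h] := boolP (t \in ~` `]u, v[%classic).
      apply: cvg_step_below => //; apply: xout => //.
      move: h; rewrite inE /= => /negP; rewrite in_itv /= negb_and -!leNgt !le_eqVlt.
      by rewrite (negbTE tu) (eq_sym v) (negbTE tv) => /orP.
    apply: cvg_step_above => //.
    move: h; rewrite notin_setE /= => /contrapT; rewrite in_itv /= => /andP[]; exact: xin.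
  - exact: integrable_norm ia.
  - apply: aeW => t n _ /=; rewrite lee_fin normrM ler_piMr //.
have e0 : (\int[mu]_(x in D) (a x * chi x)%:E = 0)%E.
  apply: (cvg_unique _ cv) => //.
  rewrite (_ : [sequence _]_n = (fun=> 0%E)); first exact: cvg_cst.
  apply/funext => n /=; have := oP n; rewrite /Rintegral => h.
  by rewrite -[LHS]fineK ?h //; apply: integrable_fin_num => //; exact: integrable_test.
have tchi : bounded_test chi.
  by split=> //; exists 1 => t; rewrite /chi indicE normr_nat lern1 leq_b1.
have uvD : D `&` `]u, v[%classic = `]u, v[%classic.
  apply/setIidPr => t /=; rewrite !in_itv /= => /andP[ut tv].
  by rewrite (le_lt_trans u0 ut) (lt_le_trans tv v1).
rewrite -uvD Rintegral_mkcondr.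
have -> : \int[mu]_(x in D) (a \_ `]u, v[%classic) x = \int[mu]_(x in D) (a x - a x * chi x).
  apply: eq_Rintegral => t _; rewrite patchE /chi indicE in_setC.
  by case: (t \in _); rewrite /= ?mulr0 ?mulr1 ?subr0 ?subrr.
rewrite RintegralB //; last exact: integrable_test.
rewrite {2}/Rintegral e0 subr0 -[RHS](a_cos 0); apply: eq_Rintegral => t _.
by rewrite /freq mulr0 mul0r cos0 mulr1.
Qed.

(** The primitive of [a] vanishes on (0,1), so [a] vanishes almost everywhere by Lebesgue
    differentiation. For x > 1/2 the short arc is the complementary one, (x, 1). *)
Lemma trig_orthogonal_ae0 : {ae mu, forall t, D t -> a t = 0}.
Proof.
pose f := a \_ D; pose F x := \int[mu]_(t in `]-oo, x]) f t.
have a0 : \int[mu]_(t in D) a t = 0.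
  rewrite -[RHS](a_cos 0); apply: eq_Rintegral => t _.
  by rewrite /freq mulr0 mul0r cos0 mulr1.
have ifT : mu.-integrable setT (EFin \o f).
  rewrite /f -restrict_EFin; apply/integrable_restrict => //.
  by rewrite setTI.
have F0 x : D x -> F x = 0.
  rewrite /= in_itv /= => /andP[x0 x1].
  have xD : `]-oo, x]%classic `&` D = `]0, x]%classic.
    apply/seteqP; split => t /=; rewrite !in_itv /=.
      by move=> [tx /andP[-> _]].
    by move=> /andP[t0 tx]; rewrite t0 (le_lt_trans tx x1).
  rewrite /F -Rintegral_mkcondr xD.
  have sub (A : set R) : measurable A -> A `<=` D -> mu.-integrable A (EFin \o a).
    by move=> mA AD; exact: integrableS ia.
  have [xh|xh] := leP x 2^-1.
    rewrite -Rintegral_itv_bndo_bndc ?integral_itv_eq0 ?subr0 //; first exact: ltW.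
    apply: sub; first exact: measurable_itv.
    by move=> t /=; rewrite !in_itv /= => /andP[-> /lt_trans]; exact.
  have DU : D = `]0, x]%classic `|` `]x, 1[%classic.
    by rewrite -itv_bndbnd_setU // bnd_simp ltW.
  have := a0; rewrite DU Rintegral_setU.
  - rewrite (@integral_itv_eq0 x 1) ?addr0 //; [exact: ltW|lra].
  - exact: measurable_itv.
  - exact: measurable_itv.
  - by rewrite -DU.
  - apply/disj_setPRL => t /=; rewrite !in_itv /= => /andP[xt _].
    by apply/negP; rewrite leNgt xt andbF.
have iy y : mu.-integrable `]-oo, y] (EFin \o f).
  by apply: integrableS ifT => //; exact: measurable_itv.
apply: (@filterS _ _ (ae_filter_ringOfSetsType mu))
  (FTC1Ny iy (integrable_locally_restrict mD ia)) => t [dF Ft] Dt.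
have : 'D_1 F t = 'D_1 (cst 0) t.
  apply: near_eq_derive; apply: (filterS F0).
  by apply: open_nbhs_nbhs; split=> //; exact: interval_open.
rewrite derive_cst -derive1E [LHS]Ft /f patchE mem_set //.
Qed.

End Orthogonality.

Lemma L2_exp_total (x : L2 R) :
  (forall n : int, L2_dot x (L2_exp (2 * pi * n%:~R)) = 0) -> x = 0.
Proof.
move=> xe; have xP := L2_repr_square_integrable x.
pose a t := Re (repr x t); pose b t := Im (repr x t).
(* On a space of finite measure square integrable implies integrable, through |p z| <= 1 + |z|^2. *)
have ix (p : R[i] -> R) : measurable_fun D (fun t => p (repr x t)) ->
    (forall z, `|p z| <= 1 + sqmod z) -> mu.-integrable D (EFin \o (fun t => p (repr x t))).
  move=> mp hp.
  have i1 : mu.-integrable D (EFin \o cst (1 : R)).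
    apply/integrableP; split; first exact/measurable_EFinP.
    under eq_integral do rewrite /= normr1.
    by rewrite integral_cst //= mul1e lebesgue_measure_itv /= lte01 sube0 ltry.
  apply: (le_integrable mD _ _ (integrableD mD i1 (sqmod_integrable xP))).
    exact/measurable_EFinP.
  move=> t _; rewrite /= lee_fin (ger0_norm (_ : 0 <= 1 + _)) //.
  by rewrite addr_ge0 // sqmod_ge0.
have [mr mi _] := xP.
have ia : mu.-integrable D (EFin \o a).
  apply: (ix (fun z => Re z)) => // z; rewrite sqmodE ler_norml.
  by case: z => p q /=; apply/andP; split; nra.
have ib : mu.-integrable D (EFin \o b).
  apply: (ix (fun z => Im z)) => // z; rewrite sqmodE ler_norml.
  by case: z => p q /=; apply/andP; split; nra.
pose Ic (f : R -> R) n := \int[mu]_(t in D) (f t * cos (freq n t)).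
pose Is (f : R -> R) n := \int[mu]_(t in D) (f t * sin (freq n t)).
have xn n : Ic a n + Is b n = 0 /\ Ic b n - Is a n = 0.
  have := xe n; rewrite -[x in L2_dot x _]L2_class_repr L2_dot_class //; last first.
    exact: L2_exp_square_integrable.
  rewrite /complex_integral => /eqP; rewrite eq_complex /= => /andP[/eqP h1 /eqP h2].
  split.
    rewrite -[RHS]h1 -RintegralD //;
      [|exact: integrable_test (bounded_test_cos n)
       |exact: integrable_test (bounded_test_sin n)].
    apply: eq_Rintegral => t _; rewrite /a /b /freq.
    by case: (L2fun_val (repr x) t) => p q /=; ring.
  rewrite -[RHS]h2 -RintegralB //;
    [|exact: integrable_test (bounded_test_cos n)
     |exact: integrable_test (bounded_test_sin n)].
  apply: eq_Rintegral => t _; rewrite /a /b /freq.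
  by case: (L2fun_val (repr x) t) => p q /=; ring.
have cN f n : Ic f (- n) = Ic f n.
  by apply: eq_Rintegral => t _; rewrite /freq mulrNz mulrN mulNr cosN.
have sN f n : mu.-integrable D (EFin \o f) -> Is f (- n) = - Is f n.
  move=> iF; rewrite -[RHS]mulN1r -RintegralZl //; last exact: integrable_test (bounded_test_sin n).
  by apply: eq_Rintegral => t _; rewrite /freq mulrNz mulrN mulNr sinN; ring.
(* Cosine is even and sine odd, so the equations at n and -n separate the four integrals. *)
have z n : [/\ Ic a n = 0, Is a n = 0, Ic b n = 0 & Is b n = 0].
  have [h1 h2] := xn n; have [] := xn (- n); rewrite !cN !sN // => h3 h4.
  by split; lra.
have a0 : {ae mu, forall t, D t -> a t = 0}.
  by apply: trig_orthogonal_ae0 => // n; have [] := z n.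
have b0 : {ae mu, forall t, D t -> b t = 0}.
  by apply: trig_orthogonal_ae0 => // n; have [] := z n.
rewrite -L2_class0 -(L2_class_repr x); apply/L2_class_eq => //.
  exact: square_integrable0.
apply: (@filterS2 _ _ (ae_filter_ringOfSetsType mu)) a0 b0 => t ha hb Dt.
apply/eqP; rewrite eq_complex; have := ha Dt; have := hb Dt; rewrite /a /b => -> ->.
by rewrite !eqxx.
Qed.

End TrigonometricTotality.

(** * Moments and interpolation *)

Section Moments.
Context {F : fieldType} {I : eqType}.
Variable x : I -> F.
Hypothesis x_inj : injective x.
Implicit Types (c : I -> F) (s : seq I).

Lemma moments_horner c s (K : nat) :
  (forall k, (k < K)%N -> \sum_(n <- s) c n * x n ^+ k = 0) ->
  forall p : {poly F}, (size p <= K)%N -> \sum_(n <- s) c n * p.[x n] = 0.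
Proof.
move=> mom0 p pK; under eq_bigr do rewrite horner_coef mulr_sumr.
rewrite exchange_big big1 //= => k _.
transitivity (p`_k * \sum_(n <- s) c n * x n ^+ k).
  by rewrite mulr_sumr; apply: eq_bigr => n _; rewrite mulrCA.
by rewrite mom0 ?mulr0 // (leq_trans (ltn_ord k)).
Qed.

Definition node_poly s : {poly F} := \prod_(j <- s) ('X - (x j)%:P).

Lemma size_node_poly s : size (node_poly s) = (size s).+1.
Proof. by rewrite /node_poly size_prod_XsubC. Qed.

Lemma node_polyE s (y : F) : (node_poly s).[y] = \prod_(j <- s) (y - x j).
Proof. by rewrite horner_prod; apply: eq_bigr => j _; rewrite hornerXsubC. Qed.

Lemma node_poly_eq0 s n : ((node_poly s).[x n] == 0) = (n \in s).
Proof.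
rewrite node_polyE prodf_seq_eq0; apply/hasP/idP => [[j js]|ns].
  by rewrite subr_eq0 => /eqP/x_inj ->.
by exists n; rewrite //= subrr.
Qed.

(** Vandermonde: the node polynomial of the other points has degree [size s] - 1 and isolates the
    coefficient at [n]. *)
Lemma moments_separate c s : uniq s ->
  (forall k, (k < size s)%N -> \sum_(n <- s) c n * x n ^+ k = 0) ->
  forall n, n \in s -> c n = 0.
Proof.
move=> us mom0 n ns; have s0 : (0 < size s)%N by case: (s) ns.
have := moments_horner mom0 (p := node_poly (rem n s)).
rewrite size_node_poly size_rem // prednK // leqnn => /(_ isT).
rewrite (bigD1_seq n) //= big_seq_cond big1 ?addr0 => [/eqP|j /andP[js jn]].
  by rewrite mulf_eq0 node_poly_eq0 mem_rem_uniq // inE eqxx orbF => /eqP.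
by apply/eqP; rewrite mulf_eq0 node_poly_eq0 mem_rem_uniq // inE jn js orbT.
Qed.

(** For k < [size s], X^k equals its Lagrange interpolant at the nodes of [s]; evaluation at x_n is
    the moment condition, with coefficients the negated Lagrange polynomials at x_n. *)
Lemma moments_interpolation s n : uniq s -> n \notin s -> exists c : I -> F,
  c n = 1 /\ forall k, (k < size s)%N -> \sum_(m <- n :: s) c m * x m ^+ k = 0.
Proof.
move=> us ns.
pose l m : {poly F} := (node_poly (rem m s)).[x m]^-1 *: node_poly (rem m s).
have lm m j : m \in s -> j \in s -> (l m).[x j] = (m == j)%:R.
  move=> ms js; rewrite hornerZ; have [<-|mj] := eqVneq m j.
    by rewrite mulVf // node_poly_eq0 mem_rem_uniq // inE eqxx.
  rewrite mulr0n; apply/eqP; rewrite mulf_eq0 [X in _ || X]node_poly_eq0 mem_rem_uniq //.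
  by rewrite inE (eq_sym j) mj js orbT.
exists (fun m => if m == n then 1 else - (l m).[x n]); split=> [|k ks]; first by rewrite eqxx.
rewrite big_cons eqxx mul1r.
pose q : {poly F} := 'X^k - \sum_(m <- s) x m ^+ k *: l m.
have q0 : q = 0.
  apply: (@roots_geq_poly_eq0 _ q [seq x m | m <- s]).
  - apply/allP => _ /mapP[j js ->]; rewrite rootE /q hornerD hornerN hornerXn horner_sum.
    rewrite (bigD1_seq j) //= hornerZ lm // eqxx mulr1 big_seq_cond big1 ?addr0 ?subrr //.
    by move=> m /andP[ms mj]; rewrite hornerZ lm // (negbTE mj) mulr0.
  - by rewrite map_inj_uniq.
  - rewrite size_map; apply: leq_trans (size_polyD _ _) _; rewrite geq_max size_polyXn ks.
    rewrite size_polyN; apply: leq_trans (size_sum _ _ _) _; apply/bigmax_leqP_seq => m ms _.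
    apply: leq_trans (size_scale_leq _ _) _; apply: leq_trans (size_scale_leq _ _) _.
    by rewrite size_node_poly size_rem // prednK //; case: (s) ms.
have := congr1 (fun p : {poly F} => p.[x n]) q0.
rewrite /q hornerD hornerN hornerXn horner_sum horner0 => h; rewrite -[RHS]h; congr (_ + _).
rewrite -sumrN big_seq [RHS]big_seq; apply: eq_bigr => m ms.
have -> : (m == n) = false by apply: contraNF ns => /eqP <-.
by rewrite (hornerZ (x m ^+ k)) mulNr mulrC.
Qed.

(** Testing against the node polynomial of [rem m s] leaves only the points [n] and [m]. The
    relation shows how c_m grows with x_n. *)
Lemma moments_coef c s n m : uniq s -> n \notin s -> m \in s ->
  (forall k, (k < size s)%N -> \sum_(j <- n :: s) c j * x j ^+ k = 0) ->
  c n * \prod_(j <- rem m s) (x n - x j) = - (c m * \prod_(j <- rem m s) (x m - x j)).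
Proof.
move=> us ns ms mom0; have s0 : (0 < size s)%N by case: (s) ms.
have := moments_horner mom0 (p := node_poly (rem m s)).
rewrite size_node_poly size_rem // prednK // leqnn => /(_ isT).
rewrite big_cons (bigD1_seq m) //= big_seq_cond big1 ?addr0 ?node_polyE => [/eqP|j /andP[js jm]].
  by rewrite addr_eq0 => /eqP.
by apply/eqP; rewrite mulf_eq0 node_poly_eq0 mem_rem_uniq // inE jm js orbT.
Qed.

End Moments.

(** * Weighted dual systems *)

Section WeightedDual.
Context {R : realType}.
Local Notation mu := (@lebesgue_measure R).
Local Notation D := (`]0%R, 1%R[%classic : set R).

Let mD : measurable (D : set (measurableTypeR R)).
Proof. exact: measurable_itv. Qed.

Let aeF := ae_filter_ringOfSetsType mu.

Lemma L2_mulpow_dot (alpha : R) (x y : L2 R) : 0 <= alpha ->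
  L2_dot (L2_mulpow alpha x) y = L2_dot x (L2_mulpow alpha y).
Proof.
move=> a0; have xP := L2_repr_square_integrable x; have yP := L2_repr_square_integrable y.
rewrite -{1}(L2_class_repr y) -{2}(L2_class_repr x) /L2_mulpow.
rewrite !L2_dot_class //; try exact: L2_mulpow_square_integrable.
have conjR (k : R) (z w : R[i]) : k%:C * z * w^* = z * (k%:C * w)^*.
  by case: z w => ? ? [? ?]; apply/eqP; rewrite eq_complex /=; apply/andP; split; apply/eqP; ring.
rewrite /complex_integral; congr (_ +i* _); apply: eq_Rintegral => t _; by rewrite conjR.
Qed.

Lemma L2_mulpow_eq0 (alpha : R) (x : L2 R) : 0 <= alpha ->
  L2_mulpow alpha x = 0 -> x = 0.
Proof.
move=> a0; rewrite -L2_class0 => x0.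
have [_ ->] := L2_mulpow_unweightE a0 square_integrable0 x0.
by congr L2_class; apply/funext => t; rewrite /unweight mulr0.
Qed.

Lemma rnorm_L2_mulpow (alpha : R) (x : L2 R) : 0 <= alpha ->
  rnorm (L2_mulpow alpha x) <= rnorm x.
Proof.
move=> a0; have xP := L2_repr_square_integrable x.
rewrite -(@ler_pXn2r _ 2%N) ?nnegrE ?rnorm_ge0 // -lee_fin /L2_mulpow.
rewrite rnorm_class ?rnorm_repr; last exact: L2_mulpow_square_integrable.
apply: ge0_le_integral => //.
- by move=> t _; rewrite lee_fin sqmod_ge0.
- by apply: measurable_sqmod; exact: L2_mulpow_square_integrable.
- exact: measurable_sqmod.
move=> t; rewrite /= in_itv /= => /andP[t0 t1]; rewrite lee_fin !sqmod_rnorm rnormM exprMn.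
rewrite ler_piMl ?sqr_ge0 // rnorm_real ger0_norm ?powR_ge0 //.
by rewrite exprn_ile1 ?powR_ge0 // powR_le1 // ltW.
Qed.

Lemma rnorm_L2_exp (l : R) : rnorm (L2_exp l) = 1.
Proof.
apply/eqP; rewrite -(@eqrXn2 _ 2%N) ?rnorm_ge0 // expr1n; apply/eqP/EFin_inj.
rewrite rnorm_class; last exact: L2_exp_square_integrable.
under eq_integral do rewrite sqmodE /= cos2Dsin2.
by rewrite integral_cst //= mul1e lebesgue_measure_itv /= lte01 sube0.
Qed.

Lemma rnorm_sqr_inj (V : normedZmodType R[i]) (x y : V) :
  rnorm x ^+ 2 = rnorm y ^+ 2 -> rnorm x = rnorm y.
Proof. by move=> /eqP; rewrite eqrXn2 ?rnorm_ge0 // => /eqP. Qed.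

(** As |exp(i l t)| = 1, both are the norm of t^alpha. *)
Lemma rnorm_L2_mulpow_exp (alpha l m : R) : 0 <= alpha ->
  rnorm (L2_mulpow alpha (L2_exp l)) = rnorm (L2_mulpow alpha (L2_exp m)).
Proof.
move=> a0; suff h k : ((rnorm (L2_mulpow alpha (L2_exp k)) ^+ 2)%:E =
    \int[mu]_(t in D) ((t `^ alpha) ^+ 2)%:E)%E.
  exact: rnorm_sqr_inj (EFin_inj (etrans (h l) (esym (h m)))).
have eP := L2_exp_square_integrable k; have rP := L2_repr_square_integrable (L2_exp k).
have mP := L2_mulpow_square_integrable a0 rP; rewrite rnorm_class //.
apply: ae_eq_integral => //.
- exact: measurable_sqmod.
- apply/measurable_EFinP; apply: measurable_funX; apply: measurable_funTS.
  exact: measurable_powR.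
- apply: (@filterS _ _ aeF) (L2_classE eP) => t h Dt.
  rewrite (h Dt) sqmod_rnorm rnormM exprMn -[X in _ * X]sqmod_rnorm sqmodE /= cos2Dsin2.
  by rewrite mulr1 rnorm_real ger0_norm // powR_ge0.
Qed.

(** Pointwise |exp(i l t) - exp(i m t)| = |exp(i (l - m) t) - 1|, estimated by the Taylor bound of
    order 1. *)
Lemma rnorm_L2_expB (l m : R) : rnorm (L2_exp l - L2_exp m) <= 2 * `|l - m|.
Proof.
rewrite -(@ler_pXn2r _ 2%N) ?nnegrE ?rnorm_ge0 ?mulr_ge0 // -lee_fin.
have lP := L2_exp_square_integrable l; have mP := L2_exp_square_integrable m.
rewrite rnorm_class_sub //.
apply: (@le_trans _ _ (\int[mu]_(t in D) ((2 * `|l - m|) ^+ 2)%:E)%E); last first.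
  by rewrite integral_cst //= lebesgue_measure_itv /= lte01 sube0 mule1.
apply: ge0_le_integral => //.
- by move=> t _; rewrite lee_fin sqmod_ge0.
- have := measurable_sqmod (square_integrableD lP (square_integrableZ (-1) mP)).
  by congr measurable_fun; apply/funext => t; rewrite /= mulN1r.
move=> t; rewrite /= in_itv /= => /andP[t0 t1]; rewrite lee_fin.
rewrite -[X in sqmod X]/(cexp (l * t) - cexp (m * t)) sqmod_cexpB -mulrBl.
have <- : sqmod (cexp ((l - m) * t) - cexp 0) = 2 - 2 * cos ((l - m) * t).
  by rewrite sqmod_cexpB subr0.
rewrite sqmod_rnorm ler_pXn2r ?nnegrE ?rnorm_ge0 ?mulr_ge0 //.
have := rnorm_cexp_taylor 1 ((l - m) * t).
have c0 : 1%:C = cexp 0 :> R[i] by rewrite /cexp cos0 sin0.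
rewrite /ctaylor big_ord1 !expr0 divr1 mul1r c0.
move=> /le_trans; apply; rewrite ler_wpM2l // expr1 normrM (gtr0_norm t0).
by rewrite ler_piMr // ltW.
Qed.

Lemma half_le : 1 - 2^-1 <= 2^-1 :> R.
Proof. by lra. Qed.

Lemma double_gap (q : R) : 0 <= q -> q < 2 * (q + 1 + 1) - 1.
Proof. by lra. Qed.

Lemma le_of_mul_sqr_le1 (a y : R) : 0 < a -> a * y ^+ 2 <= 1 -> y <= a^-1 + 1.
Proof.
move=> a0; rewrite -ler_pdivlMl // mulr1 => h.
by apply: (@le_trans _ _ (y ^+ 2 + 1)); [nra|rewrite lerD2r].
Qed.

Lemma pred_add_half (M : nat) (a : R) :
  (0 < M)%N -> M%:R - 2^-1 <= a -> M.-1%:R + 2^-1 <= a.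
Proof. by case: M => // M _; rewrite /= -natr1; lra. Qed.

Section Core.
Variables (lambda : int -> R) (r : int -> L2 R) (s : seq int) (alpha : R).
Let e n := L2_exp (lambda n).
Hypothesis alpha_gt0 : 0 < alpha.
Hypothesis us : uniq s.
Hypothesis er : biorthogonal (@L2_dot R) e r [set: int].
Hypothesis r_total : forall x : L2 R, (forall n, L2_dot x (r n) = 0) -> x = 0.

Let J : set int := ~` [set n | n \in s].
Let f n := L2_mulpow alpha (r n).
Let alpha_ge0 : 0 <= alpha := ltW alpha_gt0.
Let z n : R[i] := (lambda n)%:C.

Let er' n m : L2_dot (e n) (r m) = (n == m)%:R.
Proof. exact: er. Qed.

Let L2_dotC (x y : L2 R) : L2_dot x y = (L2_dot y x)^*.
Proof. exact: (dotC (@L2_dot R)). Qed.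

(** Equal frequencies would make <e_n, r_n> = 1 and <e_m, r_n> = 0 coincide. *)
Lemma biorthogonal_exp_inj : injective z.
Proof.
move=> n m /complexI nm; apply/eqP; have := er' n n; rewrite eqxx /e nm -/(e m) er'.
by rewrite eq_sym; case: eqP => // _ /eqP; rewrite eq_sym oner_eq0.
Qed.

Lemma exp_sum_coef (c : int -> R[i]) (u : seq int) m : uniq u ->
  L2_dot (\sum_(n <- u) c n *: e n) (r m) = if m \in u then c m else 0.
Proof.
move=> uu; transitivity (\sum_(n <- u) c n * (n == m)%:R).
  rewrite (linear_sumlz (@L2_dot R)) /=; apply: eq_bigr => n _.
  by rewrite [LHS](linearZl_LR (@L2_dot R)) /= [X in _ * X]er'.
case: ifPn => mu'.
  rewrite (bigD1_seq m) //= eqxx mulr1 big1 ?addr0 // => n nm.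
  by rewrite (negbTE nm) mulr0.
rewrite big_seq big1 // => n nu; have [nm|nm] := eqVneq n m; last by rewrite mulr0.
by rewrite nm (negbTE mu') in nu.
Qed.

(** The difference of the two sides is orthogonal to every r_m: for [m] in [u] the coefficients
    agree, outside [u] both products vanish. *)
Lemma orthogonal_expansion (u : seq int) (g : L2 R) : uniq u ->
  (forall n, n \notin u -> L2_dot (f n) g = 0) ->
  L2_mulpow alpha g = \sum_(n <- u) (L2_dot g (f n)) *: e n.
Proof.
move=> uu fg; apply/eqP; rewrite -subr_eq0; apply/eqP; apply: r_total => m.
rewrite [LHS](linearBl (@L2_dot R)) /= [X in _ - X]exp_sum_coef //.
rewrite [X in X - _]L2_mulpow_dot // -/(f m).
case: ifPn => [_|mu']; first by rewrite subrr.
by rewrite L2_dotC fg // conjC0 subrr.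
Qed.

Lemma expansion_moments_separate (u : seq int) (c : int -> R[i]) (g : L2 R) (K : nat) :
  uniq u -> L2_mulpow alpha g = \sum_(n <- u) c n *: e n ->
  (size u <= K.+1)%N -> K%:R + 2^-1 <= alpha -> forall n, n \in u -> c n = 0.
Proof.
move=> uu; have [fP <-] := expsum_class lambda c u => gE uK aK.
have [uP _] := L2_mulpow_unweightE alpha_ge0 fP gE.
apply: (moments_separate biorthogonal_exp_inj) => // k ku.
by apply: (moment_eq0 aK uP); rewrite -ltnS (leq_trans ku).
Qed.

(** [g] is described through t^alpha g, which determines it; the coefficients and their moment
    conditions are kept because the growth estimates work on them. *)
Definition dual_vector n (g : L2 R) := exists c : int -> R[i],
  [/\ c n = 1, forall k, (k < size s)%N -> moment lambda c (n :: s) k = 0 &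
      L2_mulpow alpha g = \sum_(m <- n :: s) c m *: e m].

Lemma dual_vector_exists n : n \notin s -> alpha < (size s)%:R + 2^-1 ->
  exists g, dual_vector n g.
Proof.
move=> ns aM; have [c [cn mom0]] := moments_interpolation biorthogonal_exp_inj us ns.
have uP := unweight_expsum_square_integrable aM mom0.
have [fP fE] := expsum_class lambda c (n :: s).
exists (L2_class (unweight alpha (expsum lambda c (n :: s)))), c.
by split=> //; rewrite L2_mulpow_unweight.
Qed.

Lemma dual_vector_dot n g m : n \notin s -> m \notin s -> dual_vector n g ->
  L2_dot (f m) g = (m == n)%:R.
Proof.
move=> ns ms [c [cn _ gE]]; rewrite L2_mulpow_dot // L2_dotC gE exp_sum_coef /= ?ns //.
rewrite inE (negbTE ms) orbF; case: eqP => [->|_]; first by rewrite cn conjC1.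
by rewrite conjC0.
Qed.

Let sep := closure_lspan_separation (@L2_normE R) (@L2_geometric_cvg R).
Let orth := closure_orthogonal (@L2_normE R).

Lemma weighted_complete : (0 < size s)%N -> (size s)%:R - 2^-1 <= alpha ->
  complete_system f J.
Proof.
move=> s0 aM; apply/seteqP; split=> // x _; apply: contrapT => /sep[g [fg xg]].
have fg' n : n \notin s -> L2_dot (f n) g = 0 by move=> ns; apply: fg; exact/negP.
have gE := orthogonal_expansion us fg'.
have aK : (size s).-1%:R + 2^-1 <= alpha.
  exact: pred_add_half.
have sK : (size s <= (size s).-1.+1)%N by rewrite prednK.
have c0 := expansion_moments_separate us gE sK aK.
move: xg; rewrite (_ : g = 0) ?(linear0r (@L2_dot R)) ?eqxx //.
apply: (L2_mulpow_eq0 alpha_ge0); rewrite gE big_seq big1 // => n ns.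
by rewrite (c0 n ns) scale0r.
Qed.

Lemma weighted_minimal : alpha < (size s)%:R + 2^-1 -> minimal_system f J.
Proof.
move=> aM n Jn; have ns : n \notin s by exact/negP.
have [g gn] := dual_vector_exists ns aM; move=> cn.
have fg m : (J `\ n) m -> L2_dot (f m) g = 0.
  move=> [/negP ms mn]; rewrite (dual_vector_dot ns ms gn).
  by case: eqP => // mn'; case: mn.
have : L2_dot (f n) g = 0 by exact: (orth fg cn).
by rewrite (dual_vector_dot ns ns gn) eqxx => /eqP; rewrite oner_eq0.
Qed.

(** Below the range, the sum over [s] with [size s] - 1 vanishing moments stays square integrable
    after division by t^alpha. The quotient is orthogonal to the whole system and is nonzero because
    one coefficient is 1. *)
Lemma complete_weight_ge : (0 < size s)%N -> complete_system f J ->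
  (size s)%:R - 2^-1 <= alpha.
Proof.
move=> s0 cf; rewrite leNgt; apply/negP => aM.
have [m0 [s' sE]] : exists m0 s', s = m0 :: s' by case: (s) s0 => // m0 s'; exists m0, s'.
have /andP[ms us'] : (m0 \notin s') && uniq s' by have := us; rewrite sE.
have [c [cm mom0]] := moments_interpolation biorthogonal_exp_inj us' ms.
have aM' : alpha < (size s')%:R + 2^-1
  by apply: lt_le_trans aM _; rewrite sE /= -natr1 -addrA lerD2l; exact: half_le.
have uP := unweight_expsum_square_integrable aM' mom0.
have [fP fE] := expsum_class lambda c (m0 :: s').
pose g := L2_class (unweight alpha (expsum lambda c (m0 :: s'))).
have gE : L2_mulpow alpha g = \sum_(n <- s) c n *: e n.
  by rewrite L2_mulpow_unweight // fE sE.
have fg n : J n -> L2_dot (f n) g = 0.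
  move=> /negP ns; rewrite L2_mulpow_dot // L2_dotC gE exp_sum_coef // (negbTE ns).
  exact: conjC0.
have cg : closure (lspan f J) g by rewrite cf.
have : L2_dot g g = 0 by exact: (orth fg cg).
move=> /eqP; rewrite [_ == 0](dnorm_eq0 (@L2_dot R)) => /eqP g0.
have := exp_sum_coef c m0 us; rewrite -gE g0 {1}sE mem_head cm.
have -> : L2_mulpow alpha (0 : L2 R) = 0.
  apply: r_total => n; rewrite L2_mulpow_dot //; exact: (linear0l (@L2_dot R)).
by rewrite [LHS](linear0l (@L2_dot R)) => /eqP; rewrite eq_sym oner_eq0.
Qed.

(** A vector separating f_n from the others would give a sum over the [size s] + 1 frequencies of
    [n :: s] with as many vanishing moments, whose coefficients are all 0. *)
Lemma minimal_weight_lt : minimal_system f J -> alpha < (size s)%:R + 2^-1.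
Proof.
move=> mf; rewrite ltNge; apply/negP => aM.
(* S + 1 is an index outside [s]: as a member it would satisfy |S + 1| <= S. *)
pose S : int := \sum_(m <- s) `|m|.
have ns : S + 1 \notin s.
  apply/negP => ns; suff : `|S + 1| <= S.
    by move=> /(le_trans (ler_norm _)); rewrite gerDl.
  rewrite {2}/S (bigD1_seq _ ns us) /= lerDl.
  by apply: sumr_ge0 => i _; exact: normr_ge0.
have Jn : J (S + 1) by exact/negP.
move: (S + 1) ns Jn => n ns Jn.
have un : uniq (n :: s) by rewrite /= ns.
have /sep[g [fg fng]] := mf n Jn.
have fg' m : m \notin n :: s -> L2_dot (f m) g = 0.
  rewrite inE negb_or => /andP[mn ms]; apply: fg; split; first exact/negP.
  by apply/eqP.
have gE := orthogonal_expansion un fg'.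
have c0 := expansion_moments_separate un gE (leqnn _) aM (mem_head _ _).
by move: fng => /eqP; apply; rewrite [LHS]L2_dotC c0 conjC0.
Qed.

Lemma weighted_exact_iff : (0 < size s)%N ->
  exact_system f J <-> (size s)%:R - 2^-1 <= alpha < (size s)%:R + 2^-1.
Proof.
move=> s0; split=> [[cf mf]|/andP[a1 a2]].
  by apply/andP; split; [exact: complete_weight_ge|exact: minimal_weight_lt].
by split; [exact: weighted_complete|exact: weighted_minimal].
Qed.

Lemma dual_unbounded_single (m : int) : s = [:: m] -> 2^-1 <= alpha ->
  (forall B : R, exists n, B < `|lambda n|) ->
  ~ exists C : R, forall n, n \notin s -> exists2 g, dual_vector n g & rnorm g <= C.
Proof.
move=> sE a2 unb [C hC].
(* Since ln(2 eps) = -b with b = C^2 + 2, the lower bound -2 ln(2 eps) - 1 equals 2 C^2 + 3 and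
   exceeds C^2. *)
pose b := (C ^+ 2 + 1) + 1; pose eps := expR (- b) / 2.
have b0 : 0 < b by rewrite ltr_wpDl // addr_ge0 // sqr_ge0.
have eps0 : 0 < eps by rewrite divr_gt0 // expR_gt0.
have eps2 : eps < 2^-1 by rewrite /eps gtr_pMl ?invr_gt0 // expR_lt1 oppr_lt0.
have [n nB] := unb (`|lambda m| + 6 / eps ^+ 2).
have e6 : 0 < 6 / eps ^+ 2 by rewrite divr_gt0 // exprn_gt0.
have nm : n != m by apply: contraTneq nB => ->; rewrite -leNgt lerDl ltW.
have ns : n \notin s by rewrite sE inE.
have far : 6 / eps ^+ 2 <= `|lambda n - lambda m|.
  apply: le_trans (lerB_dist _ _); rewrite lerBrDl; exact: ltW.
have [g [c [cn mom0 gE]] gC] := hC n ns.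
have cm : c m = -1.
  have := mom0 0%N; rewrite sE /= => /(_ isT).
  by rewrite /moment !big_cons big_nil !expr0 !mulr1 addr0 cn addrC => /eqP; rewrite addr_eq0 => /eqP.
have [fP fE] := expsum_class lambda c (n :: s); rewrite -fE in gE.
have [uP gu] := L2_mulpow_unweightE alpha_ge0 fP gE.
have pE : expsum lambda c (n :: s) = (fun t => cexp (lambda n * t) - cexp (lambda m * t)).
  by apply/funext => t; rewrite /expsum sE !big_cons big_nil cn cm mul1r mulN1r addr0.
rewrite pE in uP gu.
have low := unweight_cexpB_ge a2 eps0 eps2 far uP.
rewrite -rnorm_class // -gu lee_fin in low.
have lnE : ln (2 * eps) = - b.
  by rewrite /eps mulrC divfK // expRK.
rewrite lnE in low.
have C2 : rnorm g ^+ 2 <= C ^+ 2.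
  by rewrite ler_pXn2r ?nnegrE ?rnorm_ge0 // (le_trans (rnorm_ge0 g)).
have := le_trans low C2; rewrite mulrNN /b leNgt => /negP; apply.
exact: double_gap (sqr_ge0 C).
Qed.

Lemma rnorm_prod (T : Type) (u : seq T) (F : T -> R[i]) :
  rnorm (\prod_(j <- u) F j) = \prod_(j <- u) rnorm (F j).
Proof.
apply: (big_morph _ (@rnormM R)).
by rewrite -[1]/(1%:C) rnorm_real normr1.
Qed.

(** The coefficient c_m is <t^alpha g, r_m>, hence bounded when [g] is, but [moments_coef] makes it
    proportional to a product with at least one factor growing in lambda_n. *)
Lemma dual_unbounded_many (m m' : int) (s' : seq int) : s = [:: m, m' & s'] ->
  (forall B : R, exists n, B < `|lambda n|) ->
  ~ exists C : R, forall n, n \notin s -> exists2 g, dual_vector n g & rnorm g <= C.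
Proof.
move=> sE unb [C hC].
pose S := \sum_(j <- s) `|lambda j|.
have ljS j : j \in s -> `|lambda j| <= S.
  move=> js; rewrite /S (bigD1_seq j) //= lerDl.
  by apply: sumr_ge0 => i _; exact: normr_ge0.
have S0 : 0 <= S by apply: sumr_ge0 => i _; exact: normr_ge0.
pose P := \prod_(j <- rem m s) rnorm (z m - z j).
have P0 : 0 <= P by apply: prodr_ge0 => j _; exact: rnorm_ge0.
(* Bound for the product of the |lambda_n - lambda_j|, j in [rem m s], if |g| <= C. Once each
   distance exceeds 1 + Q, one factor beats Q and the others are at least 1. *)
pose Q := `|C| * rnorm (r m) * P.
have Q0 : 0 <= Q by rewrite !mulr_ge0 ?rnorm_ge0.
have [n nB] := unb (S + 1 + Q).
have far j : j \in s -> 1 + Q < rnorm (z n - z j).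
  move=> js; rewrite -rmorphB rnorm_real; apply: lt_le_trans (lerB_dist _ _).
  rewrite ltrBrDl; apply: le_lt_trans nB; rewrite addrA !lerD2r; exact: ljS.
have ns : n \notin s.
  apply/negP => /far; rewrite subrr rnorm0 ltNge addr_ge0 //.
have ms : m \in s by rewrite sE mem_head.
have [g [c [cn mom0 gE]] gC] := hC n ns.
have := congr1 rnorm (moments_coef biorthogonal_exp_inj us ns ms mom0).
rewrite cn mul1r rnormN rnormM !rnorm_prod -/P => eqn.
have cmE : c m = L2_dot (L2_mulpow alpha g) (r m).
  rewrite gE exp_sum_coef /= ?ns //; first by rewrite inE ms orbT.
have cmC : rnorm (c m) <= `|C| * rnorm (r m).
  rewrite cmE; apply: le_trans (rnorm_dot_le (dot := @L2_dot R) (@L2_normE R) _ _) _.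
  rewrite ler_wpM2r ?rnorm_ge0 //; apply: le_trans (rnorm_L2_mulpow _ alpha_ge0) _.
  exact: le_trans gC (ler_norm C).
have up : \prod_(j <- rem m s) rnorm (z n - z j) <= Q.
  by rewrite eqn ler_wpM2r.
have remE : rem m s = m' :: s' by rewrite sE /= eqxx.
have m's : m' \in s by rewrite sE !inE eqxx orbT.
have rest : 1 <= \prod_(j <- s') rnorm (z n - z j).
  rewrite big_seq; apply: (big_ind (fun y => 1 <= y)) => //.
    by move=> x y x1 y1; rewrite -[1]mulr1 ler_pM.
  move=> j js; apply: ltW; apply: le_lt_trans (far j _); first by rewrite lerDl.
  by rewrite sE !inE js !orbT.
have : Q < \prod_(j <- rem m s) rnorm (z n - z j).
  rewrite remE big_cons; apply: lt_le_trans (ler_peMr (rnorm_ge0 _) rest).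
  by apply: le_lt_trans (far m' m's); rewrite lerDr.
by rewrite ltNge up.
Qed.

Lemma dual_unbounded : (0 < size s)%N -> (size s)%:R - 2^-1 <= alpha ->
  (forall B : R, exists n, B < `|lambda n|) ->
  ~ exists C : R, forall n, n \notin s -> exists2 g, dual_vector n g & rnorm g <= C.
Proof.
move=> s0 sa unb.
have [[m sE]|[m [m' [s' sE]]]] :
    (exists m, s = [:: m]) \/ exists m m' s', s = [:: m, m' & s'].
  case: (s) s0 => [//|m [|m' s']] _; first by left; exists m.
  by right; exists m, m', s'.
- apply: (dual_unbounded_single sE _ unb).
  by have := pred_add_half s0 sa; rewrite sE /= add0r.
- exact: (dual_unbounded_many sE unb).
Qed.

(** * Excluding frames, Riesz bases and Schauder bases *)

Section BoundedDual.
Hypothesis s_gt0 : (0 < size s)%N.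
Hypothesis alpha_range : (size s)%:R - 2^-1 <= alpha < (size s)%:R + 2^-1.
Hypothesis lambda_unbounded : forall B : R, exists n, B < `|lambda n|.

Let alpha_ge : (size s)%:R - 2^-1 <= alpha. Proof. by case/andP: alpha_range. Qed.
Let alpha_lt : alpha < (size s)%:R + 2^-1. Proof. by case/andP: alpha_range. Qed.

Let dual_family : exists g : int -> L2 R, forall n, n \notin s -> dual_vector n (g n).
Proof.
have h n : exists g, n \notin s -> dual_vector n g.
  have [ns|ns] := boolP (n \in s); first by exists 0.
  by have [g gn] := dual_vector_exists ns alpha_lt; exists g.
by exists (fun n => projT1 (cid (h n))) => n; case: cid.
Qed.

(** In the frame sum of the dual vector [g] at n only the term of index n is nonzero, and it is 1,
    so a |g|^2 <= 1. The bound 1/a + 1 on |g| follows from y <= y^2 + 1. *)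
Lemma weighted_not_frame : ~ is_frame (@L2_dot R) f J.
Proof.
move=> [a [b [a0 _ frame]]].
apply: (dual_unbounded s_gt0 alpha_ge lambda_unbounded); exists (a^-1 + 1) => n ns.
have [g gn] := dual_vector_exists ns alpha_lt; exists g => //.
have /andP[low _] := frame g.
have esum1 : (\esum_(m in J) (sqmod (L2_dot g (f m)))%:E = 1)%E.
  rewrite (esumID [set n]); last by move=> m _; rewrite lee_fin sqmod_ge0.
  have -> : J `&` [set n] = [set n].
    by apply/seteqP; split => [m []//|m ->]; split=> //; exact/negP.
  rewrite esum_set1 ?lee_fin ?sqmod_ge0 // L2_dotC (dual_vector_dot ns ns gn) eqxx conjC1.
  rewrite esum1 ?adde0 => [|m [/negP ms mn]].
    by rewrite sqmod_rnorm -[1]/(1%:C) rnorm_real normr1 expr1n.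
  rewrite L2_dotC (dual_vector_dot ns ms gn) (_ : (m == n) = false); last exact/eqP.
  by rewrite conjC0 sqmod_rnorm rnorm0 expr0n.
move: low; rewrite [X in (_ <= X)%E]esum1 lee_fin sqmod_rnorm.
rewrite (rnormE g) rnorm_real ger0_norm ?rnorm_ge0 //; exact: le_of_mul_sqr_le1.
Qed.

(** On the span of the orthonormal basis, and then by density, <V x, g_n> = <x, u_n>. As [V] is
    onto, the g_n are bounded pointwise, hence uniformly. *)
Lemma weighted_not_riesz : ~ riesz_basis (@L2_dot R) f J.
Proof.
move=> [u [V [[uu ucomplete] [B VB] Vbij fV]]].
have [g gP] := dual_family.
have u1 n : J n -> rnorm (u n) = 1.
  move=> Jn; have : rnorm (u n) ^+ 2 = 1 by rewrite L2_rnorm_dot uu // eqxx.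
  by move=> /eqP; rewrite sqrp_eq1 ?rnorm_ge0 // => /eqP.
have VB' x : rnorm (V x) <= `|B| * rnorm x.
  have := VB x; rewrite !rnormE -rmorphM /= lecR => /le_trans; apply.
  by rewrite ler_wpM2r ?rnorm_ge0 // ler_norm.
have Vg x n : J n -> L2_dot (V x) (g n) = L2_dot x (u n).
  move=> Jn; have ns : n \notin s by exact/negP.
  have span y : lspan u J y -> L2_dot (V y) (g n) = L2_dot y (u n).
    move=> [t [d [tJ ->]]]; rewrite linear_sum.
    rewrite (linear_sumlz (@L2_dot R)) (linear_sumlz (@L2_dot R)) /= big_seq [RHS]big_seq.
    apply: eq_bigr => m mt; have Jm := tJ m mt.
    rewrite linearZ [LHS](linearZl_LR (@L2_dot R)) [RHS](linearZl_LR (@L2_dot R)) /=.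
    congr (_ * _); rewrite -fV // [LHS](dual_vector_dot ns _ (gP n ns)); last exact/negP.
    by rewrite [RHS]uu.
  apply/eqP; rewrite -subr_eq0 -rnorm_eq0 eq_le rnorm_ge0 andbT.
  pose K := `|B| * rnorm (g n) + 1.
  have K0 : 0 < K by rewrite ltr_wpDl // mulr_ge0 // rnorm_ge0.
  apply/ler_addgt0Pr => a a0; rewrite add0r.
  have : closure (lspan u J) x by rewrite ucomplete.
  move=> /closure_rnormP /(_ (a / K) (divr_gt0 a0 K0))[y uy xy].
  have -> : L2_dot (V x) (g n) - L2_dot x (u n) =
      L2_dot (V (x - y)) (g n) - L2_dot (x - y) (u n).
    rewrite linearB [X in _ = X - _](linearBl (@L2_dot R)) [X in _ = _ - X](linearBl (@L2_dot R)) /=.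
    by rewrite [X in _ = _ - X - _](span y uy); ring.
  apply: le_trans (ler_rnormB _ _) _.
  have le1 := rnorm_dot_le (dot := @L2_dot R) (@L2_normE R) (V (x - y)) (g n).
  have le2 := rnorm_dot_le (dot := @L2_dot R) (@L2_normE R) (x - y) (u n).
  rewrite u1 // mulr1 in le2.
  apply: le_trans (lerD le1 le2) _.
  apply: (@le_trans _ _ (rnorm (x - y) * K)); last by rewrite -ler_pdivlMr // ltW.
  rewrite /K mulrDr mulr1 lerD2r mulrA ler_wpM2r ?rnorm_ge0 // mulrC; exact: VB'.
have [C hC] : exists C : R, forall n, J n -> rnorm (g n) <= C.
  apply: (uniform_boundedness (@L2_normE R) (@L2_geometric_cvg R)) => y.
  have [W _ VW] := Vbij; exists (rnorm (W y)) => n Jn.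
  rewrite -{1}(VW y) [X in rnorm X]Vg //.
  apply: le_trans (rnorm_dot_le (dot := @L2_dot R) (@L2_normE R) _ _) _.
  by rewrite u1 // mulr1.
apply: (dual_unbounded s_gt0 alpha_ge lambda_unbounded); exists C => n ns.
by exists (g n); [exact: gP|apply: hC; exact/negP].
Qed.

Lemma weighted_not_schauder (c : R) : 0 < c -> (forall n, n \notin s -> c <= rnorm (f n)) ->
  ~ schauder_basis f J.
Proof.
move=> c0 cf [_ [k kJ kexp]]; have [g gP] := dual_family.
have fg : biorthogonal (@L2_dot R) f g J.
  move=> n m /negP ns /negP ms.
  by rewrite [LHS](dual_vector_dot ms ns (gP m ms)).
have fexp (x : L2 R) : exists d : nat -> R[i], series (fun i => d i *: f (k i)) @ \oo --> x.
  by have [d [dx _]] := kexp x; exists d.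
have cf' n : J n -> c <= rnorm (f n) by move=> Jn; apply: cf; exact/negP.
have [C hC] := expansion_dual_bounded (@L2_normE R) (@L2_geometric_cvg R) kJ fg fexp c0
  cf'.
apply: (dual_unbounded s_gt0 alpha_ge lambda_unbounded); exists C => n ns.
by exists (g n); [exact: gP|apply: hC; exact/negP].
Qed.

End BoundedDual.

End Core.

End WeightedDual.

(** * Exponential bases *)

Section ExponentialSystems.
Context {R : realType}.
Local Notation mu := (@lebesgue_measure R).
Local Notation D := (`]0%R, 1%R[%classic : set R).

(** Pigeonhole: inside [-B, B] the lambda_i with i >= 0 would occupy pairwise distinct cells of
    length [d], of which there are finitely many. *)
Lemma separated_unbounded (lambda : int -> R) (d : R) : 0 < d ->
  (forall n m, n != m -> d <= `|lambda n - lambda m|) ->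
  forall B : R, exists n, B < `|lambda n|.
Proof.
move=> d0 sep B; apply: contrapT => nB.
have lB n : `|lambda n| <= B by rewrite leNgt; apply/negP => h; apply: nB; exists n.
pose k (i : nat) := Num.truncn ((lambda (Posz i) + B) / d).
have pos i : 0 <= (lambda i + B) / d.
  by rewrite divr_ge0 ?(ltW d0) // -lerBlDr sub0r; have := lB i; rewrite ler_norml => /andP[].
have kinj : injective k.
  move=> i j kij; apply/eqP; apply: contraT => ij.
  have /sep : Posz i != Posz j by rewrite eqz_nat.
  have := truncn_itv (pos i); have := truncn_itv (pos j); rewrite -/(k i) -/(k j) kij.
  move=> /andP[j1 j2] /andP[i1 i2].
  have : `|(lambda i + B) / d - (lambda j + B) / d| < 1.
    by move: j2 i2; rewrite -!natr1 ltr_norml => j2 i2; apply/andP; split; lra.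
  rewrite -mulrBl opprD addrACA subrr addr0 normrM normfV (gtr0_norm d0) ltr_pdivrMr // mul1r.
  by rewrite ltNge => /negP.
pose N := Num.truncn (2 * B / d).
have kN i : (k i <= N)%N.
  apply: le_truncn; rewrite ler_pM2r ?invr_gt0 //.
  by have := lB i; rewrite ler_norml => /andP[_ h]; lra.
have sub : {subset [seq k i | i <- iota 0 N.+2] <= iota 0 N.+1}.
  by move=> _ /mapP[i _ ->]; rewrite mem_iota /= add0n ltnS kN.
have := uniq_leq_size _ sub; rewrite map_inj_uniq // iota_uniq size_map !size_iota.
by move=> /(_ isT); rewrite ltnn.
Qed.

(** For distinct n and m, 1 = |<e_n - e_m, r_n>| <= 2 |lambda_n - lambda_m| |r_n|, and the r_n are
    bounded because the exponentials have norm 1. *)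
Lemma schauder_exp_unbounded (lambda : int -> R) (r : int -> L2 R) :
  schauder_basis (fun n => L2_exp (lambda n)) [set: int] ->
  biorthogonal (@L2_dot R) (fun n => L2_exp (lambda n)) r [set: int] ->
  forall B : R, exists n, B < `|lambda n|.
Proof.
move=> [_ [k kJ kexp]] er.
have fexp (x : L2 R) : exists d : nat -> R[i],
    series (fun i => d i *: L2_exp (lambda (k i))) @ \oo --> x.
  by have [d [dx _]] := kexp x; exists d.
have e1 n : [set: int] n -> 1 <= rnorm (L2_exp (lambda n)) by rewrite rnorm_L2_exp.
have [C hC] := expansion_dual_bounded (@L2_normE R) (@L2_geometric_cvg R) kJ er fexp ltr01 e1.
have C0 : 0 < 2 * (`|C| + 1) by rewrite mulr_gt0 // ltr_wpDl.
apply: (@separated_unbounded _ (2 * (`|C| + 1))^-1); first by rewrite invr_gt0.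
move=> n m nm; rewrite -(ler_pM2l C0) divff ?gt_eqF //.
have one : rnorm (L2_dot (L2_exp (lambda n) - L2_exp (lambda m)) (r n)) = 1.
  rewrite [X in rnorm X](linearBl (@L2_dot R)) /= [X in X - _]er // [X in _ - X]er //.
  by rewrite eqxx eq_sym (negbTE nm) subr0 -[1%:R]/(1%:C) rnorm_real normr1.
rewrite -[X in X <= _]one.
apply: le_trans (rnorm_dot_le (dot := @L2_dot R) (@L2_normE R) _ _) _.
rewrite (mulrC 2) -mulrA mulrC; apply: ler_pM; rewrite ?rnorm_ge0 //.
  by apply: le_trans (hC n I) _; apply: le_trans (ler_norm C) _; rewrite lerDl.
exact: rnorm_L2_expB.
Qed.

Lemma schauder_exp_total (lambda : int -> R) (r : int -> L2 R) :
  schauder_basis (fun n => L2_exp (lambda n)) [set: int] ->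
  biorthogonal (@L2_dot R) (fun n => L2_exp (lambda n)) r [set: int] ->
  forall x : L2 R, (forall n, L2_dot x (r n) = 0) -> x = 0.
Proof.
move=> [_ [k kJ kexp]] er x xr.
have fexp (y : L2 R) : exists d : nat -> R[i],
    series (fun i => d i *: L2_exp (lambda (k i))) @ \oo --> y.
  by have [d [dx _]] := kexp y; exists d.
by apply: (expansion_total (@L2_normE R) kJ er fexp) => n _; exact: xr.
Qed.

Lemma cos_sin_2pi_int (n : int) : cos (2 * pi * n%:~R) = 1 :> R /\ sin (2 * pi * n%:~R) = 0 :> R.
Proof.
have h (k : nat) : cos (2 * pi * k%:R) = 1 :> R /\ sin (2 * pi * k%:R) = 0 :> R.
  elim: k => [|k [c s]]; first by rewrite mulr0 cos0 sin0.
  rewrite -[k.+1]addn1 natrD mulrDr mulr1 cosD sinD c s [2 * pi]mulr_natl cos2pi sin2pi.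
  by split; ring.
case: n => k; first exact: h.
by have [c s] := h k.+1; rewrite NegzE mulrNz mulrN cosN sinN c s oppr0.
Qed.

Lemma integral_trig_period (k : int) : k != 0 ->
  \int[mu]_(t in D) cos (2 * pi * k%:~R * t) = 0 /\
  \int[mu]_(t in D) sin (2 * pi * k%:~R * t) = 0.
Proof.
move=> k0; set w := 2 * pi * k%:~R.
have w0 : w != 0 by rewrite !mulf_neq0 ?intr_eq0 // gt_eqF // pi_gt0.
have [cw sw] := cos_sin_2pi_int k; rewrite -/w in cw sw.
have mw : measurable_fun [set: R] (fun t : R => w * t) by exact: measurable_funM.
have dw (t : R) : is_derive t 1 (fun t : R => w * t) w.
  by have := is_deriveZ w (is_derive_id t 1); rewrite /GRing.scale /= mulr1.
have cwt (t : R) : {for t, continuous (fun t : R => w * t)}.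
  by apply: cvgM; [exact: cvg_cst|exact: cvg_id].
have main (G g : R -> R) : (forall t : R, is_derive t 1 G (g t)) ->
    (forall t : R, {for t, continuous g}) -> G 0 = G 1 -> \int[mu]_(t in D) g t = 0.
  move=> dG cg G01; have mg : measurable_fun [set: R] g by exact: continuous_measurable_fun.
  have I01 := integral_derivative (ltr01 : 0 < 1 :> R) (fun t _ => dG t) (fun t _ => cg t).
  rewrite /Rintegral integral_itv_bndo_bndc; last first.
    by apply/measurable_EFinP; exact: measurable_funTS.
  rewrite integral_itv_obnd_cbnd; last first.
    by apply/measurable_EFinP; exact: measurable_funTS.
  by rewrite I01 G01 subrr.
split.
  apply: (main (fun t => w^-1 * sin (w * t))) => [t|t|].
  - have := is_deriveZ w^-1 (is_derive1_comp (is_derive_sin (w * t)) (dw t)).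
    by rewrite /GRing.scale /= mulrCA mulVf // mulr1.
  - exact: (cvg_comp _ _ (cwt t) (@continuous_cos R (w * t))).
  - by rewrite mulr0 sin0 mulr1 sw.
apply: (main (fun t => - (w^-1 * cos (w * t)))) => [t|t|].
- have := is_deriveN (is_deriveZ w^-1 (is_derive1_comp (is_derive_cos (w * t)) (dw t))).
  by rewrite /GRing.scale /= mulrCA mulVf // mulr1 opprK.
- exact: (cvg_comp _ _ (cwt t) (@continuous_sin R (w * t))).
- by rewrite mulr0 cos0 mulr1 cw.
Qed.

Lemma trig_orthonormal :
  biorthogonal (@L2_dot R) (fun n : int => L2_exp (2 * pi * n%:~R))
    (fun n : int => L2_exp (2 * pi * n%:~R)) [set: int].
Proof.
move=> n m _ _; have [->|nm] := eqVneq n m.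
  by rewrite [LHS](dot_rnorm (dot := @L2_dot R) (@L2_normE R)) rnorm_L2_exp expr1n.
have nP l := L2_exp_square_integrable (l : R).
have nm0 : n - m != 0 by rewrite subr_eq0.
have [c s] := integral_trig_period nm0.
rewrite [LHS]L2_dot_class // /complex_integral; apply/eqP; rewrite eq_complex /=.
apply/andP; split; apply/eqP; [rewrite -[RHS]c|rewrite -[RHS]s];
  apply: eq_Rintegral => t _; rewrite rmorphB /= mulrBr mulrBl ?cosB ?sinB; ring.
Qed.

End ExponentialSystems.

Lemma finite_card_seq (T : choiceType) (A : set T) (M : nat) : (A #= `I_M)%card ->
  exists s : seq T, [/\ uniq s, size s = M & A = [set n | n \in s]].
Proof.
move=> AM; have fA : finite_set A by exists M.
exists (finmap.enum_fset (fset_set A)); split; first exact: finmap.fset_uniq.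
  exact: card_fset_set.
by apply/seteqP; split=> n; [move/mem_set|move=> An; apply: set_mem; move: An];
  rewrite /= (in_fset_set fA).
Qed.

Theorem theorem1p1 (R : realType) (A : set int) (M : nat) (alpha : R)
    (M_gt0 : (0 < M)%N) (cardA : (A #= `I_M)%card) (alpha_gt0 : 0 < alpha) :
  (forall (lambda : int -> R) (r : int -> L2 R),
     schauder_basis (fun n => L2_exp (lambda n)) [set: int] ->
     biorthogonal (@L2_dot R) (fun n => L2_exp (lambda n)) r [set: int] ->
     (exact_system (fun n => L2_mulpow alpha (r n)) (~` A) <->
        M%:R - 2^-1 <= alpha < M%:R + 2^-1) /\
     (M%:R - 2^-1 <= alpha < M%:R + 2^-1 ->
        ~ riesz_basis (@L2_dot R) (fun n => L2_mulpow alpha (r n)) (~` A) /\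
        ~ is_frame (@L2_dot R) (fun n => L2_mulpow alpha (r n)) (~` A))) /\
  ((exact_system (fun n : int => L2_mulpow alpha (L2_exp (2 * pi * n%:~R)))
      (~` A) <-> M%:R - 2^-1 <= alpha < M%:R + 2^-1) /\
   (M%:R - 2^-1 <= alpha < M%:R + 2^-1 ->
      ~ schauder_basis
          (fun n : int => L2_mulpow alpha (L2_exp (2 * pi * n%:~R))) (~` A))).
Proof.
have [s [us sM AE]] := finite_card_seq cardA; subst M A.
split=> [lambda r er_basis er|].
  have r_total := schauder_exp_total er_basis er.
  split; first exact: (weighted_exact_iff alpha_gt0 us er r_total M_gt0).
  move=> a_range; have unb := schauder_exp_unbounded er_basis er.
  split; first exact: (weighted_not_riesz alpha_gt0 us er M_gt0 a_range unb).
  exact: (weighted_not_frame alpha_gt0 us er M_gt0 a_range unb).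
(* The trigonometric system is orthonormal, so it is its own biorthogonal family and takes the place
   of [r]. *)
pose lambda (n : int) : R := 2 * pi * n%:~R.
have er : biorthogonal (@L2_dot R) (fun n => L2_exp (lambda n))
    (fun n => L2_exp (lambda n)) [set: int] := @trig_orthonormal R.
have e_total (x : L2 R) : (forall n, L2_dot x (L2_exp (lambda n)) = 0) -> x = 0.
  exact: L2_exp_total.
split; first exact: (weighted_exact_iff alpha_gt0 us er e_total M_gt0).
move=> a_range.
have unb (B : R) : exists n, B < `|lambda n|.
  apply: (@separated_unbounded _ _ (2 * pi)); first by rewrite mulr_gt0 ?pi_gt0.
  move=> n m nm; rewrite -mulrBr -rmorphB normrM ger0_norm ?mulr_ge0 ?pi_ge0 //.
  by rewrite ler_peMr ?mulr_ge0 ?pi_ge0 // -intr_norm ler1z -gtz0_ge1 normr_gt0 subr_eq0.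
(* The common norm of all t^alpha e_n is positive because multiplication by t^alpha is injective. *)
have [c c0 cE] : exists2 c : R, 0 < c & forall l, c <= rnorm (L2_mulpow alpha (L2_exp l)).
  exists (rnorm (L2_mulpow alpha (L2_exp (0 : R)))); last first.
    move=> l; rewrite le_eqVlt; apply/orP; left; apply/eqP.
    exact: (rnorm_L2_mulpow_exp 0 l (ltW alpha_gt0)).
  rewrite lt_neqAle rnorm_ge0 andbT eq_sym rnorm_eq0; apply/negP => /eqP.
  move=> /(L2_mulpow_eq0 (ltW alpha_gt0)) /(congr1 rnorm).
  by rewrite rnorm_L2_exp rnorm0 => /eqP; rewrite oner_eq0.
apply: (weighted_not_schauder alpha_gt0 us er M_gt0 a_range unb c0) => n _.
exact: cE.
Qed.
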